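(* Let $P$ be a polynomial on $\mathbb{R}^d$, $f\in\mathcal{S}(\mathbb{R}^d)$, and $0<R<\infty$. Then the following are equivalent: (a) There exists a function $\phi:\mathbb{N}\to\mathbb{R}_+$ such that $$\liminf_{n\to\infty}\phi(n)^{1/n}\ge 1/R$$ and $$\sup_{n\in\mathbb{N}}\phi(n)\,\bigl\|(1+|x|)^{d+1}P(\partial)^n f\bigr\|_\infty<\infty;$$ (b) For each $N\in\mathbb{N}_0$, there exists a constant $C$ such that, for all $n\in\mathbb{N}$ and $x\in\mathbb{R}^d$, $$|P(\partial)^n f(x)|\le C\,n^N R^n(1+|x|)^{-N};$$ (c) $R(P,\mathcal{F}f)\le R$.
   Context: $\mathbb{N}=\{1,2,3,\ldots\}$, $\mathbb{N}_0=\{0,1,2,\ldots\}$, $\mathbb{R}_+=[0,\infty)$; $\mathcal{S}(\mathbb{R}^d)$ is the Schwartz space. Polynomials have complex coefficients. For a polynomial $P$ on $\mathbb{R}^d$, $P(\partial)$ is the corresponding constant coefficient differential operator, so that $P(\partial)e^{i\lambda\cdot x}=P(i\lambda)e^{i\lambda\cdot x}$. The Fourier transform is $\mathcal{F}f(\lambda)=(2\pi)^{-d/2}\int_{\mathbb{R}^d}f(x)e^{-i\lambda\cdot x}\,dx$. For a distribution $T$ on $\mathbb{R}^d$, $R(P,T)=\sup\{|P(i\lambda)|:\lambda\in\operatorname{supp}T\}\in[0,\infty]$, with $R(P,T)=0$ if $T=0$. *)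

(* Defs.v *)
From HB Require Import structures.
From mathcomp Require Import all_boot all_order all_algebra.
From mathcomp Require Import all_classical all_reals all_analysis.
From mathcomp Require Import complex.
From mathcomp Require mpoly.
Import Order.TTheory GRing.Theory Num.Theory numFieldNormedType.Exports.

Set Implicit Arguments.
Unset Strict Implicit.
Unset Printing Implicit Defensive.

Local Open Scope classical_set_scope.
Local Open Scope ring_scope.

(* [mpoly] is not imported because its notations clash with those of
   [all_analysis]. *)
Definition cpoly (K : realType) (d : nat) := mpoly.mpoly d K[i].

Section EuclideanSpace.
Variables (K : realType) (d : nat).
Implicit Types (x y : 'rV[K]_d) (f g : 'rV[K]_d -> K[i]).

Definition dotv x y : K := \sum_(j < d) x 0 j * y 0 j.

(* The library norm on ['rV[K]_d] is the maximum norm. *)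
Definition enorm x : K := Num.sqrt (dotv x x).

Definition cabs (z : K[i]) : K := ComplexField.Normc.normc z.

(* [K[i]] carries no normed [K]-module structure in the library, so analytic
   notions for complex-valued functions are stated through these. *)
Definition Ref f : 'rV[K]_d -> K := fun x => complex.Re (f x).
Definition Imf f : 'rV[K]_d -> K := fun x => complex.Im (f x).

Definition basisv (j : 'I_d) : 'rV[K]_d := delta_mx 0 j.

Definition partial (j : 'I_d) f : 'rV[K]_d -> K[i] := fun x =>
  ('D_(basisv j) (Ref f) x +i* 'D_(basisv j) (Imf f) x)%C.

Definition partials (s : seq 'I_d) f := foldr partial f s.

Definition mpartial (a : 'I_d -> nat) f :=
  foldr (fun j g => iter (a j) (partial j) g) f (enum 'I_d).

Definition monomial (a : 'I_d -> nat) x : K := \prod_(j < d) x 0 j ^+ a j.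

Definition ccontinuous f := continuous (Ref f) /\ continuous (Imf f).

Definition smooth f := forall s : seq 'I_d,
  ccontinuous (partials s f) /\
  forall (j : 'I_d) x, derivable (Ref (partials s f)) x (basisv j) /\
                       derivable (Imf (partials s f)) x (basisv j).

Definition schwartz f := smooth f /\
  forall a b : 'I_d -> nat, exists C : K, forall x,
    cabs ((monomial a x)%:C%C * mpartial b f x) <= C.

Definition supnorm (f : 'rV[K]_d -> K[i]) : \bar K :=
  ereal_sup [set (cabs (f x))%:E | x in [set: 'rV[K]_d]].

Definition pdiff (P : cpoly K d) f : 'rV[K]_d -> K[i] := fun x =>
  \sum_(m <- mpoly.msupp P)
    mpoly.mcoeff m P * mpartial (fun j => mpoly.fun_of_multinom m j) f x.

(* P(i lambda) *)
Definition symbol (P : cpoly K d) (l : 'rV[K]_d) : K[i] :=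
  mpoly.meval (fun j => (0 +i* l 0 j)%C) P.

End EuclideanSpace.

(* Lebesgue measure on K^n: the n-fold product of [lebesgue_measure], along the
   bijection (s, t) |-> s :: t from K * K^m to K^m.+1. *)
Fixpoint lebesgue_tuple (K : realType) (n : nat) :
    set (n.-tuple (measurableTypeR K)) -> \bar K :=
  if n is m.+1 then
    pushforward (lebesgue_measure \x lebesgue_tuple (n := m))%E
      (fun p : measurableTypeR K * m.-tuple (measurableTypeR K) =>
         cons_tuple p.1 p.2)
  else \d_([tuple]).

Section SigmaFinitePushforward.
Context d1 d2 d3 (T1 : measurableType d1) (T2 : measurableType d2)
  (T3 : measurableType d3) (R : realType).
Variables (m1 : {sigma_finite_measure set T1 -> \bar R})
  (m2 : {sigma_finite_measure set T2 -> \bar R}).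
Variables (h : T1 * T2 -> T3) (hinv : T3 -> T1 * T2).
Hypotheses (mh : measurable_fun setT h) (mhinv : measurable_fun setT hinv)
  (hK : cancel h hinv).

Let push := pushforward (m1 \x m2)%E h.

Let push0 : push set0 = 0%E.
Proof. by rewrite /push /pushforward preimage_set0 measure0. Qed.

Let push_ge0 A : (0 <= push A)%E.
Proof. exact: measure_ge0. Qed.

Let push_sigma_additive : semi_sigma_additive push.
Proof. exact: (@measure_semi_sigma_additive _ _ _ (pushforward _ _)). Qed.

HB.instance Definition _ := isMeasure.Build _ _ _ push
  push0 push_ge0 push_sigma_additive.

Let push_sigma_finite : sigma_finite setT push.
Proof.
have /sigma_finiteP[F [TF ndF Foo]] := sigma_finiteT m1.
have /sigma_finiteP[G [TG ndG Goo]] := sigma_finiteT m2.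
exists (fun n => hinv @^-1` (F n `*` G n)).
  rewrite -preimage_bigcup -(preimage_setT hinv); congr (_ @^-1` _).
  rewrite -setXTT TF TG predeqE => -[x y]; split.
    move=> [/= [n _ Fnx] [k _ Gky]]; exists (maxn n k) => //; split.
    - by move: x Fnx; exact/subsetPset/ndF/leq_maxl.
    - by move: y Gky; exact/subsetPset/ndG/leq_maxr.
  by move=> [n _ []/= ? ?]; split; exists n.
move=> k; have [? ?] := Foo k; have [? ?] := Goo k; split.
  by rewrite -[X in measurable X]setTI; apply: mhinv => //; exact: measurableX.
rewrite /push /pushforward -comp_preimage (_ : hinv \o h = id); last exact/funext.
by rewrite /= product_measure1E// lte_mul_pinfty// ge0_fin_numE.
Qed.

HB.instance Definition _ := Measure_isSigmaFinite.Build _ _ _ push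
  push_sigma_finite.

Lemma sigma_finite_pushforward :
  exists mu : {sigma_finite_measure set T3 -> \bar R}, push = mu.
Proof. by exists push. Qed.
End SigmaFinitePushforward.

Lemma lebesgue_tupleE (K : realType) (n : nat) : exists mu :
    {sigma_finite_measure set (n.-tuple (measurableTypeR K)) -> \bar K},
  @lebesgue_tuple K n = mu.
Proof.
elim: n => [|n [mu IH]] /=.
  by exists (\d_([tuple] : 0.-tuple (measurableTypeR K)))%R.
rewrite IH.
apply: (@sigma_finite_pushforward _ _ _ _ _ _ _ _ _ _ (fun t => (thead t, behead_tuple t))).
- exact: measurable_cons.
- apply/measurable_fun_pairP; split.
    exact: measurable_tnth.
  exact: measurable_behead.
- by case=> a b; congr pair; apply: val_inj.
Qed.

Section LebesgueTuple.
Variables (K : realType) (n : nat).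
Let mu := @lebesgue_tuple K n.

Let mu0 : mu set0 = 0%E.
Proof. by rewrite /mu; have [nu ->] := lebesgue_tupleE K n. Qed.

Let mu_ge0 A : (0 <= mu A)%E.
Proof. by rewrite /mu; have [nu ->] := lebesgue_tupleE K n. Qed.

Let mu_sigma_additive : semi_sigma_additive mu.
Proof.
rewrite /mu; have [nu ->] := lebesgue_tupleE K n.
exact: measure_semi_sigma_additive.
Qed.

HB.instance Definition _ := isMeasure.Build _ _ _ (@lebesgue_tuple K n)
  mu0 mu_ge0 mu_sigma_additive.

Let mu_sigma_finite : sigma_finite setT mu.
Proof.
rewrite /mu; have [nu ->] := lebesgue_tupleE K n.
exact: sigma_finiteT.
Qed.

HB.instance Definition _ := Measure_isSigmaFinite.Build _ _ _
  (@lebesgue_tuple K n) mu_sigma_finite.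

End LebesgueTuple.

Section Fourier.
Variables (K : realType) (d : nat).
Implicit Types (f g psi : 'rV[K]_d -> K[i]) (l : 'rV[K]_d).

Definition row_of_tuple (t : d.-tuple (measurableTypeR K)) : 'rV[K]_d :=
  \row_(j < d) tnth t j.

Definition integralRd (g : 'rV[K]_d -> K[i]) : K[i] :=
  ((\int[@lebesgue_tuple K d]_t Ref g (row_of_tuple t)) +i*
   (\int[@lebesgue_tuple K d]_t Imf g (row_of_tuple t)))%C.

Definition fourier f : 'rV[K]_d -> K[i] := fun l =>
  ((2 * pi) `^ (- (d%:R / 2)))%:C%C *
  integralRd (fun x => f x * (cos (dotv l x) -i* sin (dotv l x))%C).

Definition fsupp psi := closure [set x | psi x != 0].

Definition test_function psi := smooth psi /\ compact (fsupp psi).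

(* Support of a distribution, given by its action [T] on test functions: the
   complement of the largest open set on which [T] vanishes. *)
Definition dsupp (T : ('rV[K]_d -> K[i]) -> K[i]) : set 'rV[K]_d :=
  [set l | forall U : set 'rV[K]_d, open U -> U l ->
    exists psi, [/\ test_function psi, fsupp psi `<=` U & T psi != 0]].

Definition regular_dist g : ('rV[K]_d -> K[i]) -> K[i] :=
  fun psi => integralRd (fun x => g x * psi x).

(* The point 0 is adjoined so that the supremum is 0 when [T] = 0. *)
Definition Rsup (P : cpoly K d) (T : ('rV[K]_d -> K[i]) -> K[i]) : \bar K :=
  ereal_sup (0%E |` [set (cabs (symbol P l))%:E | l in dsupp T]).

End Fourier.

(* Main.v *)
Require Import Defs.
From HB Require Import structures.
From mathcomp Require Import all_boot all_order all_algebra.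
From mathcomp Require Import all_classical all_reals all_analysis.
From mathcomp Require Import complex measurable_realfun.
From mathcomp Require Import ring lra.
Import Order.TTheory GRing.Theory Num.Theory numFieldNormedType.Exports.

Set Implicit Arguments.
Unset Strict Implicit.
Unset Printing Implicit Defensive.

Local Open Scope classical_set_scope.
Local Open Scope ring_scope.

(* The unnormalised Fourier transform turns P(d) into multiplication by P(i l), and by
   bump functions the condition R(P, F f) <= R says that |P(i l)| <= R wherever
   F f <> 0.

   (a) -> (c): the supremum bound makes phi(n) |P(i l)|^n |F f (l)| bounded in n. If
   |P(i l)| > R then phi(n) |P(i l)|^n grows geometrically, so F f (l) = 0.

   (c) -> (b): induction on N, for all Schwartz functions with this spectral condition at
   once. For N = 0, F(P(d)^n f) = O(R^n prod_j (1 + l_j^2)^-1), and an L^oo inversion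
   inequality applies. For the step, with Q = [P(d), x_j],
     x_j P(d)^n f = P(d)^n (x_j f) - n P(d)^(n-1) Q f,
   and both x_j f and Q f satisfy the spectral condition again.

   (b) -> (a): phi(n) = R^-n n^-(d+1).

   The inversion inequality needs no inverse transform: on the line an Abel-regularised
   inversion integral is a Cauchy (Poisson) kernel, which is an approximate identity, and
   the dimension is raised by freezing one coordinate at a time. *)

(** The condition that [|P(i l)| <= R] wherever [F f <> 0] is local in [l]: if [|P(i l)| > R], the
    same holds near [l], so [F f] vanishes on a neighbourhood of [l] and its derivatives vanish at
    [l]. This is why [x_j f] inherits it; [Q f] inherits it because [F(Q f)] is a multiple of [F f].
    Each power of [x_j] then costs one factor [n], which is the origin of [n^N] in (b).

    The decay of [F f] is measured by the product of the [(1 + l_j^2)^-1] and not by a power of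
    [1 + |l|] because the product factors: while one coordinate is inverted, the other factors only
    rescale the bound. Each coordinate costs a constant independent of [n], which (b) can absorb.

    With bound 0 the inversion inequality is the injectivity of the Fourier transform. In this form
    it shows that every point with [F f <> 0] lies in the distributional support, which links (c) to
    the pointwise condition. *)

Section PointwiseDerivative.
Variables (K : realType) (V : normedModType K).
Implicit Types (f g : V -> K) (x v : V) (c : K).

(** Reduces directional derivatives to derivatives in one real variable, where the chain rule and
    the mean value theorem are available. *)
Lemma is_derive_line f x v (s df : K) : is_derive (s *: v + x) v f df <->
  is_derive s (1:K) (fun h : K => f (h *: v + x)) df.
Proof.
have E : (fun h : K => h^-1 *: ((f \o shift (s *: v + x)) (h *: v) - f (s *: v + x))) =
  (fun h : K => h^-1 *: (((fun h : K => f (h *: v + x)) \o shift s) (h *: (1 : K))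
     - f (s *: v + x))).
  by apply/funext => h /=; rewrite [h *: 1]mulr1 scalerDl addrA.
by split=> -[df1 df2]; apply: DeriveDef; move: df1 df2; rewrite /derivable /derive E.
Qed.

Lemma is_derive_line0 f x v (df : K) : is_derive x v f df <->
  is_derive (0:K) (1:K) (fun h : K => f (h *: v + x)) df.
Proof. by rewrite -is_derive_line scale0r add0r. Qed.

Lemma isdM f g x v df dg : is_derive x v f df -> is_derive x v g dg ->
  is_derive x v (fun y => f y * g y) (f x * dg + g x * df).
Proof. exact: is_deriveM. Qed.

Lemma isdD f g x v df dg : is_derive x v f df -> is_derive x v g dg ->
  is_derive x v (fun y => f y + g y) (df + dg).
Proof. exact: is_deriveD. Qed.

Lemma isdB f g x v df dg : is_derive x v f df -> is_derive x v g dg ->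
  is_derive x v (fun y => f y - g y) (df - dg).
Proof. exact: is_deriveB. Qed.

Lemma isdN f x v df : is_derive x v f df -> is_derive x v (fun y => - f y) (- df).
Proof. exact: is_deriveN. Qed.

Lemma isdC c x v : is_derive x v (fun=> c) 0.
Proof. exact: is_derive_cst. Qed.

Lemma isdZ c f x v df : is_derive x v f df -> is_derive x v (fun y => c * f y) (c * df).
Proof. by move=> /(isdM (isdC c x v)); rewrite mulr0 addr0. Qed.

Lemma isd_comp f x v df (h : K -> K) dh : is_derive x v f df ->
  is_derive (f x) (1:K) h dh -> is_derive x v (fun y => h (f y)) (dh * df).
Proof.
move=> /is_derive_line0 fd hd; apply/is_derive_line0.
have hd' : is_derive (f (0 *: v + x)) (1:K) h dh by rewrite scale0r add0r.
by have := @is_derive1_comp K h (fun s => f (s *: v + x)) 0 dh df hd' fd; rewrite mulrC.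
Qed.

Lemma isd_ext f g x v df dg : (forall y, f y = g y) -> df = dg ->
  is_derive x v f df -> is_derive x v g dg.
Proof. by move=> /funext -> ->. Qed.

End PointwiseDerivative.

Section Coordinate.
Variable K : realType.

Lemma isd_coord d (i j : 'I_d) (x : 'rV[K]_d) :
  is_derive x (basisv K j) (fun y : 'rV[K]_d => y 0 i) (i == j)%:R.
Proof.
apply/is_derive_line0.
apply: (isd_ext (f := fun h : K => (i == j)%:R * h + x 0 i) (df := (i == j)%:R * 1 + 0)).
- by move=> h; rewrite !mxE/= mulrC.
- by rewrite mulr1 addr0.
Qed.

Lemma is_derive1_continuous (f : K -> K) (x df : K) : is_derive x (1:K) f df ->
  {for x, continuous f}.
Proof. by move=> [/derivable1_diffP /differentiable_continuous]. Qed.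

End Coordinate.

(** * The sum norm, splitting off a coordinate, and measurability of open sets *)

Section RealVectors.
Variable K : realType.

(** The sum norm is used for the weights because it is additive when a coordinate is split off, see
    [n1_consr]. *)
Definition n1 d (x : 'rV[K]_d) : K := \sum_(j < d) `|x 0 j|.

Lemma n1_ge0 d (x : 'rV[K]_d) : 0 <= n1 x.
Proof. by apply: sumr_ge0. Qed.

Lemma coord_le_n1 d (x : 'rV[K]_d) j : `|x 0 j| <= n1 x.
Proof. by rewrite /n1 (bigD1 j)//= lerDl sumr_ge0. Qed.

Lemma n1D d (x y : 'rV[K]_d) : n1 (x + y) <= n1 x + n1 y.
Proof. by rewrite /n1 -big_split/=; apply: ler_sum => j _; rewrite mxE ler_normD. Qed.

Lemma rV_normE d (x : 'rV[K]_d) e : 0 < e ->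
  (`|x| < e) <-> (forall j, `|x 0 j| < e).
Proof.
move=> e0; split => [xe j|xe].
  apply: le_lt_trans xe; rewrite [leRHS]mx_normrE.
  exact: (le_bigmax _ (fun ij : 'I_1 * 'I_d => `|x ij.1 ij.2|) (0, j)).
by rewrite [ltLHS]mx_normrE; apply/bigmax_ltP; split => // -[i j] _; rewrite ord1.
Qed.

Lemma norm_le_n1 d (x : 'rV[K]_d) : `|x| <= n1 x.
Proof.
rewrite [leLHS]mx_normrE; apply/bigmax_leP; split; first exact: n1_ge0.
by move=> [i j] _; rewrite ord1 coord_le_n1.
Qed.

Lemma n1_le_norm d (x : 'rV[K]_d) : n1 x <= d%:R * `|x|.
Proof.
have -> : d%:R * `|x| = \sum_(j < d) `|x| by rewrite sumr_const card_ord mulr_natl.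
apply: ler_sum => j _.
rewrite [leRHS]mx_normrE.
exact: (le_bigmax _ (fun ij : 'I_1 * 'I_d => `|x ij.1 ij.2|) (0, j)).
Qed.

(** Row-vector form of the bijection that defines [lebesgue_tuple]; slices of functions are taken
    along it. *)
Definition consr d (t : K) (x : 'rV[K]_d) : 'rV[K]_d.+1 :=
  \row_j oapp (x 0) t (unlift ord0 j).

Lemma consr0 d t (x : 'rV[K]_d) : consr t x 0 ord0 = t.
Proof. by rewrite mxE unlift_none. Qed.

Lemma consrS d t (x : 'rV[K]_d) j : consr t x 0 (lift ord0 j) = x 0 j.
Proof. by rewrite mxE liftK. Qed.

Lemma consr_eta d (x : 'rV[K]_d.+1) :
  x = consr (x 0 ord0) (\row_j x 0 (lift ord0 j)).
Proof.
apply/rowP => j; case: (unliftP ord0 j) => [k ->|->]; last by rewrite consr0.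
by rewrite consrS mxE.
Qed.

Lemma n1_consr d t (x : 'rV[K]_d) : n1 (consr t x) = `|t| + n1 x.
Proof.
rewrite /n1 big_ord_recl consr0; congr (_ + _).
by apply: eq_bigr => j _; rewrite consrS.
Qed.

Lemma row_of_tuple_cons d t (u : d.-tuple (measurableTypeR K)) :
  row_of_tuple [tuple of t :: u] = consr t (row_of_tuple u).
Proof.
apply/rowP => j; case: (unliftP ord0 j) => [k ->|->]; rewrite !mxE.
  by rewrite liftK/= mxE tnthS.
by rewrite unlift_none.
Qed.

(** The measurable structure on tuples is generated by the coordinates and the topology on rows by
    the maximum norm. An open set is the union of the half-open grid boxes of side [1/(k+1)] that it
    contains, and there are countably many of these. *)
Lemma measurable_open_row d (U : set 'rV[K]_d) : open U ->
  measurable (@row_of_tuple K d @^-1` U).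
Proof.
move=> oU.
pose B (kz : nat * d.-tuple int) : set (d.-tuple (measurableTypeR K)) :=
  \bigcap_(j in [set: 'I_d]) ((@tnth d (measurableTypeR K) ^~ j) @^-1`
     `[(tnth kz.2 j)%:~R / kz.1.+1%:R, (tnth kz.2 j + 1)%:~R / kz.1.+1%:R[%classic).
have BE kz t : B kz t <-> forall j, (tnth kz.2 j)%:~R / kz.1.+1%:R <= tnth t j <
      (tnth kz.2 j + 1)%:~R / kz.1.+1%:R.
  by split => H j; have := H j; rewrite /= in_itv/=; [apply|].
have -> : @row_of_tuple K d @^-1` U =
    \bigcup_(kz in [set kz | B kz `<=` @row_of_tuple K d @^-1` U]) B kz.
  apply/seteqP; split => [t Ut|t [kz kzU] Bt]; last exact: kzU.
  have : nbhs (row_of_tuple t) U by rewrite nbhsE/=; exists U.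
  move=> /nbhs_ballP[e /= e0 eU].
  pose k := Num.truncn e^-1.
  have ke : (k.+1%:R)^-1 < e by rewrite invf_plt ?posrE// truncnS_gt.
  have k0 : 0 < k.+1%:R :> K by [].
  pose z := [tuple Num.floor (tnth t j * k.+1%:R) | j < d].
  have Bt : B (k, z) t.
    apply/BE => j; rewrite /z tnth_mktuple /= ler_pdivrMr// ltr_pdivlMr//.
    by rewrite floor_le floorD1_gt.
  exists (k, z) => // u /BE Bu; apply: eU.
  rewrite -ball_normE/= rV_normE// => j; rewrite !mxE.
  apply: le_lt_trans ke.
  have := Bu j; move/BE: Bt => /(_ j)/=; rewrite !intrD !mulr1z !mulrDl !mul1r => /andP[a1 a2] /andP[b1 b2].
  have aux (p q r i : K) : r <= p -> p < r + i -> r <= q -> q < r + i ->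
    p - i <= q <= p + i by lra.
  by rewrite ler_distlC; exact: aux b1 b2.
rewrite bigcup_mkcond; apply: countable_bigcupT_measurable => //= kz.
case: ifPn => // _; apply: fin_bigcap_measurable => //= j _.
by rewrite -[X in measurable X]setTI; apply: measurable_tnth.
Qed.

End RealVectors.

(** * Iterated integrals on R^d *)

Section TupleIntegral.
Variable K : realType.
Local Notation mu n := (@lebesgue_tuple K n).
Local Notation leb := (@lebesgue_measure K).

Lemma continuous_measurable_row d (h : 'rV[K]_d -> K) : continuous h ->
  measurable_fun setT (fun t : d.-tuple (measurableTypeR K) => h (row_of_tuple t)).
Proof.
move=> ch; apply: (measurability _ (RGenOInfty.measurableE K)) => /= _ [_ [x ->] <-].
rewrite setTI; have oU : open (h @^-1` `]x, +oo[).
  by apply: open_comp => // ? _; exact: ch.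
exact: (measurable_open_row oU).
Qed.

Let cons_pair n (p : measurableTypeR K * n.-tuple (measurableTypeR K)) :=
  [tuple of p.1 :: p.2].

Let measurable_cons_pair n : measurable_fun setT (@cons_pair n).
Proof. exact: measurable_cons. Qed.

Lemma measurable_integral_tuple n (F : n.+1.-tuple (measurableTypeR K) -> \bar K) :
  measurable_fun setT F -> (forall t, 0 <= F t)%E ->
  measurable_fun [set: measurableTypeR K] (fun x => \int[mu n]_u F [tuple of x :: u])%E.
Proof.
move=> mF F0.
apply: (measurable_fun_fubini_tonelli_F (F \o @cons_pair n)); last by move=> x; exact: F0.
exact: (measurableT_comp mF (@measurable_cons_pair n)).
Qed.

Lemma integral_tupleS_ge0 n (F : n.+1.-tuple (measurableTypeR K) -> \bar K) :
  measurable_fun setT F -> (forall t, 0 <= F t)%E ->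
  (\int[mu n.+1]_t F t = \int[leb]_x \int[mu n]_u F [tuple of x :: u])%E.
Proof.
move=> mF F0.
(* By definition [lebesgue_tuple] in dimension [n.+1] is this pushforward; restating the integral
   makes the change of variables applicable. *)
transitivity (\int[pushforward (leb \x mu n) (@cons_pair n)]_t F t)%E; first by [].
rewrite (ge0_integral_pushforward (@measurable_cons_pair n))//.
rewrite preimage_setT/= (fubini_tonelli1 (F \o @cons_pair n))//.
- exact: (measurableT_comp mF (@measurable_cons_pair n)).
- by move=> x; exact: F0.
Qed.

Lemma integrable_cons_pair n (F : n.+1.-tuple (measurableTypeR K) -> \bar K) :
  (mu n.+1).-integrable setT F ->
  (leb \x mu n)%E.-integrable setT (F \o @cons_pair n).
Proof.
move=> /integrableP[mF Foo]; apply/integrableP; split.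
  exact: (measurableT_comp mF (@measurable_cons_pair n)).
apply: le_lt_trans Foo.
have -> : (\int[mu n.+1]_t (abse \o F) t =
   \int[pushforward (leb \x mu n) (@cons_pair n)]_t (abse \o F) t)%E by [].
rewrite (ge0_integral_pushforward (@measurable_cons_pair n))//.
  exact: measurableT_comp.
by move=> y _; rewrite /= abse_ge0.
Qed.

Lemma integral_tupleS n (F : n.+1.-tuple (measurableTypeR K) -> \bar K) :
  (mu n.+1).-integrable setT F ->
  (\int[mu n.+1]_t F t = \int[leb]_x \int[mu n]_u F [tuple of x :: u])%E.
Proof.
move=> iF; have iG := integrable_cons_pair iF.
transitivity (\int[pushforward (leb \x mu n) (@cons_pair n)]_t F t)%E; first by [].
rewrite (integral_pushforward (@measurable_cons_pair n))//; first last.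
  exact: (measurable_int (mu n.+1)).
by rewrite preimage_setT/= -(integral12_prod_meas1 iG).
Qed.

(** The order in which the first coordinate is integrated innermost, needed for derivatives in that
    coordinate. *)
Lemma integral_tupleS' n (F : n.+1.-tuple (measurableTypeR K) -> \bar K) :
  (mu n.+1).-integrable setT F ->
  (\int[mu n.+1]_t F t = \int[mu n]_u \int[leb]_x F [tuple of x :: u])%E.
Proof.
move=> iF; have iG := integrable_cons_pair iF.
by rewrite integral_tupleS// (Fubini iG).
Qed.

End TupleIntegral.

(** * Integration on the line: the Cauchy kernel and the fundamental theorem on unbounded sets *)

Section Line.
Variable K : realType.
Local Notation leb := (@lebesgue_measure K).
Local Notation RT := (measurableTypeR K).
Implicit Types (g G h : K -> K) (a b t u x y C : K).

(** The substitution [(t - y) / a] reduces to [1 / (1 + t^2)], whose half-line integral [pi / 2] is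
    doubled by symmetry. *)
Lemma integral_cauchy a y : 0 < a ->
  (\int[leb]_t (a / (a ^+ 2 + (t - y) ^+ 2))%:E = (pi : K)%:E)%E.
Proof.
move=> a0.
have dF t : is_derive t (1:K) (fun t : K => (t - y) / a) a^-1.
  apply: (isd_ext (f := fun t => a^-1 * (t - y)) (df := a^-1 * (1 - 0))).
  - by move=> z; rewrite mulrC.
  - by rewrite subr0 mulr1.
have F'E : (fun t : K => (t - y) / a)^`()%classic = cst a^-1.
  by apply/funext => t; rewrite derive1E; apply: derive_val.
have pi1 : (\int[leb]_t ((oneDsqr t)^-1)%:E = (pi : K)%:E)%E.
  rewrite (@ge0_symfun_integralT K (fun t => (oneDsqr t)^-1))//.
  - have -> : [set x : K | 0 <= x] = `[0, +oo[%classic.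
      by apply/seteqP; split => x /=; rewrite in_itv/= andbT.
    by rewrite integral0y_oneDsqr -EFinM mulrC divfK.
  - exact: continuous_oneDsqrV.
  - by move=> x; rewrite /oneDsqr/= sqrrN.
have key (t : K) : a / (a ^+ 2 + (t - y) ^+ 2) = (1 + ((t - y) / a) ^+ 2)^-1 * a^-1.
  have ? : a ^+ 2 + (t - y) ^+ 2 != 0.
    by rewrite gt_eqF// ltr_pwDl ?sqr_ge0// exprn_gt0.
  by field; rewrite gt_eqF.
rewrite -pi1 (@increasing_ge0_integration_by_substitutionT K (fun t : K => (t - y) / a)
  (fun t => (oneDsqr t)^-1)).
- by apply: eq_integral => t _; rewrite F'E; congr EFin; exact: key.
- by move=> u v uv; rewrite ltr_pM2r ?invr_gt0// ltrD2r.
- by rewrite F'E; exact: cst_continuous.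
- by rewrite F'E; exact: is_cvg_cst.
- by rewrite F'E; exact: is_cvg_cst.
- by move=> t; have [] := dF t.
- apply: gt0_cvgMlNy; first by rewrite invr_gt0.
  exact: cvg_addrr_Ny.
- apply: gt0_cvgMly; first by rewrite invr_gt0.
  exact: cvg_addrr.
- exact: continuous_oneDsqrV.
- by move=> t; rewrite invr_ge0 /oneDsqr addr_ge0// sqr_ge0.
Qed.

(** The integral over [J] is the limit of those over the compact intervals [[p n, q n]], by
    dominated convergence of the truncations of [g] with majorant [|g|]. Keeping [J] general covers
    both the whole line and the half-line. *)
Lemma FTC_cvg (J : set RT) (p q : nat -> K) g G (A : K) : measurable J ->
  leb.-integrable J (EFin \o g) -> continuous g ->
  (forall t, J t -> is_derive t 1 G (g t)) -> continuous G ->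
  (forall n, p n < q n) -> (forall n, `[p n, q n] `<=` J) ->
  (forall t, J t -> \forall n \near \oo, t \in `[p n, q n]) ->
  (fun n => G (q n) - G (p n)) @ \oo --> A ->
  \int[leb]_(t in J) g t = A.
Proof.
move=> mJ ig cg dG cG pq pqJ Jpq GA.
have mg : measurable_fun setT g by exact: continuous_measurable_fun.
pose f n t := (g \_ `[p n, q n]) t.
have fE n : (\int[leb]_(t in J) (f n t)%:E)%E = (G (q n) - G (p n))%:E.
  transitivity (\int[leb]_(t in `[p n, q n]) (g t)%:E)%E.
    rewrite [RHS]integral_mkcond [LHS]integral_mkcond; apply: eq_integral => t _.
    rewrite /f !patchE/=; case: ifPn => [_|tJ]; case: ifPn => // tpq.
    by rewrite inE in tpq; move: tJ; rewrite notin_setE => -[]; exact: pqJ tpq.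
  rewrite (@continuous_FTC2 _ g G) => //.
  - by apply: continuous_subspaceT.
  - split.
    + move=> t tpq; have [] := dG t => //; apply: (pqJ n) => /=.
      exact: subset_itv_oo_cc tpq.
    + by apply: cvg_at_right_filter; exact: cG.
    + by apply: cvg_at_left_filter; exact: cG.
  - move=> t tpq; rewrite derive1E; have tJ : J t.
      by apply: (pqJ n) => /=; exact: subset_itv_oo_cc tpq.
    by have := dG t tJ => ?; apply: derive_val.
have := @dominated_convergence _ _ _ leb J mJ (fun n t => (f n t)%:E)
  (EFin \o g) (fun t => `|g t|%:E).
case.
- move=> n; apply/measurable_EFinP; apply: measurable_funTS.
  by apply/measurable_restrict => //; exact: measurable_funTS.
- by apply/measurable_EFinP; exact: measurable_funTS.
- apply: aeW => t Jt; apply: cvg_EFin; first exact: nearW.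
  apply: cvg_near_cst; near=> n; rewrite /f /= patchE ifT//.
  by rewrite inE; near: n; exact: Jpq.
- by have := integrable_norm ig; apply: eq_integrable.
- apply: aeW => t n Jt; rewrite /f /= patchE lee_fin.
  by case: ifPn => //; rewrite normr0.
move=> _ _; under eq_fun do rewrite fE.
move=> GI.
have GA' : (G (q n) - G (p n))%:E @[n --> \oo] --> A%:E.
  by apply: cvg_EFin => //; exact: nearW.
have E := cvg_unique _ GA' GI; have -> : A = fine A%:E by [].
by rewrite /Rintegral E.
Unshelve. all: by end_near. Qed.

Lemma integrable_cauchy a y : 0 < a ->
  leb.-integrable setT (fun t => (a / (a ^+ 2 + (t - y) ^+ 2))%:E).
Proof.
move=> a0; have c : continuous (fun t : K => a / (a ^+ 2 + (t - y) ^+ 2)).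
  move=> t; apply: cvgM; first exact: cvg_cst.
  apply: cvgV; first by rewrite gt_eqF// ltr_pwDl ?sqr_ge0// exprn_gt0.
  apply: cvgD; first exact: cvg_cst.
  by apply: cvgM; (apply: cvgB; [exact: cvg_id|exact: cvg_cst]).
apply/integrableP; split.
  by apply/measurable_EFinP; exact: continuous_measurable_fun.
under eq_integral => t _.
  rewrite gee0_abs; last first.
    by rewrite lee_fin divr_ge0 ?(ltW a0)// addr_ge0// sqr_ge0.
  over.
by rewrite integral_cauchy// ltry.
Qed.

Lemma integrable_le_cauchy (D : set RT) h C : measurable D -> measurable_fun [set: RT] h ->
  (forall t, D t -> `|h t| <= C / (1 + t ^+ 2)) -> leb.-integrable D (fun t => (h t)%:E).
Proof.
(* The majorant is spelled as the Cauchy kernel with [a = 1], [y = 0], so that [integrable_cauchy]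
   matches. *)
move=> mD mh hC; apply: (@le_integrable _ _ _ leb D mD _ (fun t => (C * (1 / (1 ^+ 2 + (t - 0) ^+ 2)))%:E)).
- by apply/measurable_EFinP; exact: measurable_funTS.
- move=> t Dt; rewrite lee_fin subr0 expr1n mul1r (le_trans (hC t Dt))//.
  exact: ler_norm.
- have i1 := integrableS measurableT mD (@subsetT _ _) (@integrable_cauchy 1 0 ltr01).
  have i2 := integrableZl mD C i1.
  by apply: eq_integrable i2.
Qed.

Lemma Rintegral_le_cauchy (D : set RT) h C : measurable D -> measurable_fun [set: RT] h ->
  0 <= C -> (forall t, D t -> `|h t| <= C / (1 + t ^+ 2)) ->
  `|\int[leb]_(t in D) h t| <= C * pi.
Proof.
move=> mD mh C0 hC; have ih := integrable_le_cauchy mD mh hC.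
rewrite (le_trans (le_normr_Rintegral mD ih))//.
have i1 := @integrable_cauchy 1 0 ltr01.
have -> : C * pi = \int[leb]_t (C * (1 / (1 ^+ 2 + (t - 0) ^+ 2))).
  by rewrite RintegralZl// /Rintegral integral_cauchy.
apply: (@le_trans _ _ (\int[leb]_(t in D) (C * (1 / (1 ^+ 2 + (t - 0) ^+ 2))))).
  apply: le_Rintegral => //.
  - by have := integrable_norm ih.
  - have i2 := integrableZl mD C (integrableS measurableT mD (@subsetT _ _) i1).
    by apply: eq_integrable i2.
  - by move=> t Dt; rewrite subr0 expr1n mul1r hC.
have iC : leb.-integrable setT (fun t => (C * (1 / (1 ^+ 2 + (t - 0) ^+ 2)))%:E).
  by have i2 := integrableZl measurableT C i1; apply: eq_integrable i2.
rewrite /Rintegral fine_le//.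
- exact: (integrable_fin_num mD (integrableS measurableT mD (@subsetT _ _) iC)).
- exact: (integrable_fin_num measurableT iC).
- apply: ge0_subset_integral => //.
  + exact: (measurable_int leb).
  + move=> t _; rewrite lee_fin mulr_ge0// divr_ge0// addr_ge0// ?sqr_ge0//.
Qed.

End Line.

(** * Real-valued Fubini theorem with a product majorant *)

Section RFubini.
Context d1 d2 (T1 : measurableType d1) (T2 : measurableType d2) (R : realType).
Variables (m1 : {sigma_finite_measure set T1 -> \bar R}).
Variables (m2 : {sigma_finite_measure set T2 -> \bar R}).
Variable F : T1 * T2 -> R.

(** A real integral is the [fine] part of an extended one. Integrability of every slice, not just of
    almost every one, allows the inner [fine] to be removed pointwise. *)
Lemma Rfubini : (m1 \x m2)%E.-integrable setT (fun p => (F p)%:E) ->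
  (forall x, m2.-integrable setT (fun y => (F (x, y))%:E)) ->
  (forall y, m1.-integrable setT (fun x => (F (x, y))%:E)) ->
  \int[m1]_x \int[m2]_y F (x, y) = \int[m2]_y \int[m1]_x F (x, y).
Proof.
move=> iF iF2 iF1; congr fine.
under eq_integral do rewrite /Rintegral fineK ?integrable_fin_num//.
under [RHS]eq_integral do rewrite /Rintegral fineK ?integrable_fin_num//.
exact: (Fubini iF).
Qed.

(** By Tonelli, the iterated integral of [|F|] is at most the product of the two finite
    integrals. *)
Lemma integrable_prod_dominated (a : T1 -> R) (b : T2 -> R) :
  measurable_fun setT F ->
  (forall x, 0 <= a x) -> (forall y, 0 <= b y) ->
  m1.-integrable setT (fun x => (a x)%:E) ->
  m2.-integrable setT (fun x => (b x)%:E) ->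
  (forall x y, `|F (x, y)| <= a x * b y) ->
  (m1 \x m2)%E.-integrable setT (fun p => (F p)%:E).
Proof.
move=> mF a0 b0 ia ib Fab.
have mEF : measurable_fun setT (fun p => (F p)%:E) by apply/measurable_EFinP.
apply/integrable12ltyP => //.
apply: (@le_lt_trans _ _ (\int[m1]_x ((a x)%:E * \int[m2]_y (b y)%:E))%E).
  apply: ge0_le_integral => //.
  - by move=> x _; apply: integral_ge0.
  - apply: (measurable_fun_fubini_tonelli_F (fun p => `|(F p)%:E|%E)) => //.
    exact: measurableT_comp.
  - apply: emeasurable_funM => //; exact: (measurable_int m1).
  - move=> x _; rewrite -ge0_integralZl//.
    + apply: ge0_le_integral => //.
      * apply: measurableT_comp => //.
        exact: (measurableT_comp mEF (pair1_measurable x)).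
      * apply: emeasurable_funM => //; exact: (measurable_int m2).
      * by move=> y _; rewrite -EFinM lee_fin.
    + exact: (measurable_int m2).
    + by move=> y _; rewrite lee_fin.
    + by rewrite lee_fin.
rewrite ge0_integralZr//.
- apply: lte_mul_pinfty.
  + by apply: integral_ge0 => x _; rewrite lee_fin.
  + exact: (integrable_fin_num measurableT ia).
  + by case/integrableP: ib => _; under eq_integral do rewrite gee0_abs ?lee_fin//.
- exact: (measurable_int m1).
- by move=> x _; rewrite lee_fin.
- by apply: integral_ge0 => x _; rewrite lee_fin.
Qed.

End RFubini.

(** * Fourier inversion on the line *)

Section LineInversion.
Variable K : realType.
Local Notation leb := (@lebesgue_measure K).
Local Notation RT := (measurableTypeR K).
Implicit Types (g G h : K -> K) (a b t u x y C : K).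

Lemma cauchy_weight_cvg0 C : (fun n : nat => C / (1 + n%:R ^+ 2)) @ \oo --> (0 : K).
Proof.
rewrite -(mulr0 C); apply: cvgM; first exact: cvg_cst.
apply/cvgrPdist_lt => e e0; near=> n.
have n1 : (0 < n)%N by near: n; exact: nbhs_infty_gt.
rewrite sub0r normrN ger0_norm; last by rewrite invr_ge0 addr_ge0// sqr_ge0.
have n0 : 0 < n%:R :> K by rewrite ltr0n.
apply: (@le_lt_trans _ _ n%:R^-1).
  rewrite lef_pV2 ?posrE// ?ltr_pwDl ?sqr_ge0//.
  by rewrite (@le_trans _ _ (n%:R ^+ 2))// ?lerDr// ler_eXnr// ler1n.
rewrite invf_plt ?posrE//; near: n; exact: nbhs_infty_gtr.
Unshelve. all: by end_near. Qed.

(** The decay of [g] gives integrability, and that of [G] makes the boundary terms vanish at both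
    ends. *)
Lemma integral_derivative_eq0 g G C : continuous g ->
  (forall t, is_derive t (1 : K) G (g t)) ->
  (forall t, `|g t| <= C / (1 + t ^+ 2)) -> (forall t, `|G t| <= C / (1 + t ^+ 2)) ->
  \int[leb]_t g t = 0.
Proof.
move=> cg dG gC GC.
apply: (@FTC_cvg K setT (fun n => - n.+1%:R) (fun n => n.+1%:R) g G) => //.
- by apply: (@integrable_le_cauchy K setT g C) => //; exact: continuous_measurable_fun.
- by move=> t; exact: is_derive1_continuous (dG t).
- by move=> n; rewrite gtrN.
- move=> t _; near=> n; rewrite in_itv/= -ler_norml.
  have : `|t| <= n%:R by near: n; exact: nbhs_infty_ger.
  by move/le_trans; apply; rewrite ler_nat.
- rewrite -(addr0 0); have H : (fun n : nat => C / (1 + n.+1%:R ^+ 2)) @ \oo --> (0:K).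
    by rewrite (cvg_shiftS (fun n => C / (1 + n%:R ^+ 2))); exact: cauchy_weight_cvg0.
  have H' : (fun n : nat => - (C / (1 + n.+1%:R ^+ 2))) @ \oo --> (0:K).
    by rewrite -oppr0; exact: cvgN.
  apply: cvgD; [|rewrite -oppr0; apply: cvgN]; apply: squeeze_cvgr H' H.
    by near=> n; rewrite -ler_norml GC.
  by near=> n; rewrite -ler_norml; have := GC (- n.+1%:R); rewrite sqrrN.
Unshelve. all: by end_near. Qed.

(** From [expR (a t) >= 1 + (a t)^2 / 2]. The constant is such that [(1 + 2/a^2) (1 + a^2 t^2 / 2)]
    expands to [1 + t^2] plus nonnegative terms. *)
Lemma expR_le_cauchy a t : 0 < a -> 0 <= t ->
  expR (- (a * t)) <= (1 + 2 / a ^+ 2) / (1 + t ^+ 2).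
Proof.
move=> a0 t0; have := @expR_ge1Dxn K (a * t) 1 (mulr_ge0 (ltW a0) t0).
rewrite expRN => e1; have T : 0 < 1 + t ^+ 2 by rewrite ltr_pwDl// sqr_ge0.
rewrite ler_pdivlMr// mulrC ler_pdivrMr ?expR_gt0//.
have a2 : 0 < a ^+ 2 by rewrite exprn_gt0.
apply: (@le_trans _ _ ((1 + 2 / a ^+ 2) * (1 + (a * t) ^+ 2 / 2))).
  rewrite exprMn; have -> : (1 + 2 / a ^+ 2) * (1 + a ^+ 2 * t ^+ 2 / 2) =
    1 + t ^+ 2 + 2 / a ^+ 2 + a ^+ 2 * t ^+ 2 / 2 by field; rewrite gt_eqF.
  by rewrite -addrA lerDl addr_ge0// ?divr_ge0// ?mulr_ge0// ?sqr_ge0// ltW.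
by rewrite ler_wpM2l// addr_ge0// divr_ge0// ltW.
Qed.

Lemma integral_expR_cos a u : 0 < a ->
  \int[leb]_(t in `[0, +oo[) (expR (- (a * t)) * cos (t * u)) = a / (a ^+ 2 + u ^+ 2).
Proof.
move=> a0; have D0 : 0 < a ^+ 2 + u ^+ 2 by rewrite ltr_pwDl ?sqr_ge0// exprn_gt0.
(* The real part of [exp ((-a + i u) t) / (-a + i u)]. *)
pose G t := expR (- (a * t)) * ((u * sin (t * u) - a * cos (t * u)) / (a ^+ 2 + u ^+ 2)).
pose g t := expR (- (a * t)) * cos (t * u).
have dtu t : is_derive t (1 : K) (fun t : K => t * u) u.
  by apply: (isd_ext (f := fun t => u * t) (df := u * 1)); rewrite ?mulr1// => ?; rewrite mulrC.
have dat t : is_derive t (1 : K) (fun t : K => - (a * t)) (- (a * 1)).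
  by apply: isdN; apply: isdZ.
have dexp t : is_derive t (1 : K) (fun t : K => expR (- (a * t))) (expR (- (a * t)) * - (a * 1)).
  exact: (isd_comp (dat t)).
have dsin t : is_derive t (1 : K) (fun t : K => sin (t * u)) (cos (t * u) * u).
  exact: (isd_comp (dtu t)).
have dcos t : is_derive t (1 : K) (fun t : K => cos (t * u)) (- sin (t * u) * u).
  exact: (isd_comp (dtu t)).
have dG t : is_derive t (1 : K) G (g t).
  have H := isdM (dexp t) (isdM (isdB (isdZ u (dsin t)) (isdZ a (dcos t))) (isdC (a ^+ 2 + u ^+ 2)^-1 t 1)).
  by apply: (isd_ext _ _ H) => //; rewrite /g; field; rewrite gt_eqF.
have cg : continuous g.
  move=> t; exact: is_derive1_continuous (isdM (dexp t) (dcos t)).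
have cG : continuous G by move=> t; exact: is_derive1_continuous (dG t).
have G0 : G 0 = - (a / (a ^+ 2 + u ^+ 2)).
  by rewrite /G mulr0 oppr0 expR0 mul0r sin0 cos0 mulr0 mulr1 mul1r sub0r mulNr.
pose C := (1 + 2 / a ^+ 2) * ((`|u| + a) / (a ^+ 2 + u ^+ 2)).
apply: (@FTC_cvg K `[0, +oo[%classic (fun n => 0) (fun n => n.+1%:R) g G) => //.
- apply: (@integrable_le_cauchy K _ g (1 + 2 / a ^+ 2)) => //.
  + exact: continuous_measurable_fun.
  + move=> t /=; rewrite in_itv/= andbT => t0; rewrite normrM ger0_norm ?expR_ge0//.
    rewrite (le_trans _ (expR_le_cauchy a0 t0))// ler_piMr ?expR_ge0//.
    by rewrite ler_norml cos_geN1 cos_le1.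
- by move=> n; apply: subset_itvl.
- move=> t /=; rewrite in_itv/= andbT => t0; near=> n; rewrite in_itv/= t0/=.
  have : t <= n%:R by near: n; exact: nbhs_infty_ger.
  by move/le_trans; apply; rewrite ler_nat.
- rewrite G0 opprK -[X in _ --> X]add0r; apply: cvgD; last exact: cvg_cst.
  have H : (fun n : nat => C / (1 + n.+1%:R ^+ 2)) @ \oo --> (0:K).
    by rewrite (cvg_shiftS (fun n => C / (1 + n%:R ^+ 2))); exact: cauchy_weight_cvg0.
  have H' : (fun n : nat => - (C / (1 + n.+1%:R ^+ 2))) @ \oo --> (0:K).
    by rewrite -oppr0; exact: cvgN.
  apply: squeeze_cvgr H' H; near=> n; rewrite -ler_norml /G.
  rewrite normrM ger0_norm ?expR_ge0// normrM normfV (gtr0_norm D0).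
  apply: (@le_trans _ _ ((1 + 2 / a ^+ 2) / (1 + n.+1%:R ^+ 2) * ((`|u| + a) / (a ^+ 2 + u ^+ 2)))).
    apply: ler_pM; rewrite ?expR_ge0// ?divr_ge0// ?(ltW D0)//.
      exact: expR_le_cauchy.
    rewrite ler_pM2r ?invr_gt0// (le_trans (ler_normB _ _))// !normrM (gtr0_norm a0).
    apply: lerD.
      by rewrite ler_piMr// ler_norml sin_geN1 sin_le1.
    by rewrite ler_piMr ?(ltW a0)// ler_norml cos_geN1 cos_le1.
  by rewrite /C mulrAC.
Unshelve. all: by end_near. Qed.

(** One small [a] for each tolerance is all that the inversion uses, so no limit in [a] is formed.
    Near [x] the continuity of [h] gives the smallness, away from [x] the factor [a] of the kernel
    does. *)
Lemma cauchy_approximate_identity h (M : K) x (eta : K) : continuous h -> 0 <= M ->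
  (forall t, `|h t| <= M) -> 0 < eta -> exists2 a, 0 < a &
  `|\int[leb]_t (h t * (a / (a ^+ 2 + (t - x) ^+ 2))) - h x * pi| <= eta.
Proof.
move=> ch M0 hM eta0; have p0 : 0 < pi :> K := pi_gt0 _.
have e0 : 0 < eta / 2 / pi by rewrite !divr_gt0.
have /cvgrPdist_lt/(_ _ e0)/nbhs_ballP[de /= de0 hde] := ch x.
(* For [|s| >= de] this gives [1 + s^2 <= D s^2], so away from [x] the kernel is at most [a D] times
   the kernel of width 1. *)
pose D := 1 + de ^- 2.
have D0 : 0 < D by rewrite ltr_pwDl// invr_ge0 sqr_ge0.
(* Makes the far contribution [2 M a D pi] at most [eta / 2]; the summand 1 keeps the denominator
   positive when [M = 0]. *)
pose a : K := eta / (4 * M * D * pi + 1).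
have den0 : 0 < 4 * M * D * pi + 1 by rewrite ltr_wpDl// !mulr_ge0// ltW.
have a0 : 0 < a by rewrite divr_gt0.
exists a => //.
pose k (t : K) : K := a / (a ^+ 2 + (t - x) ^+ 2).
pose k1 (t : K) : K := 1 / (1 ^+ 2 + (t - x) ^+ 2).
have ck : continuous k.
  move=> t; apply: cvgM; first exact: cvg_cst.
  apply: cvgV; first by rewrite gt_eqF// ltr_pwDl ?sqr_ge0// exprn_gt0.
  apply: cvgD; first exact: cvg_cst.
  by apply: cvgM; (apply: cvgB; [exact: cvg_id|exact: cvg_cst]).
have k0 t : 0 <= k t by rewrite divr_ge0 ?(ltW a0)// addr_ge0// sqr_ge0.
have ik : leb.-integrable setT (fun t => (k t)%:E) := @integrable_cauchy K a x a0.
have ik1 : leb.-integrable setT (fun t => (k1 t)%:E) := @integrable_cauchy K 1 x ltr01.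
have ihk : leb.-integrable setT (fun t => (h t * k t)%:E).
  apply: (@le_integrable _ _ _ leb setT measurableT _ (fun t => (M * k t)%:E)).
  - apply/measurable_EFinP; apply: measurable_funM; exact: continuous_measurable_fun.
  - by move=> t _; rewrite lee_fin !normrM ler_pM// (le_trans (hM t))// ler_norm.
  - by have i2 := integrableZl measurableT M ik; apply: eq_integrable i2.
have ick : leb.-integrable setT (fun t => (h x * k t)%:E).
  by have i2 := integrableZl measurableT (h x) ik; apply: eq_integrable i2.
have -> : h x * pi = \int[leb]_t (h x * k t).
  by rewrite RintegralZl// [in RHS]/Rintegral integral_cauchy.
rewrite -RintegralB//.
have iB : leb.-integrable setT (fun t => (h t * k t - h x * k t)%:E).
  by have i2 := integrableB measurableT ihk ick; apply: eq_integrable i2.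
rewrite (le_trans (le_normr_Rintegral measurableT iB))//.
pose c2 : K := 2 * M * (a * D).
have i1 : leb.-integrable setT (fun t => (eta / 2 / pi * k t)%:E).
  by have i2 := integrableZl measurableT (eta / 2 / pi) ik; apply: eq_integrable i2.
have i2 : leb.-integrable setT (fun t => (c2 * k1 t)%:E).
  by have i2 := integrableZl measurableT c2 ik1; apply: eq_integrable i2.
(* One majorant valid for all [t]: its first term serves the points near [x], its second the others,
   so the integral need not be split. *)
have key (t : K) : `|h t * k t - h x * k t| <= eta / 2 / pi * k t + c2 * k1 t.
  rewrite -mulrBl normrM (ger0_norm (k0 t)).
  have k1t0 : 0 <= k1 t by rewrite divr_ge0// addr_ge0// sqr_ge0.
  have c20 : 0 <= c2 by apply: mulr_ge0; apply: mulr_ge0 => //; exact: ltW.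
  have [xt|xt] := ltP `|x - t| de.
    rewrite -[leLHS]addr0; apply: lerD; last exact: mulr_ge0.
    by apply: ler_wpM2r => //; apply: ltW; rewrite distrC; exact: hde.
  rewrite -[leLHS]add0r; apply: lerD; first by apply: mulr_ge0 => //; exact: ltW.
  rewrite /c2 -[leRHS]mulrA; apply: ler_pM => //.
    by rewrite (le_trans (ler_normB _ _))// mulr_natl mulr2n lerD.
  have T0 : 0 < (t - x) ^+ 2.
    by rewrite exprn_even_gt0//= -normr_gt0 distrC (lt_le_trans de0).
  rewrite /k /k1 -mulrA ler_pM2l// expr1n div1r ler_pdivlMr ?ltr_pwDl ?(ltW T0)//.
  rewrite mulrC ler_pdivrMr ?ltr_wpDl ?sqr_ge0//.
  apply: (@le_trans _ _ (D * (t - x) ^+ 2)).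
    rewrite /D mulrDl mul1r addrC lerD2l mulrC ler_pdivlMr ?exprn_gt0// mul1r.
    by rewrite -[leRHS]real_normK ?num_real// distrC lerXn2r// nnegrE ltW.
  by rewrite ler_pM2l// lerDr sqr_ge0.
apply: (@le_trans _ _ (\int[leb]_t (eta / 2 / pi * k t + c2 * k1 t))).
  apply: le_Rintegral => //.
  - by have := integrable_norm iB.
  - by have i3 := integrableD measurableT i1 i2; apply: eq_integrable i3.
have Ek : \int[leb]_t k t = pi by rewrite /Rintegral /k integral_cauchy.
have Ek1 : \int[leb]_t k1 t = pi by rewrite /Rintegral /k1 integral_cauchy.
rewrite RintegralD// RintegralZl// RintegralZl// Ek Ek1 divfK ?gt_eqF//.
have : c2 * pi <= eta / 2.
  rewrite /c2 /a ler_pdivlMr//; set Q := 4 * M * D * pi.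
  have -> : 2 * M * (eta / (Q + 1) * D) * pi * 2 = Q / (Q + 1) * eta.
    by set i := (Q + 1)^-1; rewrite /Q; ring.
  by rewrite ler_piMl ?(ltW eta0)// ler_pdivrMr// mul1r lerDl.
by lra.
Qed.

Let cos1 (c : K) : `|cos c| <= 1.
Proof. by rewrite ler_norml cos_geN1 cos_le1. Qed.

Let sin1 (c : K) : `|sin c| <= 1.
Proof. by rewrite ler_norml sin_geN1 sin_le1. Qed.

Lemma integrable_expR_cos a u : 0 < a ->
  leb.-integrable `[0, +oo[ (fun l => (expR (- (a * l)) * cos (l * u))%:E).
Proof.
move=> a0; apply: (@integrable_le_cauchy K _ _ (1 + 2 / a ^+ 2)) => //.
  apply: (@continuous_measurable_fun K) => l; apply: cvgM; apply: continuous_comp.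
  - by apply: cvgN; apply: cvgM; [exact: cvg_cst|exact: cvg_id].
  - exact: continuous_expR.
  - by apply: cvgM; [exact: cvg_id|exact: cvg_cst].
  - exact: continuous_cos.
move=> l /=; rewrite in_itv/= andbT => l0; rewrite normrM ger0_norm ?expR_ge0//.
by rewrite (le_trans _ (@expR_le_cauchy a l a0 _))// ler_piMr// expR_ge0.
Qed.

Lemma integrable_mul_cos h C l : continuous h -> (forall t, `|h t| <= C / (1 + t ^+ 2)) ->
  leb.-integrable setT (fun y => (h y * cos (l * y))%:E).
Proof.
move=> ch hC; apply: (@integrable_le_cauchy K setT _ C) => //.
  apply: (@continuous_measurable_fun K) => y; apply: cvgM; first exact: ch.
  apply: continuous_comp; last exact: continuous_cos.
  by apply: cvgM; [exact: cvg_cst|exact: cvg_id].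
by move=> y _; rewrite normrM (le_trans _ (hC y))// ler_piMr.
Qed.

Lemma integrable_mul_sin h C l : continuous h -> (forall t, `|h t| <= C / (1 + t ^+ 2)) ->
  leb.-integrable setT (fun y => (h y * sin (l * y))%:E).
Proof.
move=> ch hC; apply: (@integrable_le_cauchy K setT _ C) => //.
  apply: (@continuous_measurable_fun K) => y; apply: cvgM; first exact: ch.
  apply: continuous_comp; last exact: continuous_sin.
  by apply: cvgM; [exact: cvg_cst|exact: cvg_id].
by move=> y _; rewrite normrM (le_trans _ (hC y))// ler_piMr.
Qed.

Lemma integral_mul_cosB h C l x : continuous h -> (forall t, `|h t| <= C / (1 + t ^+ 2)) ->
  \int[leb]_y (h y * cos (l * (y - x))) =
    cos (l * x) * \int[leb]_y (h y * cos (l * y)) +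
    sin (l * x) * \int[leb]_y (h y * sin (l * y)).
Proof.
move=> ch hC; have ic := integrable_mul_cos l ch hC; have iss := integrable_mul_sin l ch hC.
rewrite -(RintegralZl (cos (l * x)) measurableT ic) -(RintegralZl (sin (l * x)) measurableT iss).
have i1 := integrableZl measurableT (cos (l * x)) ic.
have i2 := integrableZl measurableT (sin (l * x)) iss.
rewrite -(RintegralD measurableT i1 i2); apply: eq_Rintegral => y _.
by rewrite mulrBr cosB; set p := cos _; set q := cos _; set p' := sin _; set q' := sin _; ring.
Qed.

(** The Abel factor, extended by 0 to negative frequencies so that Fubini runs over the product of
    two full lines. *)
Let r a : K -> K := (fun l : K => expR (- (a * l))) \_ `[0, +oo[.

Let mr a : measurable_fun [set: RT] (r a).
Proof.
apply/(measurable_restrictT _ _).1 => //; apply: measurable_funTS.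
apply: (@continuous_measurable_fun K) => l; apply: continuous_comp.
  by apply: cvgN; apply: cvgM; [exact: cvg_cst|exact: cvg_id].
exact: continuous_expR.
Qed.

Let r_lt0 a l : l < 0 -> r a l = 0.
Proof.
by move=> l0; rewrite /r patchE; case: ifPn => //; rewrite inE/= in_itv/= andbT leNgt l0.
Qed.

Let r_ge0 a l : 0 <= l -> r a l = expR (- (a * l)).
Proof. by move=> l0; rewrite /r patchE ifT// inE/= in_itv/= andbT. Qed.

Let r0 a l : 0 <= r a l.
Proof. by rewrite /r patchE; case: ifPn => // _; rewrite expR_ge0. Qed.

Let r1 a l : 0 < a -> r a l <= 1.
Proof.
move=> a0; have [l0|l0] := leP 0 l; last by rewrite r_lt0.
by rewrite r_ge0// -expR0 ler_expR oppr_le0 mulr_ge0// ltW.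
Qed.

Let ir a : 0 < a -> leb.-integrable setT (fun l => (r a l)%:E).
Proof.
move=> a0; apply: (@integrable_le_cauchy K setT (r a) (1 + 2 / a ^+ 2)) => // l _.
rewrite ger0_norm//; have [l0|l0] := leP 0 l; first by rewrite r_ge0// expR_le_cauchy.
by rewrite r_lt0// divr_ge0// addr_ge0// ?sqr_ge0// divr_ge0// sqr_ge0.
Qed.

Let F a h x (p : RT * RT) : K := r a p.1 * (h p.2 * cos (p.1 * (p.2 - x))).

Let mF a h x : continuous h -> measurable_fun setT (F a h x).
Proof.
move=> ch; apply: measurable_funM; first by apply: (measurableT_comp (mr a)); exact: measurable_fst.
apply: measurable_funM.
  by apply: (measurableT_comp (continuous_measurable_fun ch)); exact: measurable_snd.
apply: (measurableT_comp (continuous_measurable_fun (@continuous_cos K))).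
apply: measurable_funM; first exact: measurable_fst.
by apply: measurable_funB; [exact: measurable_snd|exact: measurable_cst].
Qed.

Let F_le a h x l y : `|F a h x (l, y)| <= r a l * `|h y|.
Proof. by rewrite /F/= normrM ger0_norm// normrM ler_wpM2l// ler_piMr. Qed.

Let iF a h x C : 0 < a -> continuous h -> (forall t, `|h t| <= C / (1 + t ^+ 2)) ->
  (leb \x leb)%E.-integrable setT (fun p => (F a h x p)%:E).
Proof.
move=> a0 ch hC; have ih : leb.-integrable setT (fun y => `|h y|%:E).
  apply: (@integrable_le_cauchy K setT _ C) => //.
    by apply: measurableT_comp => //; exact: continuous_measurable_fun.
  by move=> t _; rewrite normr_id.
exact: (@integrable_prod_dominated _ _ _ _ K leb leb (F a h x) (r a) (fun y => `|h y|)
  (mF a x ch) (r0 a) (fun y => normr_ge0 (h y)) (ir a0) ih (F_le a h x)).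
Qed.

Let F_inner a h x C l : continuous h -> (forall t, `|h t| <= C / (1 + t ^+ 2)) ->
  r a l * \int[leb]_y (h y * cos (l * (y - x))) = \int[leb]_y F a h x (l, y).
Proof.
move=> ch hC; rewrite /F/= RintegralZl//.
have hc : continuous (fun y => h y * cos (l * (y - x))).
  move=> y; apply: cvgM; first exact: ch.
  apply: continuous_comp; last exact: continuous_cos.
  by apply: cvgM; [exact: cvg_cst|apply: cvgB; [exact: cvg_id|exact: cvg_cst]].
apply: (@integrable_le_cauchy K setT _ C) => //; first exact: continuous_measurable_fun.
by move=> y _; rewrite normrM (le_trans _ (hC y))// ler_piMr.
Qed.

(** After the exchange, the integral in [l] is the Laplace transform of a cosine, which
    [integral_expR_cos] evaluates to the Cauchy kernel centred at [x]. *)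
Let poisson_fubini a h x C : 0 < a -> 0 <= C -> continuous h ->
  (forall t, `|h t| <= C / (1 + t ^+ 2)) ->
  \int[leb]_l (r a l * \int[leb]_y (h y * cos (l * (y - x)))) =
  \int[leb]_y (h y * (a / (a ^+ 2 + (y - x) ^+ 2))).
Proof.
move=> a0 C0 ch hC.
have hM t : `|h t| <= C.
  rewrite (le_trans (hC t))// ler_pdivrMr ?ltr_pwDl ?sqr_ge0// mulrDr mulr1.
  by rewrite lerDl mulr_ge0// sqr_ge0.
have iF2 (l : RT) : leb.-integrable setT (fun y => (F a h x (l, y))%:E).
  apply: (@integrable_le_cauchy K setT (fun y => F a h x (l, y)) C) => //.
    exact: (measurableT_comp (mF a x ch) (pair1_measurable l)).
  by move=> y _; rewrite (le_trans (F_le a h x l y))// (le_trans _ (hC y))// ler_piMl// r1.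
have iF1 (y : RT) : leb.-integrable setT (fun l => (F a h x (l, y))%:E).
  apply: (@le_integrable _ _ _ leb setT measurableT _ (fun t => (C * r a t)%:E)).
  - by apply/measurable_EFinP; exact: (measurableT_comp (mF a x ch) (pair2_measurable y)).
  - move=> t _; rewrite lee_fin (le_trans (F_le a h x t y))// normrM (ger0_norm C0) mulrC.
    by rewrite (ger0_norm (r0 a t)) ler_wpM2r.
  - exact: (integrableZl measurableT C (ir a0)).
under eq_Rintegral => l _ do rewrite (F_inner _ _ _ ch hC).
rewrite (@Rfubini _ _ _ _ _ leb leb _ (iF x a0 ch hC) iF2 iF1).
apply: eq_Rintegral => y _; rewrite -integral_expR_cos//.
rewrite -(RintegralZl _ _ (integrable_expR_cos (y - x) a0))//.
rewrite [RHS]Rintegral_mkcond.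
apply: eq_Rintegral => l _; rewrite /F/= /r !patchE.
by case: ifPn => _; rewrite ?mul0r// mulrCA.
Qed.

(** The regularised inversion integral is at most [2 B pi] uniformly in the Abel parameter, the 2
    coming from the cosine and sine parts of [cos (l (y - x))]. It also differs from [h x * pi] by
    at most [eta * pi], and [pi] cancels. *)
Lemma line_inversion h C (B : K) : continuous h -> 0 <= C -> 0 <= B ->
  (forall t, `|h t| <= C / (1 + t ^+ 2)) ->
  (forall l : K, 0 <= l -> `|\int[leb]_y (h y * cos (l * y))| <= B / (1 + l ^+ 2)) ->
  (forall l : K, 0 <= l -> `|\int[leb]_y (h y * sin (l * y))| <= B / (1 + l ^+ 2)) ->
  forall x, `|h x| <= 2 * B.
Proof.
move=> ch C0 B0 hC hcos hsin x; have p0 : 0 < pi :> K := pi_gt0 _.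
apply/ler_addgt0Pr => eta eta0; have ep0 : 0 < eta * pi by rewrite mulr_gt0.
have hM t : `|h t| <= C.
  rewrite (le_trans (hC t))// ler_pdivrMr ?ltr_pwDl ?sqr_ge0// mulrDr mulr1.
  by rewrite lerDl mulr_ge0// sqr_ge0.
have [a a0 happ] := cauchy_approximate_identity x ch C0 hM ep0.
have PF := poisson_fubini x a0 C0 ch hC.
have J1 : `|\int[leb]_l (r a l * \int[leb]_y (h y * cos (l * (y - x))))| <= 2 * B * pi.
  apply: (@Rintegral_le_cauchy K setT _ (2 * B)) => //.
  - have m := measurableT_comp (@fine_measurable K setT measurableT) (measurable_fubini_F (iF x a0 ch hC)).
    by apply: eq_measurable_fun m => l _; rewrite (F_inner _ _ _ ch hC).
  - by rewrite mulr_ge0.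
  - move=> l _; rewrite (integral_mul_cosB l x ch hC) normrM ger0_norm//.
    have [l0|l0] := leP 0 l; last first.
      by rewrite r_lt0// mul0r divr_ge0// ?mulr_ge0// addr_ge0// sqr_ge0.
    apply: (@le_trans _ _ (1 * (B / (1 + l ^+ 2) + B / (1 + l ^+ 2)))); last first.
      by rewrite mul1r -mulrDl -mulr2n mulr_natl.
    apply: ler_pM => //; first exact: r1.
    apply: le_trans (ler_normD _ _) _; rewrite !normrM.
    apply: lerD; rewrite -[leRHS]mul1r; apply: ler_pM => //.
    + exact: hcos.
    + exact: hsin.
rewrite PF in J1.
rewrite -(ler_pM2r p0) mulrDl -[X in `|h x| * X](gtr0_norm p0) -normrM.
set J := Rintegral _ _ _ in happ J1.
have -> : h x * pi = J - (J - h x * pi) by ring.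
by rewrite (le_trans (ler_normB _ _))// lerD.
Qed.

End LineInversion.

(** * Decaying functions on R^d: integrability, slices, vanishing integrals of derivatives *)

Section DecayingFunctions.
Variable K : realType.
Local Notation leb := (@lebesgue_measure K).
Local Notation mu n := (@lebesgue_tuple K n).

Lemma continuous_rV (T : topologicalType) d (f : T -> 'rV[K]_d) :
  (forall j, continuous (fun x => f x 0 j)) -> continuous f.
Proof.
move=> cf x; apply/cvgrPdist_lt => e e0.
have : \forall y \near x, forall j, `|f x 0 j - f y 0 j| < e.
  by apply: filter_forall => j; have /cvgrPdist_lt/(_ _ e0) := cf j x.
by apply: filterS => y H; apply/rV_normE => // j; rewrite !mxE.
Qed.

Lemma coord_continuous_rV d (j : 'I_d) : continuous (fun x : 'rV[K]_d => x 0 j).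
Proof. exact: coord_continuous. Qed.

Lemma continuous_consr_l d (x : 'rV[K]_d) : continuous (fun t => consr t x).
Proof.
apply: continuous_rV => j; case: (unliftP ord0 j) => [k ->|->].
  by under eq_fun do rewrite consrS; exact: cst_continuous.
by under eq_fun do rewrite consr0; move=> t; exact: cvg_id.
Qed.

Lemma continuous_consr_r d (t : K) : continuous (@consr K d t).
Proof.
apply: continuous_rV => j; case: (unliftP ord0 j) => [k ->|->].
  by under eq_fun do rewrite consrS; exact: coord_continuous_rV.
by under eq_fun do rewrite consr0; exact: cst_continuous.
Qed.

Lemma continuous_sum (T : topologicalType) I (s : seq I) (f : I -> T -> K) :
  (forall i, continuous (f i)) -> continuous (fun x => \sum_(i <- s) f i x).
Proof.
move=> cf; elim: s => [|i s IH] x.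
  by under eq_fun do rewrite big_nil; exact: cvg_cst.
by under eq_fun do rewrite big_cons; apply: cvgD; [exact: cf|exact: IH].
Qed.

Lemma n1_continuous d : continuous (@n1 K d).
Proof.
apply: continuous_sum => j x; apply: (continuous_comp (@coord_continuous_rV d j x)).
exact: norm_continuous.
Qed.

Lemma add_n1_gt0 d (a : K) (x : 'rV[K]_d) : 0 < a -> 0 < a + n1 x.
Proof. by move=> a0; rewrite ltr_pwDl// n1_ge0. Qed.

Lemma continuous_weight d (a : K) k : 0 < a ->
  continuous (fun x : 'rV[K]_d => (a + n1 x) ^- k).
Proof.
move=> a0 x; have p : (a + n1 x) ^+ k != 0 by rewrite expf_neq0// gt_eqF// add_n1_gt0.
have c : (fun y : 'rV[K]_d => a + n1 y) @ x --> a + n1 x.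
  exact: (cvgD (cvg_cst a) (@n1_continuous d x)).
have c2 := cvg_comp _ _ c (@exprn_continuous K k (a + n1 x)).
exact: (cvgV p c2).
Qed.

Lemma measurable_weight m k (a : K) : 0 < a ->
  measurable_fun setT (fun t : m.-tuple (measurableTypeR K) =>
    ((a + n1 (row_of_tuple t)) ^- k)%:E).
Proof.
move=> a0; apply/measurable_EFinP.
exact: (@continuous_measurable_row K m (fun x => (a + n1 x) ^- k) (@continuous_weight m a k a0)).
Qed.

(** The base [a] and the surplus exponent [k] vary so that the induction closes: freezing a
    coordinate [x] turns [a] into [a + |x|], and integrating it out uses one power and yields one
    factor [pi]. *)
Lemma integral_weight_le m k (a : K) : 0 < a ->
  (\int[mu m]_t ((a + n1 (row_of_tuple t)) ^- (m + k.+1))%:E <= (pi ^+ m * a ^- k.+1)%:E)%E.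
Proof.
elim: m k a => [|m IH] k a a0.
  rewrite /= integral_dirac//; last exact: measurable_weight.
  by rewrite diracT mul1e expr0 mul1r /n1 big_ord0 addr0.
have p0 : 0 < pi :> K := pi_gt0 _.
rewrite integral_tupleS_ge0; last 2 first.
- exact: measurable_weight.
- by move=> t; rewrite lee_fin invr_ge0 exprn_ge0// ltW// add_n1_gt0.
have ax (x : K) : 0 < a + `|x| by rewrite ltr_pwDl.
have cw : continuous (fun x : K => pi ^+ m * (a + `|x|) ^- k.+2).
  move=> x; apply: cvgM; first exact: cvg_cst.
  have p : (a + `|x|) ^+ k.+2 != 0 by rewrite expf_neq0// gt_eqF.
  have c : (fun y : K => a + `|y|) @ x --> a + `|x|.
    exact: (cvgD (cvg_cst a) (@norm_continuous _ _ x)).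
  have c2 := cvg_comp _ _ c (@exprn_continuous K k.+2 (a + `|x|)).
  exact: (cvgV p c2).
apply: (@le_trans _ _ (\int[leb]_x ((pi ^+ m * (a + `|x|) ^- k.+2)%:E))%E).
  apply: ge0_le_integral => //.
  - move=> x _; apply: integral_ge0 => t _.
    by rewrite lee_fin invr_ge0 exprn_ge0// ltW// add_n1_gt0.
  - apply: (@measurable_integral_tuple K m (fun t => ((a + n1 (row_of_tuple t)) ^- (m.+1 + k.+1))%:E)).
      exact: measurable_weight.
    by move=> t; rewrite lee_fin invr_ge0 exprn_ge0// ltW// add_n1_gt0.
  - by apply/measurable_EFinP; exact: continuous_measurable_fun.
  - move=> x _; apply: le_trans (IH k.+1 (a + `|x|) (ax x)).
    rewrite le_eqVlt; apply/orP; left; apply/eqP; apply: eq_integral => t _.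
    by rewrite row_of_tuple_cons n1_consr addrA addSnnS.
(* Two factors satisfy [(a + |x|)^2 >= a^2 + x^2]; each of the other [k] is at least [a]. *)
have key (x : K) : (a + `|x|) ^- k.+2 <= a ^- k.+1 * (a / (a ^+ 2 + (x - 0) ^+ 2)).
  have -> : a ^- k.+1 * (a / (a ^+ 2 + (x - 0) ^+ 2)) = (a ^+ k * (a ^+ 2 + (x - 0) ^+ 2))^-1.
    rewrite exprS !invfM mulrA; congr (_ * _).
    by rewrite mulrAC mulVf ?gt_eqF// mul1r.
  have D : 0 < a ^+ 2 + (x - 0) ^+ 2 by rewrite ltr_pwDl ?sqr_ge0// exprn_gt0.
  rewrite lef_pV2 ?posrE ?exprn_gt0// ?mulr_gt0 ?exprn_gt0//.
  have -> : (a + `|x|) ^+ k.+2 = (a + `|x|) ^+ k * (a + `|x|) ^+ 2 by rewrite -exprD addn2.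
  apply: ler_pM; rewrite ?exprn_ge0 ?(ltW D) ?(ltW a0)//.
    by rewrite lerXn2r ?nnegrE ?(ltW a0) ?(ltW (ax x))// lerDl.
  rewrite subr0 sqrrD -[x ^+ 2]real_normK ?num_real// -addrA lerD2l addrC lerDl.
  by rewrite mulrn_wge0// mulr_ge0// ltW.
apply: (@le_trans _ _ (\int[leb]_x ((pi ^+ m * a ^- k.+1)%:E * (a / (a ^+ 2 + (x - 0) ^+ 2))%:E))%E).
  apply: ge0_le_integral => //.
  - by move=> x _; rewrite lee_fin mulr_ge0 ?exprn_ge0 ?(ltW p0)// invr_ge0 exprn_ge0// ltW.
  - by apply/measurable_EFinP; exact: continuous_measurable_fun.
  - apply: emeasurable_funM => //; exact: (measurable_int leb (integrable_cauchy 0 a0)).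
  - move=> x _; rewrite -EFinM lee_fin -mulrA ler_wpM2l ?exprn_ge0 ?(ltW p0)//.
rewrite ge0_integralZl//.
- by rewrite integral_cauchy// -EFinM lee_fin [pi ^+ m.+1]exprSr mulrAC.
- exact: (measurable_int leb (integrable_cauchy 0 a0)).
- by move=> x _; rewrite lee_fin divr_ge0 ?(ltW a0)// addr_ge0// sqr_ge0.
- by rewrite lee_fin mulr_ge0 ?exprn_ge0 ?(ltW p0)// invr_ge0 exprn_ge0// ltW.
Qed.

(** An exponent above the dimension gives integrability. Freezing a coordinate lowers the dimension
    but not the exponent, so slices decay with a power to spare. *)
Definition decaying d (h : 'rV[K]_d -> K) :=
  continuous h /\ exists2 C : K, 0 <= C & forall x, `|h x| <= C * (1 + n1 x) ^- d.+1.

Definition Rdint d (h : 'rV[K]_d -> K) : K := \int[mu d]_t h (row_of_tuple t).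

Let w_ge0 d (x : 'rV[K]_d) k : 0 <= (1 + n1 x) ^- k.
Proof. by rewrite invr_ge0 exprn_ge0// ltW// add_n1_gt0. Qed.

Lemma integrable_weight d : (mu d).-integrable setT
  (fun t => ((1 + n1 (row_of_tuple t)) ^- d.+1)%:E).
Proof.
apply/integrableP; split; first exact: measurable_weight.
under eq_integral => t _ do rewrite gee0_abs ?lee_fin ?w_ge0//.
have := @integral_weight_le d 0 1 ltr01; rewrite addn1 => /le_lt_trans; apply.
exact: ltry.
Qed.

Lemma measurable_decaying d (h : 'rV[K]_d -> K) : decaying h ->
  measurable_fun setT (fun t : d.-tuple (measurableTypeR K) => h (row_of_tuple t)).
Proof. by case=> ch _; exact: (continuous_measurable_row ch). Qed.

Lemma integrable_decaying d (h : 'rV[K]_d -> K) : decaying h ->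
  (mu d).-integrable setT (fun t => (h (row_of_tuple t))%:E).
Proof.
move=> dh; have [ch [C C0 hC]] := dh.
apply: (@le_integrable _ _ _ (mu d) setT measurableT _
  (fun t => (C * (1 + n1 (row_of_tuple t)) ^- d.+1)%:E)).
- by apply/measurable_EFinP; exact: measurable_decaying.
- by move=> t _; rewrite lee_fin (le_trans (hC _))// ler_norm.
- exact: (integrableZl measurableT C (integrable_weight d)).
Qed.

Lemma Rdint_le d (h : 'rV[K]_d -> K) C : continuous h -> 0 <= C ->
  (forall x, `|h x| <= C * (1 + n1 x) ^- d.+1) -> `|Rdint h| <= C * pi ^+ d.
Proof.
move=> ch C0 hC; have ih : decaying h by split => //; exists C.
have {}ih := integrable_decaying ih.
have iw := integrable_weight d.
apply: (le_trans (le_normr_Rintegral measurableT ih)).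
apply: (@le_trans _ _ (\int[mu d]_t (C * (1 + n1 (row_of_tuple t)) ^- d.+1))).
  apply: le_Rintegral => //.
  - exact: (integrable_norm ih).
  - exact: (integrableZl measurableT C iw).
rewrite RintegralZl// ler_wpM2l// /Rintegral -lee_fin fineK.
  by have := @integral_weight_le d 0 1 ltr01; rewrite addn1 expr1n invr1 mulr1.
exact: integrable_fin_num iw.
Qed.

Lemma decaying_slice_r d (h : 'rV[K]_d.+1 -> K) t : decaying h ->
  decaying (fun x => h (consr t x)).
Proof.
case=> ch [C C0 hC]; split.
  by move=> x; apply: continuous_comp; [exact: continuous_consr_r|exact: ch].
exists C => // x; rewrite (le_trans (hC _))// ler_wpM2l//.
have n0 := @n1_ge0 K d x.
rewrite lef_pV2 ?posrE ?exprn_gt0 ?add_n1_gt0//.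
apply: (@le_trans _ _ ((1 + n1 x) ^+ d.+2)); first by rewrite ler_weXn2l// lerDl.
by rewrite lerXn2r ?nnegrE ?addr_ge0 ?n1_ge0// n1_consr lerD2l lerDr.
Qed.

Lemma slice_l_le d (h : 'rV[K]_d.+1 -> K) C x t : 0 <= C ->
  (forall x, `|h x| <= C * (1 + n1 x) ^- d.+2) ->
  `|h (consr t x)| <= C / (1 + t ^+ 2).
Proof.
move=> C0 hC; rewrite (le_trans (hC _))// ler_wpM2l//.
have n0 := @n1_ge0 K d x.
have T : 0 < 1 + t ^+ 2 by rewrite ltr_pwDl// sqr_ge0.
rewrite lef_pV2 ?posrE ?exprn_gt0 ?add_n1_gt0//.
rewrite n1_consr; apply: (@le_trans _ _ ((1 + `|t|) ^+ 2)).
  rewrite sqrrD expr1n mul1r -[t ^+ 2]real_normK ?num_real//.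
  by rewrite -addrA lerD2l lerDr mulrn_wge0.
apply: (@le_trans _ _ ((1 + `|t|) ^+ d.+2)); first by rewrite ler_weXn2l// lerDl.
by rewrite lerXn2r ?nnegrE ?addr_ge0// lerD2l lerDl.
Qed.

Lemma continuous_slice_l d (h : 'rV[K]_d.+1 -> K) x : continuous h ->
  continuous (fun t => h (consr t x)).
Proof.
by move=> ch t; apply: continuous_comp; [exact: continuous_consr_l|exact: ch].
Qed.

Lemma integrable_slice_l d (h : 'rV[K]_d.+1 -> K) x : decaying h ->
  leb.-integrable setT (fun t => (h (consr t x))%:E).
Proof.
case=> ch [C C0 hC].
apply: (@integrable_le_cauchy K setT (fun t => h (consr t x)) C) => //.
  by apply: (@continuous_measurable_fun K); exact: continuous_slice_l.
by move=> t _; exact: slice_l_le.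
Qed.

Lemma Rdint_consr d (h : 'rV[K]_d.+1 -> K) : decaying h ->
  Rdint h = \int[leb]_t Rdint (fun x => h (consr t x)).
Proof.
move=> dh; rewrite {1}/Rdint {1}/Rintegral integral_tupleS; last exact: integrable_decaying.
congr fine; apply: eq_integral => t _.
under eq_integral do rewrite row_of_tuple_cons.
by rewrite fineK//; have := integrable_decaying (decaying_slice_r t dh); exact: integrable_fin_num.
Qed.

Lemma Rdint_consr' d (h : 'rV[K]_d.+1 -> K) : decaying h ->
  Rdint h = Rdint (fun x => \int[leb]_t h (consr t x)).
Proof.
move=> dh; rewrite {1}/Rdint {1}/Rintegral integral_tupleS'; last exact: integrable_decaying.
congr fine; apply: eq_integral => u _.
under eq_integral do rewrite row_of_tuple_cons.
by rewrite fineK//; have := integrable_slice_l (row_of_tuple u) dh; exact: integrable_fin_num.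
Qed.

Lemma is_derive_slice_r d (k : 'I_d) (G : 'rV[K]_d.+1 -> K) t x (dG : K) :
  is_derive (consr t x) (basisv K (lift ord0 k)) G dG ->
  is_derive x (basisv K k) (fun x => G (consr t x)) dG.
Proof.
move=> /is_derive_line0 H; apply/is_derive_line0; apply: (isd_ext _ _ H) => // h.
congr G; apply/rowP => i; case: (unliftP ord0 i) => [l ->|->].
  by rewrite consrS !mxE liftK/= (inj_eq lift_inj).
by rewrite consr0 !mxE unlift_none/= mulr0 add0r.
Qed.

Lemma is_derive_slice_l d (G : 'rV[K]_d.+1 -> K) t x (dG : K) :
  is_derive (consr t x) (basisv K ord0) G dG ->
  is_derive t (1 : K) (fun t => G (consr t x)) dG.
Proof.
have E s : consr s x = s *: basisv K ord0 + consr 0 x.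
  apply/rowP => i; case: (unliftP ord0 i) => [l ->|->].
    by rewrite !mxE liftK/= mulr0 add0r.
  by rewrite !mxE unlift_none/= mulr1 addr0.
rewrite E => /is_derive_line H; apply: (isd_ext _ _ H) => // s; by rewrite -(E s).
Qed.

(** If [j] is the first coordinate, integrating it innermost gives 0 by the result on the line.
    Otherwise the first coordinate is frozen and the slices vanish by induction. *)
Lemma Rdint_derivative_eq0 d (j : 'I_d) (g G : 'rV[K]_d -> K) : decaying g -> decaying G ->
  (forall x, is_derive x (basisv K j) G (g x)) -> Rdint g = 0.
Proof.
elim: d j g G => [[]//|d IH] j g G dg dG gG.
have [cg [C C0 gC]] := dg; have [cG [C' C'0 GC]] := dG.
case: (unliftP ord0 j) gG => [k ->|->] gG.
  have H t : Rdint (fun x => g (consr t x)) = 0.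
    apply: (IH k _ (fun x => G (consr t x))); try exact: decaying_slice_r.
    by move=> x; exact: is_derive_slice_r (gG _).
  rewrite Rdint_consr//; under eq_Rintegral do rewrite H.
  by rewrite Rintegral_cst// mul0r.
have H x : \int[leb]_t g (consr t x) = 0.
  have CC t : 0 <= (1 + t ^+ 2)^-1 :> K by rewrite invr_ge0 addr_ge0// sqr_ge0.
  apply: (@integral_derivative_eq0 K _ (fun t => G (consr t x)) (C + C')).
  - exact: continuous_slice_l.
  - by move=> t; exact: is_derive_slice_l (gG _).
  - by move=> t; rewrite (le_trans (slice_l_le x t C0 gC))// ler_wpM2r// lerDl.
  - by move=> t; rewrite (le_trans (slice_l_le x t C'0 GC))// ler_wpM2r// lerDr.
rewrite Rdint_consr'// /Rdint; under eq_Rintegral do rewrite H.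
by rewrite Rintegral_cst// mul0r.
Qed.

End DecayingFunctions.

(** * The Fourier transform on R^d *)

Section ComplexModulus.
Variable K : realType.
Implicit Types z w : K[i].

Lemma cReM z w : complex.Re (z * w) = complex.Re z * complex.Re w - complex.Im z * complex.Im w.
Proof. by case: z w => a b [c e]. Qed.

Lemma cImM z w : complex.Im (z * w) = complex.Re z * complex.Im w + complex.Im z * complex.Re w.
Proof. by case: z w => a b [c e]. Qed.

Lemma cReD z w : complex.Re (z + w) = complex.Re z + complex.Re w.
Proof. by case: z w => a b [c e]. Qed.

Lemma cImD z w : complex.Im (z + w) = complex.Im z + complex.Im w.
Proof. by case: z w => a b [c e]. Qed.

Lemma complex_ext z w : complex.Re z = complex.Re w -> complex.Im z = complex.Im w -> z = w.
Proof. by case: z w => a b [c e] /= -> ->. Qed.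

Lemma cabsM z w : cabs (z * w) = cabs z * cabs w.
Proof. exact: ComplexField.Normc.normcM. Qed.

Lemma cabsD z w : cabs (z + w) <= cabs z + cabs w.
Proof. exact: le_normcD. Qed.

Lemma cabsN z : cabs (- z) = cabs z.
Proof. exact: normcN. Qed.

Lemma cabs0 : cabs (0 : K[i]) = 0.
Proof. exact: ComplexField.Normc.normc0. Qed.

Lemma cabs1 : cabs (1 : K[i]) = 1.
Proof. exact: ComplexField.Normc.normc1. Qed.

Lemma cabs_ge0 z : 0 <= cabs z.
Proof. by case: z => a b; exact: sqrtr_ge0. Qed.

Lemma cabs_eq0 z : (cabs z == 0) = (z == 0).
Proof.
apply/eqP/eqP => [|->]; last exact: cabs0.
exact: ComplexField.Normc.eq0_normc.
Qed.

Lemma cabsX z n : cabs (z ^+ n) = cabs z ^+ n.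
Proof. by elim: n => [|n IH]; rewrite ?expr0 ?cabs1// !exprS cabsM IH. Qed.

Lemma cabs_real (a : K) : cabs (a%:C)%C = `|a|.
Proof. by rewrite /cabs /= expr0n/= addr0 sqrtr_sqr. Qed.

Lemma Re_le_cabs z : `|complex.Re z| <= cabs z.
Proof. by case: z => a b /=; rewrite -sqrtr_sqr ler_wsqrtr// lerDl sqr_ge0. Qed.

Lemma Im_le_cabs z : `|complex.Im z| <= cabs z.
Proof. by case: z => a b /=; rewrite -sqrtr_sqr ler_wsqrtr// lerDr sqr_ge0. Qed.

Lemma cabs_le z : cabs z <= `|complex.Re z| + `|complex.Im z|.
Proof.
case: z => a b /=; rewrite -[leRHS]ger0_norm ?addr_ge0// -sqrtr_sqr ler_wsqrtr//.
rewrite sqrrD !real_normK ?num_real// addrAC lerDl.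
by rewrite mulrn_wge0// mulr_ge0.
Qed.

Lemma cabs_phase (t : K) : cabs (cos t -i* sin t)%C = 1.
Proof. by rewrite /cabs/= sqrrN cos2Dsin2 sqrtr1. Qed.

End ComplexModulus.

(** * The Fourier integral of decaying functions and integration by parts *)

Section Fourier.
Variable K : realType.
Local Notation leb := (@lebesgue_measure K).
Local Notation mu n := (@lebesgue_tuple K n).

Lemma decayingD d (f g : 'rV[K]_d -> K) : decaying f -> decaying g ->
  decaying (fun x => f x + g x).
Proof.
move=> [cf [C C0 fC]] [cg [C' C'0 gC]]; split; first by move=> x; exact: cvgD (cf x) (cg x).
exists (C + C'); first exact: addr_ge0.
by move=> x; rewrite mulrDl (le_trans (ler_normD _ _))// lerD.
Qed.

Lemma decaying_mul_bounded d (f g : 'rV[K]_d -> K) M : decaying f -> continuous g ->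
  (forall x, `|g x| <= M) -> decaying (fun x => f x * g x).
Proof.
move=> [cf [C C0 fC]] cg gM; split; first by move=> x; exact: cvgM (cf x) (cg x).
exists (C * M); first by rewrite mulr_ge0// (le_trans _ (gM 0)).
by move=> x; rewrite normrM mulrAC ler_pM.
Qed.

Lemma decayingZ d c (f : 'rV[K]_d -> K) : decaying f -> decaying (fun x => c * f x).
Proof.
move=> df; rewrite (_ : (fun x => _) = (fun x => f x * c)); last by apply/funext => x; rewrite mulrC.
by apply: (@decaying_mul_bounded _ _ _ `|c|) => //; exact: cst_continuous.
Qed.

Lemma decayingB d (f g : 'rV[K]_d -> K) : decaying f -> decaying g ->
  decaying (fun x => f x - g x).
Proof.
move=> df dg; rewrite (_ : (fun x => _) = (fun x => f x + -1 * g x)).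
  by apply: decayingD => //; exact: decayingZ.
by apply/funext => x; rewrite mulN1r.
Qed.

Lemma RdintD d (f g : 'rV[K]_d -> K) : decaying f -> decaying g ->
  Rdint (fun x => f x + g x) = Rdint f + Rdint g.
Proof.
move=> /integrable_decaying df /integrable_decaying dg; rewrite /Rdint.
exact: (@RintegralD _ _ _ (mu d) setT (fun t => f (row_of_tuple t)) (fun t => g (row_of_tuple t))).
Qed.

Lemma RdintB d (f g : 'rV[K]_d -> K) : decaying f -> decaying g ->
  Rdint (fun x => f x - g x) = Rdint f - Rdint g.
Proof.
move=> /integrable_decaying df /integrable_decaying dg; rewrite /Rdint.
exact: (@RintegralB _ _ _ (mu d) setT (fun t => f (row_of_tuple t)) (fun t => g (row_of_tuple t))).
Qed.

Lemma RdintZ d c (f : 'rV[K]_d -> K) : decaying f ->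
  Rdint (fun x => c * f x) = c * Rdint f.
Proof.
move=> /integrable_decaying df; rewrite /Rdint.
exact: (@RintegralZl _ _ _ (mu d) setT (fun t => f (row_of_tuple t))).
Qed.

Definition cdecaying d (f : 'rV[K]_d -> K[i]) := decaying (Ref f) /\ decaying (Imf f).

Lemma cdecaying_bound d (f : 'rV[K]_d -> K[i]) : cdecaying f ->
  exists2 C : K, 0 <= C & forall x, cabs (f x) <= C * (1 + n1 x) ^- d.+1.
Proof.
move=> [[_ [C C0 fC]] [_ [C' C'0 fC']]]; exists (C + C'); first exact: addr_ge0.
by move=> x; rewrite (le_trans (cabs_le _))// mulrDl; apply: lerD; [exact: fC|exact: fC'].
Qed.

Lemma cdecaying_of_bound d (f : 'rV[K]_d -> K[i]) C : ccontinuous f -> 0 <= C ->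
  (forall x, cabs (f x) <= C * (1 + n1 x) ^- d.+1) -> cdecaying f.
Proof.
move=> [c1 c2] C0 fC; split; split => //; exists C => // x; apply: le_trans (fC x).
  exact: Re_le_cabs.
exact: Im_le_cabs.
Qed.

Lemma integralRdE d (f : 'rV[K]_d -> K[i]) : integralRd f = (Rdint (Ref f) +i* Rdint (Imf f))%C.
Proof. by []. Qed.

(** The factor 2 comes from estimating real and imaginary parts separately. *)
Lemma cabs_integralRd_le d (f : 'rV[K]_d -> K[i]) C : ccontinuous f -> 0 <= C ->
  (forall x, cabs (f x) <= C * (1 + n1 x) ^- d.+1) ->
  cabs (integralRd f) <= 2 * C * pi ^+ d.
Proof.
move=> [c1 c2] C0 fC; rewrite (le_trans (cabs_le _))//= -mulrA mulr_natl mulr2n.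
apply: lerD; apply: Rdint_le => // x; apply: le_trans (fC x).
  exact: Re_le_cabs.
exact: Im_le_cabs.
Qed.

Lemma integralRdD d (f g : 'rV[K]_d -> K[i]) : cdecaying f -> cdecaying g ->
  integralRd (fun x => f x + g x) = integralRd f + integralRd g.
Proof.
move=> [f1 f2] [g1 g2]; apply: complex_ext; rewrite ?cReD ?cImD /= -/(Rdint _).
  rewrite -/(Rdint (Ref f)) -/(Rdint (Ref g)) -RdintD//; congr Rdint.
  by apply/funext => x; rewrite /Ref cReD.
rewrite -/(Rdint (Imf f)) -/(Rdint (Imf g)) -RdintD//; congr Rdint.
by apply/funext => x; rewrite /Imf cImD.
Qed.

Lemma integralRdZ d c (f : 'rV[K]_d -> K[i]) : cdecaying f ->
  integralRd (fun x => c * f x) = c * integralRd f.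
Proof.
move=> [f1 f2]; apply: complex_ext; rewrite ?cReM ?cImM !integralRdE /=.
  rewrite -!RdintZ// -RdintB; try exact: decayingZ.
  by congr Rdint; apply/funext => x; rewrite /Ref cReM.
rewrite -!RdintZ// -RdintD; try exact: decayingZ.
by congr Rdint; apply/funext => x; rewrite /Imf cImM.
Qed.

Lemma cdecaying_mul_bounded d (f g : 'rV[K]_d -> K[i]) M : cdecaying f -> ccontinuous g ->
  (forall x, cabs (g x) <= M) -> cdecaying (fun x => f x * g x).
Proof.
move=> [f1 f2] [g1 g2] gM.
have b1 x : `|Ref g x| <= M by rewrite (le_trans _ (gM x))// Re_le_cabs.
have b2 x : `|Imf g x| <= M by rewrite (le_trans _ (gM x))// Im_le_cabs.
split.
  rewrite (_ : Ref _ = fun x => Ref f x * Ref g x - Imf f x * Imf g x); last first.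
    by apply/funext => x; rewrite /Ref cReM.
  by apply: decayingB; exact: decaying_mul_bounded.
rewrite (_ : Imf _ = fun x => Ref f x * Imf g x + Imf f x * Ref g x); last first.
  by apply/funext => x; rewrite /Imf cImM.
by apply: decayingD; exact: decaying_mul_bounded.
Qed.

Lemma cdecayingD d (f g : 'rV[K]_d -> K[i]) : cdecaying f -> cdecaying g ->
  cdecaying (fun x => f x + g x).
Proof.
move=> [f1 f2] [g1 g2]; split.
  rewrite (_ : Ref _ = fun x => Ref f x + Ref g x); first exact: decayingD.
  by apply/funext => x; rewrite /Ref cReD.
rewrite (_ : Imf _ = fun x => Imf f x + Imf g x); first exact: decayingD.
by apply/funext => x; rewrite /Imf cImD.
Qed.

Lemma cdecayingZ d c (f : 'rV[K]_d -> K[i]) : cdecaying f -> cdecaying (fun x => c * f x).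
Proof.
move=> df; rewrite (_ : (fun x => _) = (fun x => f x * c)); last by apply/funext => x; rewrite mulrC.
by apply: (@cdecaying_mul_bounded _ _ _ (cabs c)) => //; split; exact: cst_continuous.
Qed.

Definition phase d (l x : 'rV[K]_d) : K[i] := (cos (dotv l x) -i* sin (dotv l x))%C.

Lemma continuous_dotv d (l : 'rV[K]_d) : continuous (dotv l).
Proof.
apply: continuous_sum => j x.
exact: (cvgM (cvg_cst (l 0 j)) (@coord_continuous_rV K d j x)).
Qed.

Lemma ccontinuous_phase d (l : 'rV[K]_d) : ccontinuous (phase l).
Proof.
split => x; rewrite /Ref /Imf /phase /=.
  exact: (continuous_comp (@continuous_dotv d l x) (@continuous_cos K _)).
exact: cvgN (continuous_comp (@continuous_dotv d l x) (@continuous_sin K _)).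
Qed.

(* The Fourier transform without its normalising constant. *)
Definition ftsf d (f : 'rV[K]_d -> K[i]) l := integralRd (fun x => f x * phase l x).

Lemma fourierE d (f : 'rV[K]_d -> K[i]) l :
  fourier f l = ((2 * pi) `^ (- (d%:R / 2)))%:C%C * ftsf f l.
Proof. by []. Qed.

Lemma fourier_neq0 d (f : 'rV[K]_d -> K[i]) l : (fourier f l != 0) = (ftsf f l != 0).
Proof.
rewrite fourierE mulf_eq0 negb_or andbC; case: eqP => //= _.
by rewrite -cabs_eq0 cabs_real normr_eq0 gt_eqF// powR_gt0// mulr_gt0// pi_gt0.
Qed.

Lemma cdecaying_phase d (f : 'rV[K]_d -> K[i]) l : cdecaying f ->
  cdecaying (fun x => f x * phase l x).
Proof.
move=> df; apply: (@cdecaying_mul_bounded _ _ _ 1) => //; first exact: ccontinuous_phase.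
by move=> x; rewrite cabs_phase.
Qed.

Lemma ftsfD d (f g : 'rV[K]_d -> K[i]) l : cdecaying f -> cdecaying g ->
  ftsf (fun x => f x + g x) l = ftsf f l + ftsf g l.
Proof.
move=> df dg; rewrite /ftsf -integralRdD; try exact: cdecaying_phase.
by congr integralRd; apply/funext => x; rewrite mulrDl.
Qed.

Lemma ftsfZ d c (f : 'rV[K]_d -> K[i]) l : cdecaying f ->
  ftsf (fun x => c * f x) l = c * ftsf f l.
Proof.
move=> df; rewrite /ftsf -integralRdZ; last exact: cdecaying_phase.
by congr integralRd; apply/funext => x; rewrite mulrA.
Qed.

Lemma cabs_ftsf_le d (f : 'rV[K]_d -> K[i]) C l : cdecaying f -> 0 <= C ->
  (forall x, cabs (f x) <= C * (1 + n1 x) ^- d.+1) -> cabs (ftsf f l) <= 2 * C * pi ^+ d.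
Proof.
move=> df C0 fC; apply: cabs_integralRd_le => //.
  by have [[? _] [? _]] := cdecaying_phase l df.
by move=> x; rewrite cabsM cabs_phase mulr1.
Qed.

(** A relation carries existence and value of the derivative together, whereas [partial] has a value
    even where no derivative exists. *)
Definition cderive d (j : 'I_d) (f f' : 'rV[K]_d -> K[i]) := forall x,
  is_derive x (basisv K j) (Ref f) (Ref f' x) /\ is_derive x (basisv K j) (Imf f) (Imf f' x).

Lemma cderiveM d (j : 'I_d) (f f' g g' : 'rV[K]_d -> K[i]) :
  cderive j f f' -> cderive j g g' ->
  cderive j (fun x => f x * g x) (fun x => f x * g' x + f' x * g x).
Proof.
move=> df dg x; have [f1 f2] := df x; have [g1 g2] := dg x; split.
  apply: (isd_ext _ _ (isdB (isdM f1 g1) (isdM f2 g2))) => [y|].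
    by rewrite /Ref cReM.
  by rewrite /Ref cReD !cReM /Imf; ring.
apply: (isd_ext _ _ (isdD (isdM f1 g2) (isdM f2 g1))) => [y|].
  by rewrite /Imf cImM.
by rewrite /Imf cImD !cImM /Ref; ring.
Qed.

Lemma is_derive_dotv d (j : 'I_d) (l x : 'rV[K]_d) :
  is_derive x (basisv K j) (dotv l) (l 0 j).
Proof.
rewrite (_ : dotv l = \sum_(i < d) (fun y : 'rV[K]_d => l 0 i * y 0 i)); last first.
  by apply/funext => y; rewrite fct_sumE.
apply: is_derive_eq.
  by apply: is_derive_sum => i; apply: isdZ; exact: isd_coord.
rewrite (bigD1 j)//= eqxx mulr1 big1 ?addr0// => i /negbTE ->.
by rewrite mulr0.
Qed.

Lemma cderive_phase d (j : 'I_d) (l : 'rV[K]_d) :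
  cderive j (phase l) (fun x => - (0 +i* l 0 j)%C * phase l x).
Proof.
move=> x; have D := is_derive_dotv j l x; split.
  apply: (isd_ext _ _ (isd_comp D (is_derive_cos (dotv l x)))) => //.
  by rewrite /Ref cReM/=; ring.
apply: (isd_ext _ _ (isdN (isd_comp D (is_derive_sin (dotv l x))))) => //.
by rewrite /Imf cImM/=; ring.
Qed.

Lemma integralRd_derivative_eq0 d (j : 'I_d) (f f' : 'rV[K]_d -> K[i]) :
  cdecaying f -> cdecaying f' -> cderive j f f' -> integralRd f' = 0.
Proof.
move=> [f1 f2] [f1' f2'] D; rewrite integralRdE.
have -> : Rdint (Ref f') = 0.
  by apply: (@Rdint_derivative_eq0 _ _ j _ (Ref f)) => // x; case: (D x).
have -> // : Rdint (Imf f') = 0.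
by apply: (@Rdint_derivative_eq0 _ _ j _ (Imf f)) => // x; case: (D x).
Qed.

(** Integration by parts: the derivative of [f * phase l] has integral 0, and differentiating the
    phase produces [- i l_j]. *)
Lemma ftsf_derivative d (j : 'I_d) (f f' : 'rV[K]_d -> K[i]) l :
  cdecaying f -> cdecaying f' -> cderive j f f' ->
  ftsf f' l = (0 +i* l 0 j)%C * ftsf f l.
Proof.
move=> df df' D; have dp := cdecaying_phase l df; have dp' := cdecaying_phase l df'.
have := integralRd_derivative_eq0 _ _ (cderiveM D (cderive_phase j l)).
rewrite (_ : (fun x => _ + _) = (fun x => (- (0 +i* l 0 j)%C) * (f x * phase l x) + f' x * phase l x)); last first.
  by apply/funext => x; ring.
move=> /(_ dp); rewrite integralRdD//; last exact: cdecayingZ.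
rewrite integralRdZ// -/(ftsf f l) -/(ftsf f' l) mulNr.
move=> H; apply/eqP; rewrite -subr_eq0 addrC; apply/eqP; apply: H.
by apply: cdecayingD => //; exact: cdecayingZ.
Qed.

End Fourier.

(** * The inversion inequality in dimension d *)

Section Inversion.
Variable K : realType.
Local Notation leb := (@lebesgue_measure K).
Local Notation mu n := (@lebesgue_tuple K n).

(** Provides the continuity required by [line_inversion]. The majorant is independent of [t], since
    [|t|] only enlarges the weight. *)
Lemma continuous_Rdint_slice d (g : 'rV[K]_d.+1 -> K) : decaying g ->
  continuous (fun t => Rdint (fun x => g (consr t x))).
Proof.
move=> dg t; have [cg [C C0 gC]] := dg.
have ti : t \in (`]t - 1, t + 1[%classic : set K).
  by rewrite inE/= in_itv/= ltrDl ltr01 ltrBlDr ltrDl ltr01.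
apply: (@continuity_under_integral K _ _ (mu d) (fun t u => g (consr t (row_of_tuple u)))
  setT measurableT (t - 1) (t + 1) _ _
  (fun u => C * (1 + n1 (row_of_tuple u)) ^- d.+1) _ _ t ti).
- by move=> s _; exact: integrable_decaying (decaying_slice_r s dg).
- by apply: aeW => u _ s _; exact: continuous_slice_l.
- exact: (integrableZl measurableT C (integrable_weight K d)).
- move=> s _; apply: aeW => u _; rewrite (le_trans (gC _))// ler_wpM2l//.
  rewrite lef_pV2 ?posrE ?exprn_gt0 ?add_n1_gt0//.
  have n0 := @n1_ge0 K d (row_of_tuple u).
  apply: (@le_trans _ _ ((1 + n1 (row_of_tuple u)) ^+ d.+2)).
    by rewrite ler_weXn2l// lerDl.
  by rewrite lerXn2r ?nnegrE ?addr_ge0 ?n1_ge0// n1_consr lerD2l lerDr.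
Qed.

(** This is [integral_weight_le] with base [1 + |t|]: the exponent exceeds the slice dimension by 2,
    so [(1 + |t|)^-2] remains after integration. *)
Lemma Rdint_slice_le d (g : 'rV[K]_d.+1 -> K) C t : decaying g -> 0 <= C ->
  (forall x, `|g x| <= C * (1 + n1 x) ^- d.+2) ->
  `|Rdint (fun x => g (consr t x))| <= C * pi ^+ d / (1 + t ^+ 2).
Proof.
move=> dg C0 gC; have dgt := decaying_slice_r t dg.
have t0 : 0 < 1 + `|t| by rewrite ltr_pwDl.
have ig := integrable_decaying dgt.
rewrite /Rdint -lee_fin EFin_normr_Rintegral//.
apply: (le_trans (le_abse_integral (mu d) measurableT (measurable_int (mu d) ig))).
apply: (@le_trans _ _ (\int[mu d]_u (C%:E * ((1 + `|t| + n1 (row_of_tuple u)) ^- (d + 2))%:E))%E).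
  apply: ge0_le_integral => //.
  - exact: measurableT_comp (measurable_int (mu d) ig).
  - by apply: emeasurable_funM => //; exact: measurable_weight.
  - move=> u _; rewrite lee_fin -addrA -n1_consr addn2; exact: gC.
rewrite ge0_integralZl//.
- apply: (@le_trans _ _ (C%:E * (pi ^+ d * (1 + `|t|) ^- 2)%:E)%E).
    by rewrite lee_wpmul2l ?lee_fin//; exact: integral_weight_le.
  rewrite -EFinM lee_fin mulrA ler_wpM2l ?mulr_ge0 ?exprn_ge0 ?(ltW (pi_gt0 _))//.
  rewrite lef_pV2 ?posrE ?exprn_gt0//; last by rewrite ltr_pwDl// sqr_ge0.
  rewrite sqrrD expr1n mul1r -[t ^+ 2]real_normK ?num_real//.
  by rewrite addrAC lerDl mulrn_wge0.
- exact: measurable_weight.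
- by move=> u _; rewrite lee_fin invr_ge0 exprn_ge0// ltW// add_n1_gt0.
Qed.

Lemma dotv_consr d l t (m x : 'rV[K]_d) :
  dotv (consr l m) (consr t x) = l * t + dotv m x.
Proof.
rewrite /dotv big_ord_recl !consr0; congr (_ + _).
by apply: eq_bigr => j _; rewrite !consrS.
Qed.

Lemma phase_consr d l t (m x : 'rV[K]_d) :
  phase (consr l m) (consr t x) = phase m x * (cos (l * t) -i* sin (l * t))%C.
Proof.
rewrite /phase dotv_consr cosD sinD; apply: complex_ext; rewrite ?cReM ?cImM/=; ring.
Qed.

Lemma cdecaying_slice_r d (f : 'rV[K]_d.+1 -> K[i]) t : cdecaying f ->
  cdecaying (fun x => f (consr t x)).
Proof.
by move=> [f1 f2]; split; [exact: (decaying_slice_r t f1)|exact: (decaying_slice_r t f2)].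
Qed.

(** For fixed [m], the full transform is the one-dimensional transform in [l] of the partial
    transform [p + i q] of the slices. Applying [line_inversion] to [p] and to [q] gives [2 B]
    each. *)
Lemma ftsf_slice_le d (f : 'rV[K]_d.+1 -> K[i]) (m : 'rV[K]_d) (B : K) : cdecaying f -> 0 <= B ->
  (forall l : K, cabs (ftsf f (consr l m)) <= B / (1 + l ^+ 2)) ->
  forall t, cabs (ftsf (fun x => f (consr t x)) m) <= 4 * B.
Proof.
move=> df B0 fB t.
(* Frequency 0 in the first coordinate: the slices of [G] are the integrands of the partial
   transform, while [G] itself decays on the whole space. *)
pose G (x : 'rV[K]_d.+1) : K[i] := f x * phase (consr 0 m) x.
have dG : cdecaying G by exact: cdecaying_phase.
have [dG1 dG2] := dG.
pose p s := Rdint (fun x => Ref G (consr s x)).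
pose q s := Rdint (fun x => Imf G (consr s x)).
have cp : continuous p by exact: continuous_Rdint_slice.
have cq : continuous q by exact: continuous_Rdint_slice.
have [C C0 GC] := cdecaying_bound dG.
pose C' := C * pi ^+ d.
have C'0 : 0 <= C' by rewrite mulr_ge0// exprn_ge0// ltW// pi_gt0.
have pC s : `|p s| <= C' / (1 + s ^+ 2).
  by apply: Rdint_slice_le => // x; rewrite (le_trans _ (GC x))// Re_le_cabs.
have qC s : `|q s| <= C' / (1 + s ^+ 2).
  by apply: Rdint_slice_le => // x; rewrite (le_trans _ (GC x))// Im_le_cabs.
have GE s x : f (consr s x) * phase m x = G (consr s x).
  rewrite /G phase_consr mul0r cos0 sin0 oppr0; congr (_ * _).
  by rewrite -[LHS]mulr1; congr (_ * _).
pose Pc l := \int[leb]_s (p s * cos (l * s)); pose Ps l := \int[leb]_s (p s * sin (l * s)).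
pose Qc l := \int[leb]_s (q s * cos (l * s)); pose Qs l := \int[leb]_s (q s * sin (l * s)).
have HE l s x : f (consr s x) * phase (consr l m) (consr s x) =
    G (consr s x) * (cos (l * s) -i* sin (l * s))%C.
  by rewrite phase_consr mulrA GE.
have dH l := cdecaying_phase (consr l m) df.
have ReE l : complex.Re (ftsf f (consr l m)) = Pc l + Qs l.
  have [d1 _] := dH l; rewrite /ftsf integralRdE /= Rdint_consr//.
  rewrite -RintegralD//; last 2 first.
  - exact: integrable_mul_cos pC.
  - exact: integrable_mul_sin qC.
  apply: eq_Rintegral => s _; rewrite mulrC [q s * _]mulrC -!RdintZ -?RdintD.
  - congr Rdint; apply/funext => x; rewrite /Ref HE /Imf.
    by case: (G (consr s x)) => a b /=; ring.
  - by apply: decayingZ; exact: (decaying_slice_r s dG1).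
  - by apply: decayingZ; exact: (decaying_slice_r s dG2).
  - exact: (decaying_slice_r s dG2).
  - exact: (decaying_slice_r s dG1).
have ImE l : complex.Im (ftsf f (consr l m)) = Qc l - Ps l.
  have [_ d1] := dH l; rewrite /ftsf integralRdE /= Rdint_consr//.
  rewrite -RintegralB//; last 2 first.
  - exact: integrable_mul_cos qC.
  - exact: integrable_mul_sin pC.
  apply: eq_Rintegral => s _; rewrite mulrC [p s * _]mulrC -!RdintZ -?RdintB.
  - congr Rdint; apply/funext => x; rewrite /Imf HE /Ref.
    by case: (G (consr s x)) => a b /=; ring.
  - by apply: decayingZ; exact: (decaying_slice_r s dG2).
  - by apply: decayingZ; exact: (decaying_slice_r s dG1).
  - exact: (decaying_slice_r s dG1).
  - exact: (decaying_slice_r s dG2).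
have cN (h : K -> K) l : \int[leb]_s (h s * cos (- l * s)) = \int[leb]_s (h s * cos (l * s)).
  by apply: eq_Rintegral => s _; rewrite mulNr cosN.
have sN (h : K -> K) l : (forall s, `|h s| <= C' / (1 + s ^+ 2)) -> continuous h ->
    \int[leb]_s (h s * sin (- l * s)) = - \int[leb]_s (h s * sin (l * s)).
  move=> hC ch; rewrite -[RHS]mulN1r -(RintegralZl (- 1) measurableT (integrable_mul_sin l ch hC)).
  by apply: eq_Rintegral => s _; rewrite mulNr sinN mulrN mulN1r.
have R1 l : `|Pc l + Qs l| <= B / (1 + l ^+ 2).
  by rewrite -ReE (le_trans (Re_le_cabs _)).
have R2 l : `|Pc l - Qs l| <= B / (1 + l ^+ 2).
  have := R1 (- l); rewrite sqrrN /Pc /Qs cN sN//.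
have I1 l : `|Qc l - Ps l| <= B / (1 + l ^+ 2).
  by rewrite -ImE (le_trans (Im_le_cabs _)).
have I2 l : `|Qc l + Ps l| <= B / (1 + l ^+ 2).
  by have := I1 (- l); rewrite sqrrN /Qc /Ps cN sN// opprK.
(* Passing from [l] to [-l] flips the sine integrals only. The bounds on sum and difference
   therefore bound each cosine and sine integral by itself. *)
have avg (a b c : K) : `|a + b| <= c -> `|a - b| <= c -> `|a| <= c /\ `|b| <= c.
  by rewrite !ler_norml => /andP[? ?] /andP[? ?]; split; apply/andP; split; lra.
have pB := line_inversion cp C'0 B0 pC (fun l _ => (avg _ _ _ (R1 l) (R2 l)).1)
  (fun l _ => (avg _ _ _ (I2 l) (I1 l)).2).
have qB := line_inversion cq C'0 B0 qC (fun l _ => (avg _ _ _ (I2 l) (I1 l)).1)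
  (fun l _ => (avg _ _ _ (R1 l) (R2 l)).2).
rewrite /ftsf integralRdE (le_trans (cabs_le _))//=.
rewrite (_ : 4 * B = 2 * B + 2 * B); last by ring.
apply: lerD; [apply: le_trans (pB t)|apply: le_trans (qB t)];
  rewrite le_eqVlt; apply/orP; left; apply/eqP; congr (`|_|); congr Rdint;
  by apply/funext => x; rewrite /Ref /Imf GE.
Qed.

(** Each step freezes the first coordinate at its value in [x] and pays a factor 4; for a fixed
    remaining frequency, the other factors of the product belong to the constant in
    [ftsf_slice_le]. *)
Lemma Rd_inversion d (f : 'rV[K]_d -> K[i]) (B : K) : cdecaying f -> 0 <= B ->
  (forall l, cabs (ftsf f l) <= B * \prod_(j < d) (1 + l 0 j ^+ 2)^-1) ->
  forall x, cabs (f x) <= 4 ^+ d * B.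
Proof.
elim: d f B => [|d IH] f B df B0 fB x.
  have := fB 0; rewrite big_ord0 mulr1 expr0 mul1r; congr (cabs _ <= _).
  (* In dimension 0 the measure is a point mass, so the transform of [f] is its only value. *)
  have E (h : 'rV[K]_0 -> K) : Rdint h = h x.
    rewrite /Rdint /Rintegral /= integral_dirac//.
      by rewrite diracT mul1e/=; congr h; apply/rowP => -[].
    apply/measurable_EFinP; apply: (@continuous_measurable_row K 0 h).
    move=> y; rewrite (_ : h = cst (h y)); first exact: cst_continuous.
    by apply/funext => z; congr h; apply/rowP => -[].
  rewrite /ftsf integralRdE !E /Ref /Imf /phase /dotv big_ord0 cos0 sin0 oppr0.
  have -> : (1 +i* 0)%C = 1 :> K[i] by [].
  by rewrite mulr1; case: (f x).
rewrite [x]consr_eta exprSr -mulrA.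
apply: (IH (fun y => f (consr (x 0 ord0) y)) (4 * B)).
- exact: cdecaying_slice_r.
- by rewrite mulr_ge0.
- move=> m; rewrite -mulrA; apply: ftsf_slice_le => //.
    by rewrite mulr_ge0// prodr_ge0// => j _; rewrite invr_ge0 addr_ge0// sqr_ge0.
  move=> l; have := fB (consr l m); rewrite big_ord_recl consr0.
  under eq_bigr do rewrite consrS.
  by rewrite mulrA mulrAC.
Qed.

End Inversion.

(** * Schwartz functions and constant-coefficient operators *)

Section RealSmooth.
Variables (K : realType) (d : nat).
Implicit Types (u v : 'rV[K]_d -> K) (x : 'rV[K]_d) (i j : 'I_d) (s : seq 'I_d).

Definition rpartial j u : 'rV[K]_d -> K := fun x => 'D_(basisv K j) u x.

Definition rpartials s u := foldr rpartial u s.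

Definition rsmooth u := forall s, continuous (rpartials s u) /\
  forall j x, derivable (rpartials s u) x (basisv K j).

Lemma rpartials_cat s t u : rpartials (s ++ t) u = rpartials s (rpartials t u).
Proof. exact: foldr_cat. Qed.

Lemma rsmooth_rpartials s u : rsmooth u -> rsmooth (rpartials s u).
Proof. by move=> su t; rewrite -rpartials_cat. Qed.

Lemma isd_rpartials s u j x : rsmooth u ->
  is_derive x (basisv K j) (rpartials s u) (rpartials (j :: s) u x).
Proof. by move=> su; apply: derivableP; case: (su s). Qed.

Lemma isd_rpartial u j x : rsmooth u -> is_derive x (basisv K j) u (rpartial j u x).
Proof. exact: (@isd_rpartials [::]). Qed.

Lemma mvt_line u j x (s : K) : rsmooth u -> 0 < s -> exists2 a, 0 < a < s &
  u (s *: basisv K j + x) - u x = s * rpartial j u (a *: basisv K j + x).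
Proof.
move=> su s0; pose phi (a : K) := u (a *: basisv K j + x).
have dphi (a : K) : is_derive a (1 : K) phi (rpartial j u (a *: basisv K j + x)).
  exact: (is_derive_line u x (basisv K j) a _).1 (isd_rpartial j _ su).
have [a] := @MVT K phi (fun a => rpartial j u (a *: basisv K j + x)) 0 s s0
  (fun a _ => dphi a) (continuous_subspaceT (fun a => is_derive1_continuous (dphi a))).
rewrite in_itv/= => as_ E; exists a => //.
by move: E; rewrite /phi scale0r add0r subr0 mulrC.
Qed.

Lemma continuous_addl_rV (y : 'rV[K]_d) : continuous (fun z : 'rV[K]_d => y + z).
Proof.
apply: continuous_rV => j.
rewrite (_ : (fun z => _) = fun z : 'rV[K]_d => y 0 j + z 0 j).
  by move=> z; exact: (cvgD (cvg_cst (y 0 j)) (@coord_continuous_rV K d j z)).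
by apply/funext => z; rewrite mxE.
Qed.

Lemma rsmoothB_shift u (y : 'rV[K]_d) : rsmooth u -> rsmooth (fun x => u (y + x) - u x).
Proof.
move=> su; have E s : rpartials s (fun x => u (y + x) - u x) =
    fun x => rpartials s u (y + x) - rpartials s u x.
  elim: s => //= j s ->; apply/funext => x; apply: derive_val.
  have D := isd_rpartials s j x su.
  have /is_derive_line0 D' := isd_rpartials s j (y + x) su.
  apply: isdB => //; apply/is_derive_line0; apply: (isd_ext _ _ D') => // h.
  by rewrite addrCA.
move=> s; rewrite E; split=> [x|j x].
  have c := @continuous_addl_rV y x.
  exact: (cvgB (continuous_comp c ((su s).1 (y + x))) ((su s).1 x)).
have D := isd_rpartials s j x su.
have /is_derive_line0 D' := isd_rpartials s j (y + x) su.
have H : is_derive x (basisv K j) (fun x => rpartials s u (y + x) - rpartials s u x)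
   (rpartials (j :: s) u (y + x) - rpartials (j :: s) u x).
  apply: isdB => //; apply/is_derive_line0; apply: (isd_ext _ _ D') => // h.
  by rewrite addrCA.
by case: H.
Qed.

(* Two applications of the mean value theorem to the second difference. *)
Lemma second_difference u i j x (s : K) : rsmooth u -> 0 < s -> exists2 y, `|y - x| <= 2 * s &
  u (s *: basisv K i + (s *: basisv K j + x)) - u (s *: basisv K j + x)
   - (u (s *: basisv K i + x) - u x) = s ^+ 2 * rpartials [:: i; j] u y.
Proof.
move=> su s0; have sv := rsmoothB_shift (s *: basisv K i) su.
have [a /andP[a0 as_]] := mvt_line j x sv s0.
rewrite /rpartial.
have -> : 'D_(basisv K j) (fun x => u (s *: basisv K i + x) - u x) (a *: basisv K j + x) =
   rpartial j u (s *: basisv K i + (a *: basisv K j + x)) - rpartial j u (a *: basisv K j + x).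
  apply: derive_val; apply: isdB; last exact: isd_rpartial.
  have /is_derive_line0 D' := isd_rpartial j (s *: basisv K i + (a *: basisv K j + x)) su.
  apply/is_derive_line0; apply: (isd_ext _ _ D') => // h.
  by rewrite addrCA.
move=> E; have [b /andP[b0 bs] E2] := mvt_line i (a *: basisv K j + x) (rsmooth_rpartials [:: j] su) s0.
exists (b *: basisv K i + (a *: basisv K j + x)).
  apply: (le_trans (norm_le_n1 _)); rewrite addrA addrK.
  apply: (le_trans (n1D _ _)); rewrite mulr_natl mulr2n.
  have n1e (c : K) k : 0 <= c -> n1 (c *: basisv K k) = c.
    move=> c0; rewrite /n1 (bigD1 k)//= big1 => [|l lk].
      by rewrite !mxE !eqxx mulr1 ger0_norm// addr0.
    by rewrite !mxE/= (negbTE lk) mulr0 normr0.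
  by rewrite (n1e _ _ _ (ltW b0)) (n1e _ _ _ (ltW a0)); apply: lerD; exact: ltW.
by rewrite E E2 expr2 mulrA.
Qed.

(** Here [p, q, r, t] are the values at the corners of a square and [c] is its area. The two
    iterated differences coincide, hence [A' = B'] is close to both [A] and [B]. *)
Lemma dist_le_of_quotients (A B A' B' c p q r t e : K) : c != 0 ->
  p - q - (r - t) = c * A' -> p - r - (q - t) = c * B' ->
  `|A - A'| < e / 2 -> `|B - B'| < e / 2 -> `|A - B| <= e.
Proof.
move=> c0 EA EB HA HB; have E : A' = B' by apply: (mulfI c0); rewrite -EA -EB; ring.
rewrite E in HA; have -> : A - B = A - B' - (B - B') by ring.
by rewrite (le_trans (ler_normB _ _))// [leRHS]splitr lerD// ltW.
Qed.

(** Schwarz's theorem: the second difference over a small square equals its area times either mixed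
    derivative at some nearby point, and both derivatives are continuous at [x]. *)
Lemma rpartialC u i j : rsmooth u -> rpartial i (rpartial j u) = rpartial j (rpartial i u).
Proof.
move=> su; apply/funext => x; apply/eqP; rewrite -subr_eq0 -normr_le0.
apply/ler_addgt0Pr => e e0; rewrite add0r.
have e20 : 0 < e / 2 by rewrite divr_gt0.
have c1 : {for x, continuous (rpartials [:: i; j] u)} by apply: (su [:: i; j]).1.
have c2 : {for x, continuous (rpartials [:: j; i] u)} by apply: (su [:: j; i]).1.
move/cvgrPdist_lt/(_ _ e20)/nbhs_ballP : c1 => [d1 /= d10 H1].
move/cvgrPdist_lt/(_ _ e20)/nbhs_ballP : c2 => [d2 /= d20 H2].
(* The intermediate points lie within [2 s] of [x], hence inside both balls. *)
pose s := Num.min d1 d2 / 3.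
have m0 : 0 < Num.min d1 d2 by rewrite lt_min d10.
have s0 : 0 < s by rewrite divr_gt0.
have s3 : 2 * s < Num.min d1 d2.
  by rewrite /s mulrCA gtr_pMr// ltr_pdivrMr// mul1r ltr_nat.
have B1 y : `|y - x| <= 2 * s -> `|rpartials [:: i; j] u x - rpartials [:: i; j] u y| < e / 2.
  move=> yx; apply: H1; rewrite -ball_normE/= distrC.
  by apply: (le_lt_trans yx); apply: (lt_le_trans s3); rewrite ge_min lexx.
have B2 z : `|z - x| <= 2 * s -> `|rpartials [:: j; i] u x - rpartials [:: j; i] u z| < e / 2.
  move=> zx; apply: H2; rewrite -ball_normE/= distrC.
  by apply: (le_lt_trans zx); apply: (lt_le_trans s3); rewrite ge_min lexx orbT.
have [y /B1 {}B1 Ey] := second_difference i j x su s0.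
have [z /B2 {}B2 Ez] := second_difference j i x su s0.
have s20 : s ^+ 2 != 0 by rewrite gt_eqF// exprn_gt0.
rewrite [s *: basisv K j + (s *: basisv K i + x)]addrCA in Ez.
exact: (dist_le_of_quotients s20 Ey Ez B1 B2).
Qed.

Lemma rpartials_front i s t u : rsmooth u -> rpartials (s ++ i :: t) u = rpartials (i :: s ++ t) u.
Proof.
move=> su; elim: s => //= j s ->; rewrite /= [RHS]rpartialC//.
exact: rsmooth_rpartials.
Qed.

Lemma rpartials_perm s t u : rsmooth u -> perm_eq s t -> rpartials s u = rpartials t u.
Proof.
move=> su; elim: s t => [|i s IH] t.
  by rewrite perm_sym => /perm_nilP ->.
move=> p; have it : i \in t by rewrite -(perm_mem p) mem_head.
case/splitPr: it p => t1 t2 p; rewrite rpartials_front//=.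
congr (rpartial i); apply: IH; move: p; rewrite perm_sym perm_catC/= perm_cons perm_catC.
by rewrite perm_sym.
Qed.

Lemma rpartialsD s u v : rsmooth u -> rsmooth v ->
  rpartials s (fun x => u x + v x) = fun x => rpartials s u x + rpartials s v x.
Proof.
move=> su sv; elim: s => //= j s ->; apply/funext => x; apply: derive_val.
by apply: isdD; exact: isd_rpartials.
Qed.

Lemma rpartialsZ s c u : rsmooth u ->
  rpartials s (fun x => c * u x) = fun x => c * rpartials s u x.
Proof.
move=> su; elim: s => //= j s ->; apply/funext => x; apply: derive_val.
by apply: isdZ; exact: isd_rpartials.
Qed.

Lemma rsmoothD u v : rsmooth u -> rsmooth v -> rsmooth (fun x => u x + v x).
Proof.
move=> su sv s; rewrite rpartialsD//; split=> [x|j x].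
  exact: (cvgD ((su s).1 x) ((sv s).1 x)).
by have [] := isdD (isd_rpartials s j x su) (isd_rpartials s j x sv).
Qed.

Lemma rsmoothZ c u : rsmooth u -> rsmooth (fun x => c * u x).
Proof.
move=> su s; rewrite rpartialsZ//; split=> [x|j x].
  exact: (cvgM (cvg_cst c) ((su s).1 x)).
by have [] := isdZ c (isd_rpartials s j x su).
Qed.

(** The formal derivative of the word [s] in the letter [j], with multiplicity: the Leibniz terms in
    which a derivative falls on the factor [x_j]. *)
Fixpoint deletions j s : seq (seq 'I_d) :=
  if s is i :: s' then
    (if j == i then [:: s'] else [::]) ++ map (cons i) (deletions j s')
  else [::].

Lemma isd_sum I (r : seq I) (f : I -> 'rV[K]_d -> K) (df : I -> K) x (w : 'rV[K]_d) :
  (forall k : I, is_derive x w (f k) (df k)) ->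
  is_derive x w (fun y => \sum_(k <- r) f k y) (\sum_(k <- r) df k).
Proof.
move=> H; elim: r => [|k r IH].
  by apply: (isd_ext _ _ (isdC 0 x w)) => [y|]; rewrite big_nil.
by apply: (isd_ext _ _ (isdD (H k) IH)) => [y|]; rewrite big_cons.
Qed.

Lemma isd_mul_coord s j i x u : rsmooth u ->
  is_derive x (basisv K i)
    (fun x => x 0 j * rpartials s u x + \sum_(t <- deletions j s) rpartials t u x)
    (x 0 j * rpartials (i :: s) u x + \sum_(t <- deletions j (i :: s)) rpartials t u x).
Proof.
move=> su; apply: (isd_ext _ _ (isdD (isdM (isd_coord j i x) (isd_rpartials s i x su))
   (isd_sum (deletions j s) (fun t => isd_rpartials t i x su)))) => //.
rewrite -addrA; congr (_ + _); rewrite /= big_cat big_map; congr (_ + _).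
by case: eqP => _; rewrite ?big_seq1 ?mulr1// big_nil mulr0.
Qed.

Lemma rpartials_mul_coord s j u : rsmooth u ->
  rpartials s (fun x => x 0 j * u x) =
  fun x => x 0 j * rpartials s u x + \sum_(t <- deletions j s) rpartials t u x.
Proof.
move=> su; elim: s => [|i s IH]; first by apply/funext => x; rewrite big_nil addr0.
by rewrite [LHS]/= IH; apply/funext => x; apply: derive_val; exact: isd_mul_coord.
Qed.

Lemma rsmooth_mul_coord j u : rsmooth u -> rsmooth (fun x => x 0 j * u x).
Proof.
move=> su s; rewrite rpartials_mul_coord//; split=> [x|i x].
  apply: (cvgD (cvgM (@coord_continuous_rV K d j x) ((su s).1 x))).
  by apply: continuous_sum => t; exact: (su t).1.
by have [] := isd_mul_coord s j i x su.
Qed.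

(** Words and powers of one weight replace multi-indices and monomials, so closure properties follow
    by induction on words; [schwartz_decay] supplies the bounds from the monomial form. *)
Definition rschwartz u := rsmooth u /\
  forall s N, exists2 C : K, 0 <= C & forall x, `|rpartials s u x| <= C * (1 + n1 x) ^- N.

Lemma rschwartz_rpartials s u : rschwartz u -> rschwartz (rpartials s u).
Proof.
move=> [su uC]; split; first exact: rsmooth_rpartials.
by move=> t N; rewrite -rpartials_cat.
Qed.

Lemma rschwartzD u v : rschwartz u -> rschwartz v -> rschwartz (fun x => u x + v x).
Proof.
move=> [su uC] [sv vC]; split; first exact: rsmoothD.
move=> s N; have [C C0 HC] := uC s N; have [C' C'0 HC'] := vC s N.
exists (C + C'); first exact: addr_ge0.
by move=> x; rewrite rpartialsD// mulrDl (le_trans (ler_normD _ _))// lerD.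
Qed.

Lemma rschwartzZ c u : rschwartz u -> rschwartz (fun x => c * u x).
Proof.
move=> [su uC]; split; first exact: rsmoothZ.
move=> s N; have [C C0 HC] := uC s N; exists (`|c| * C); first exact: mulr_ge0.
by move=> x; rewrite rpartialsZ// normrM -mulrA ler_wpM2l.
Qed.

Lemma rschwartz_mul_coord j u : rschwartz u -> rschwartz (fun x => x 0 j * u x).
Proof.
move=> [su uC]; split; first exact: rsmooth_mul_coord.
(* The additional power of the weight pays for the factor [x_j]. *)
move=> s N; have [C C0 HC] := uC s N.+1.
have [D D0 HD] : exists2 D : K, 0 <= D & forall x,
    `|\sum_(t <- deletions j s) rpartials t u x| <= D * (1 + n1 x) ^- N.
  elim: (deletions j s) => [|t r [D D0 IH]].
    by exists 0 => // x; rewrite big_nil normr0 mul0r.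
  have [E E0 HE] := uC t N; exists (E + D); first exact: addr_ge0.
  by move=> x; rewrite big_cons mulrDl (le_trans (ler_normD _ _))// lerD.
exists (C + D); first exact: addr_ge0.
move=> x; rewrite rpartials_mul_coord// mulrDl (le_trans (ler_normD _ _))// lerD//.
rewrite normrM (le_trans (ler_wpM2l (normr_ge0 _) (HC x)))// mulrCA ler_wpM2l//.
have n0 := add_n1_gt0 x ltr01.
rewrite exprSr invfM mulrA mulrAC ler_piMl ?invr_ge0 ?exprn_ge0 ?(ltW n0)//.
rewrite ler_pdivrMr// mul1r (le_trans (coord_le_n1 x j))// lerDr//.
Qed.

(** Lets bounds on [f] and on each [|x_j|^N f] control the full weight. For [|x| > 1] the maximum
    norm is attained at some coordinate, whose power dominates. *)
Lemma exp_add_n1_le N x :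
  (1 + n1 x) ^+ N <= d.+1%:R ^+ N * (1 + \sum_(j < d) `|x 0 j| ^+ N).
Proof.
have S0 : 0 <= \sum_(j < d) `|x 0 j| ^+ N by apply: sumr_ge0 => j _; rewrite exprn_ge0.
have n0 := n1_ge0 x.
have [x1|x1] := leP `|x| 1.
  apply: (@le_trans _ _ (d.+1%:R ^+ N)).
    rewrite lerXn2r ?nnegrE ?addr_ge0// -natr1 addrC lerD2r.
    by rewrite (le_trans (n1_le_norm x))// ler_piMr.
  by rewrite ler_peMr ?exprn_ge0// lerDl.
apply: (@le_trans _ _ (d.+1%:R ^+ N * `|x| ^+ N)).
  rewrite -exprMn lerXn2r ?nnegrE ?addr_ge0 ?mulr_ge0//.
  by rewrite -natr1 mulrDl mul1r addrC lerD ?n1_le_norm// ltW.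
rewrite ler_wpM2l ?exprn_ge0//.
have [] := @mx_norm_neq0 _ _ _ x; first by rewrite gt_eqF// (lt_trans ltr01).
move=> [i j] /= E; rewrite [`|x|]E ord1 (bigD1 j)//= addrCA lerDl.
by rewrite addr_ge0// sumr_ge0// => k _; rewrite exprn_ge0.
Qed.

End RealSmooth.

(** * Complex Schwartz functions and differential operators as lists of words *)

Section Schwartz.
Variables (K : realType) (d : nat).
Implicit Types (f g : 'rV[K]_d -> K[i]) (x l : 'rV[K]_d) (i j : 'I_d) (s : seq 'I_d).

Lemma Ref_partials s f : Ref (partials s f) = rpartials s (Ref f).
Proof. by elim: s => //= j s IH; rewrite -IH. Qed.

Lemma Imf_partials s f : Imf (partials s f) = rpartials s (Imf f).
Proof. by elim: s => //= j s IH; rewrite -IH. Qed.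

Lemma fun_complex_ext f g : Ref f = Ref g -> Imf f = Imf g -> f = g.
Proof.
move=> rfg ifg; apply/funext => x; apply: complex_ext.
  exact: (congr1 (@^~ x) rfg).
exact: (congr1 (@^~ x) ifg).
Qed.

Lemma partials_cat s t f : partials (s ++ t) f = partials s (partials t f).
Proof. exact: foldr_cat. Qed.

Definition cschwartz f := rschwartz (Ref f) /\ rschwartz (Imf f).

Lemma partials_perm s t f : cschwartz f -> perm_eq s t -> partials s f = partials t f.
Proof.
move=> [[sr _] [si _]] st; apply: fun_complex_ext.
  by rewrite !Ref_partials; exact: rpartials_perm.
by rewrite !Imf_partials; exact: rpartials_perm.
Qed.

Definition word_of (a : 'I_d -> nat) : seq 'I_d := flatten [seq nseq (a j) j | j <- enum 'I_d].

Lemma mpartialE a f : mpartial a f = partials (word_of a) f.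
Proof.
rewrite /mpartial /word_of; elim: (enum _) => //= j s IH.
rewrite partials_cat -IH; set g := foldr _ _ _; move: g => g.
by elim: (a j) => //= n ->.
Qed.

Lemma perm_word_of s : perm_eq s (word_of (fun j => count_mem j s)).
Proof.
apply/allP => /= k _; apply/eqP; rewrite /word_of count_flatten -map_comp.
rewrite (eq_map (g := fun j => if j == k then count_mem k s else 0%N)).
  rewrite sumnE big_map -(big_mkcond (fun j => j == k)) big_enum_cond /=.
  by rewrite (big_pred1 k) // => j; rewrite andbT.
by move=> j /=; rewrite count_nseq /=; case: eqP => [->|_]; rewrite ?mul1n ?mul0n.
Qed.

(** Symmetry of derivatives turns the word into a multi-index; among the seminorms only the
    monomials 1 and [x_j^N] enter, by [exp_add_n1_le]. *)
Lemma schwartz_decay f s N : schwartz f ->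
  exists2 C : K, 0 <= C & forall x, cabs (partials s f x) <= C * (1 + n1 x) ^- N.
Proof.
move=> [sf hf].
have sr : rsmooth (Ref f) by move=> t; rewrite -Ref_partials; split; [case: (sf t) => -[]|case: (sf t) => _ H j x; case: (H j x)].
have si : rsmooth (Imf f) by move=> t; rewrite -Imf_partials; split; [case: (sf t) => -[]|case: (sf t) => _ H j x; case: (H j x)].
pose b j := count_mem j s.
have E : partials s f = mpartial b f.
  rewrite mpartialE; apply: fun_complex_ext.
    by rewrite !Ref_partials; apply: rpartials_perm => //; exact: perm_word_of.
  by rewrite !Imf_partials; apply: rpartials_perm => //; exact: perm_word_of.
rewrite E.
have [C0 HC0] := hf (fun=> 0%N) b.
have HCj j := hf (fun k => if k == j then N else 0%N) b.
pose Cj j := sval (cid (HCj j)).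
have HCj' j x : `|x 0 j| ^+ N * cabs (mpartial b f x) <= Cj j.
  have := svalP (cid (HCj j)) x; rewrite -/(Cj j) cabsM cabs_real /monomial (bigD1 j)//= eqxx.
  rewrite big1 ?mulr1 ?normrX// => k /negbTE ->; by rewrite expr0.
have C00 x : cabs (mpartial b f x) <= C0.
  have := HC0 x; rewrite cabsM cabs_real /monomial big1 ?normr1 ?mul1r// => k _.
have C0p : 0 <= C0 by rewrite (le_trans _ (C00 0))// cabs_ge0.
have Cjp j : 0 <= Cj j by rewrite (le_trans _ (HCj' j 0))// mulr_ge0 ?exprn_ge0// cabs_ge0.
exists (d.+1%:R ^+ N * (C0 + \sum_j Cj j)).
  by rewrite mulr_ge0 ?exprn_ge0// addr_ge0// sumr_ge0.
move=> x; rewrite ler_pdivlMr ?exprn_gt0 ?add_n1_gt0// mulrC.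
apply: (le_trans (ler_wpM2r (cabs_ge0 _) (exp_add_n1_le N x))).
rewrite -mulrA ler_wpM2l ?exprn_ge0// mulrDl mul1r lerD// mulr_suml.
by apply: ler_sum => j _; exact: HCj'.
Qed.

Lemma cschwartz_of_schwartz f : schwartz f -> cschwartz f.
Proof.
move=> sf; have [sm _] := sf.
split; split.
- by move=> t; rewrite -Ref_partials; split; [case: (sm t) => -[]|case: (sm t) => _ H j x; case: (H j x)].
- move=> s N; have [C C0 HC] := schwartz_decay s N sf; exists C => // x.
  by rewrite -Ref_partials (le_trans _ (HC x))// Re_le_cabs.
- by move=> t; rewrite -Imf_partials; split; [case: (sm t) => -[]|case: (sm t) => _ H j x; case: (H j x)].
- move=> s N; have [C C0 HC] := schwartz_decay s N sf; exists C => // x.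
  by rewrite -Imf_partials (le_trans _ (HC x))// Im_le_cabs.
Qed.

Lemma cschwartz_partials s f : cschwartz f -> cschwartz (partials s f).
Proof.
by move=> [f1 f2]; split; rewrite ?Ref_partials ?Imf_partials; exact: rschwartz_rpartials.
Qed.

Lemma cschwartzD f g : cschwartz f -> cschwartz g -> cschwartz (fun x => f x + g x).
Proof.
move=> [f1 f2] [g1 g2]; split.
  rewrite (_ : Ref _ = fun x => Ref f x + Ref g x); first exact: rschwartzD.
  by apply/funext => x; rewrite /Ref cReD.
rewrite (_ : Imf _ = fun x => Imf f x + Imf g x); first exact: rschwartzD.
by apply/funext => x; rewrite /Imf cImD.
Qed.

Lemma cschwartzZ (c : K[i]) f : cschwartz f -> cschwartz (fun x => c * f x).
Proof.
move=> [f1 f2]; split.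
  rewrite (_ : Ref _ = fun x => complex.Re c * Ref f x + (- complex.Im c) * Imf f x).
    by apply: rschwartzD; exact: rschwartzZ.
  by apply/funext => x; rewrite /Ref cReM mulNr.
rewrite (_ : Imf _ = fun x => complex.Re c * Imf f x + complex.Im c * Ref f x).
  by apply: rschwartzD; exact: rschwartzZ.
by apply/funext => x; rewrite /Imf cImM.
Qed.

Definition mulx j f : 'rV[K]_d -> K[i] := fun x => (x 0 j)%:C%C * f x.

Lemma Ref_mulx j f : Ref (mulx j f) = fun x => x 0 j * Ref f x.
Proof. by apply/funext => x; rewrite /Ref cReM/= mul0r subr0. Qed.

Lemma Imf_mulx j f : Imf (mulx j f) = fun x => x 0 j * Imf f x.
Proof. by apply/funext => x; rewrite /Imf cImM/= mul0r addr0. Qed.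

Lemma cschwartz_mulx j f : cschwartz f -> cschwartz (mulx j f).
Proof.
by move=> [f1 f2]; split; rewrite ?Ref_mulx ?Imf_mulx; exact: rschwartz_mul_coord.
Qed.

Lemma cschwartz_decay f N : cschwartz f ->
  exists2 C : K, 0 <= C & forall x, cabs (f x) <= C * (1 + n1 x) ^- N.
Proof.
move=> [[_ f1] [_ f2]]; have [C C0 HC] := f1 [::] N; have [C' C'0 HC'] := f2 [::] N.
exists (C + C'); first exact: addr_ge0.
by move=> x; rewrite (le_trans (cabs_le _))// mulrDl; apply: lerD; [exact: HC|exact: HC'].
Qed.

Lemma cschwartz_cdecaying f : cschwartz f -> cdecaying f.
Proof.
move=> [[s1 f1] [s2 f2]]; split; split.
- exact: (s1 [::]).1.
- exact: (f1 [::]).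
- exact: (s2 [::]).1.
- exact: (f2 [::]).
Qed.

Lemma cderive_partial j f : cschwartz f -> cderive j f (partial j f).
Proof.
by move=> [[s1 _] [s2 _]] x; split; [exact: isd_rpartial|exact: isd_rpartial].
Qed.

Lemma ftsf_partials s f l : cschwartz f ->
  ftsf (partials s f) l = (\prod_(j <- s) (0 +i* l 0 j)%C) * ftsf f l.
Proof.
move=> sf; elim: s => [|j s IH]; first by rewrite big_nil mul1r.
rewrite big_cons -mulrA -IH /=; apply: ftsf_derivative.
- exact/cschwartz_cdecaying/cschwartz_partials.
- exact/cschwartz_cdecaying/(cschwartz_partials (j :: s)).
- exact/cderive_partial/cschwartz_partials.
Qed.

Lemma rschwartz0 : rschwartz (fun _ : 'rV[K]_d => 0 : K).
Proof.
have E s : rpartials s (fun _ : 'rV[K]_d => 0 : K) = fun=> 0.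
  by elim: s => //= j s ->; apply/funext => x; apply: derive_val; exact: isdC.
split=> [s|s N]; rewrite E.
  by split=> [|j x]; [exact: cst_continuous|exact: derivable_cst].
by exists 0 => // x; rewrite normr0 mul0r.
Qed.

Lemma cschwartz_sum I (r : seq I) (F : I -> 'rV[K]_d -> K[i]) :
  (forall k, cschwartz (F k)) -> cschwartz (fun x => \sum_(k <- r) F k x).
Proof.
move=> H; elim: r => [|k r IH].
  rewrite (_ : (fun x => _) = (fun=> 0)); first by split; exact: rschwartz0.
  by apply/funext => x; rewrite big_nil.
rewrite (_ : (fun x => _) = (fun x => F k x + \sum_(k <- r) F k x)); first exact: cschwartzD.
by apply/funext => x; rewrite big_cons.
Qed.

Lemma partialsD s f g : cschwartz f -> cschwartz g ->
  partials s (fun x => f x + g x) = fun x => partials s f x + partials s g x.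
Proof.
move=> [[f1 _] [f2 _]] [[g1 _] [g2 _]]; apply: fun_complex_ext.
  rewrite Ref_partials (_ : Ref _ = fun x => Ref f x + Ref g x).
    by rewrite rpartialsD//; apply/funext => x; rewrite -!Ref_partials /Ref cReD.
  by apply/funext => x; rewrite /Ref cReD.
rewrite Imf_partials (_ : Imf _ = fun x => Imf f x + Imf g x).
  by rewrite rpartialsD//; apply/funext => x; rewrite -!Imf_partials /Imf cImD.
by apply/funext => x; rewrite /Imf cImD.
Qed.

Lemma partialsZ s (c : K[i]) f : cschwartz f ->
  partials s (fun x => c * f x) = fun x => c * partials s f x.
Proof.
move=> [[f1 _] [f2 _]]; apply: fun_complex_ext.
  rewrite Ref_partials (_ : Ref _ = fun x => complex.Re c * Ref f x + (- complex.Im c) * Imf f x).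
    rewrite rpartialsD; [|exact: rsmoothZ|exact: rsmoothZ].
    rewrite (rpartialsZ s _ f1) (rpartialsZ s _ f2).
    by apply/funext => x; rewrite -Ref_partials -Imf_partials /Ref cReM mulNr.
  by apply/funext => x; rewrite /Ref cReM mulNr.
rewrite Imf_partials (_ : Imf _ = fun x => complex.Re c * Imf f x + complex.Im c * Ref f x).
  rewrite rpartialsD; [|exact: rsmoothZ|exact: rsmoothZ].
  rewrite (rpartialsZ s _ f1) (rpartialsZ s _ f2).
  by apply/funext => x; rewrite -Ref_partials -Imf_partials /Imf cImM.
by apply/funext => x; rewrite /Imf cImM.
Qed.

Lemma partials0 s : partials s (fun _ : 'rV[K]_d => 0) = fun=> 0.
Proof.
have sf : cschwartz (fun _ : 'rV[K]_d => 0) by split; exact: rschwartz0.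
have := partialsZ s 0 sf; rewrite (_ : (fun x => _) = (fun=> 0)); last by apply/funext => x; rewrite mul0r.
by move=> ->; apply/funext => x; rewrite mul0r.
Qed.

Lemma partials_sum s I (r : seq I) (F : I -> 'rV[K]_d -> K[i]) :
  (forall k, cschwartz (F k)) ->
  partials s (fun x => \sum_(k <- r) F k x) = fun x => \sum_(k <- r) partials s (F k) x.
Proof.
move=> H; elim: r => [|k r IH].
  rewrite (_ : (fun x => _) = (fun=> 0)); first by rewrite partials0; apply/funext => x; rewrite big_nil.
  by apply/funext => x; rewrite big_nil.
rewrite (_ : (fun x => _) = (fun x => F k x + \sum_(k <- r) F k x)).
  rewrite partialsD//; last exact: cschwartz_sum.
  by rewrite IH; apply/funext => x; rewrite big_cons.
by apply/funext => x; rewrite big_cons.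
Qed.

Lemma partials_mulx s j f : cschwartz f ->
  partials s (mulx j f) =
  fun x => (x 0 j)%:C%C * partials s f x + \sum_(t <- deletions j s) partials t f x.
Proof.
move=> sf; have [[f1 _] [f2 _]] := sf.
have RS x (r : seq (seq 'I_d)) : complex.Re (\sum_(t <- r) partials t f x) = \sum_(t <- r) rpartials t (Ref f) x.
  by elim: r => [|t r IH]; rewrite ?big_nil// !big_cons cReD IH -Ref_partials.
have IS x (r : seq (seq 'I_d)) : complex.Im (\sum_(t <- r) partials t f x) = \sum_(t <- r) rpartials t (Imf f) x.
  by elim: r => [|t r IH]; rewrite ?big_nil// !big_cons cImD IH -Imf_partials.
apply: fun_complex_ext.
  rewrite Ref_partials Ref_mulx rpartials_mul_coord//; apply/funext => x.
  by rewrite -Ref_partials /Ref cReD cReM/= RS mul0r subr0.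
rewrite Imf_partials Imf_mulx rpartials_mul_coord//; apply/funext => x.
by rewrite -Imf_partials /Imf cImD cImM/= IS mul0r addr0.
Qed.

(* A constant-coefficient operator, as a list of coefficients and words in the
   partial derivatives. *)
Definition opd (L : seq (K[i] * seq 'I_d)) f : 'rV[K]_d -> K[i] :=
  fun x => \sum_(p <- L) p.1 * partials p.2 f x.

Definition opsym (L : seq (K[i] * seq 'I_d)) l : K[i] :=
  \sum_(p <- L) p.1 * \prod_(j <- p.2) (0 +i* l 0 j)%C.

Lemma cschwartz_opd L f : cschwartz f -> cschwartz (opd L f).
Proof.
move=> sf; apply: (@cschwartz_sum _ L (fun p x => p.1 * partials p.2 f x)) => p.
exact/cschwartzZ/cschwartz_partials.
Qed.

Lemma ftsf_opd L f l : cschwartz f -> ftsf (opd L f) l = opsym L l * ftsf f l.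
Proof.
move=> sf; rewrite /opsym; elim: L => [|p L IH].
  rewrite big_nil mul0r /opd (_ : (fun x => _) = (fun x => 0 * f x)).
    by rewrite ftsfZ ?mul0r//; exact: cschwartz_cdecaying.
  by apply/funext => x; rewrite big_nil mul0r.
rewrite big_cons mulrDl -IH -mulrA -ftsf_partials//.
rewrite /opd (_ : (fun x => _) = (fun x => p.1 * partials p.2 f x + opd L f x)).
  rewrite ftsfD ?ftsfZ//.
  - exact/cschwartz_cdecaying/cschwartz_partials.
  - exact/cdecayingZ/cschwartz_cdecaying/cschwartz_partials.
  - exact/cschwartz_cdecaying/cschwartz_opd.
by apply/funext => x; rewrite big_cons.
Qed.

Lemma partials_opd s L f : cschwartz f -> partials s (opd L f) = opd L (partials s f).
Proof.
move=> sf; rewrite /opd (@partials_sum s _ L (fun p x => p.1 * partials p.2 f x)); last first.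
  by move=> p; exact/cschwartzZ/cschwartz_partials.
apply/funext => x; apply: eq_bigr => p _.
rewrite partialsZ; last exact: cschwartz_partials.
by rewrite -!partials_cat (@partials_perm (s ++ p.2) (p.2 ++ s))// perm_catC.
Qed.

Lemma opdC L M f : cschwartz f -> opd L (opd M f) = opd M (opd L f).
Proof.
move=> sf; apply/funext => x; rewrite {1}/opd [RHS]/opd.
under eq_bigr => p _ do rewrite partials_opd// /opd mulr_sumr.
under [RHS]eq_bigr => p _ do rewrite partials_opd// /opd mulr_sumr.
rewrite exchange_big/=; apply: eq_bigr => p _; apply: eq_bigr => q _.
by rewrite mulrCA -!partials_cat (@partials_perm (q.2 ++ p.2) (p.2 ++ q.2))// perm_catC.
Qed.

Lemma opdD L f g : cschwartz f -> cschwartz g ->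
  opd L (fun x => f x + g x) = fun x => opd L f x + opd L g x.
Proof.
move=> sf sg; apply/funext => x; rewrite /opd -big_split/=; apply: eq_bigr => p _.
by rewrite partialsD// mulrDr.
Qed.

Lemma opdZ L (c : K[i]) f : cschwartz f -> opd L (fun x => c * f x) = fun x => c * opd L f x.
Proof.
move=> sf; apply/funext => x; rewrite /opd mulr_sumr; apply: eq_bigr => p _.
by rewrite partialsZ// mulrCA.
Qed.

(* The commutator of [opd L] with multiplication by [x_j]. *)
Definition dop j (L : seq (K[i] * seq 'I_d)) : seq (K[i] * seq 'I_d) :=
  flatten [seq [seq (p.1, t) | t <- deletions j p.2] | p <- L].

Lemma opd_mulx L j f : cschwartz f ->
  opd L (mulx j f) = fun x => (x 0 j)%:C%C * opd L f x + opd (dop j L) f x.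
Proof.
move=> sf; apply/funext => x; rewrite /opd /dop big_flatten big_map mulr_sumr -big_split/=.
apply: eq_bigr => p _; rewrite partials_mulx// mulrDr big_map mulr_sumr; congr (_ + _).
by rewrite mulrCA.
Qed.

Lemma cschwartz_iter_opd n L f : cschwartz f -> cschwartz (iter n (opd L) f).
Proof. by move=> sf; elim: n => //= n IH; exact: cschwartz_opd. Qed.

Lemma iter_opdC n L M f : cschwartz f -> opd M (iter n (opd L) f) = iter n (opd L) (opd M f).
Proof.
move=> sf; elim: n => //= n IH; rewrite -IH opdC//.
exact: cschwartz_iter_opd.
Qed.

(** The commutator has constant coefficients and so commutes with [opd L]; its [n] occurrences
    collect into one term. For [n = 0] the factor [n] neutralises [n.-1]. *)
Lemma iter_opd_mulx n L j f : cschwartz f ->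
  iter n (opd L) (mulx j f) = fun x => (x 0 j)%:C%C * iter n (opd L) f x +
    n%:R * iter n.-1 (opd L) (opd (dop j L) f) x.
Proof.
move=> sf; elim: n => [|n IH]; first by apply/funext => x; rewrite mul0r addr0.
rewrite [LHS]/= IH opdD; last 2 first.
- exact/cschwartz_mulx/cschwartz_iter_opd.
- exact/cschwartzZ/cschwartz_iter_opd/cschwartz_opd.
rewrite opdZ; last exact/cschwartz_iter_opd/cschwartz_opd.
rewrite -/(mulx j (iter n (opd L) f)) opd_mulx; last exact: cschwartz_iter_opd.
apply/funext => x; rewrite -addrA /=; congr (_ + _).
rewrite iter_opdC// -[n.+1%:R]natr1 mulrDl mul1r addrC; congr (_ + _).
by case: n {IH} => [|n]; rewrite ?mul0r.
Qed.

Lemma ftsf_iter_opd n L f l : cschwartz f ->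
  ftsf (iter n (opd L) f) l = opsym L l ^+ n * ftsf f l.
Proof.
move=> sf; elim: n => [|n IH]; first by rewrite expr0 mul1r.
by rewrite /= ftsf_opd ?IH ?exprS ?mulrA//; exact: cschwartz_iter_opd.
Qed.

Definition word_of_mpoly (P : cpoly K d) : seq (K[i] * seq 'I_d) :=
  [seq (mpoly.mcoeff m P, word_of (fun j => mpoly.fun_of_multinom m j)) | m <- mpoly.msupp P].

Lemma pdiffE P f : pdiff P f = opd (word_of_mpoly P) f.
Proof.
apply/funext => x; rewrite /pdiff /opd /word_of_mpoly [RHS]big_map.
apply: eq_bigr => m _.
by rewrite mpartialE.
Qed.

Lemma prod_word_of (a : 'I_d -> nat) (F : 'I_d -> K[i]) :
  \prod_(j <- word_of a) F j = \prod_j F j ^+ a j.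
Proof.
rewrite /word_of big_flatten big_map big_enum/=; apply: eq_bigr => j _.
by rewrite big_nseq; elim: (a j) => //= n ->; rewrite exprS.
Qed.

Lemma symbolE P l : symbol P l = opsym (word_of_mpoly P) l.
Proof.
rewrite /symbol /opsym /word_of_mpoly [RHS]big_map mpoly.mevalE; apply: eq_bigr => m _.
by rewrite /= prod_word_of.
Qed.

End Schwartz.

(** * First- and second-order bounds for sine and cosine *)

Section Trigonometry.
Variable K : realType.

Lemma mvt_bound (f f' : K -> K) (a b r M : K) : (forall t, is_derive t (1 : K) f (f' t)) ->
  (forall t, `|t| <= r -> `|f' t| <= M) -> `|a| <= r -> `|b| <= r ->
  `|f b - f a| <= M * `|b - a|.
Proof.
move=> df f'M; wlog ab : a b / a <= b => [H ar br|].
  have [ab|/ltW ba] := leP a b; first exact: H.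
  by rewrite distrC [`|b - a|]distrC; exact: H.
move=> ar br.
have [c] := MVT_segment ab (fun t _ => df t)
  (continuous_subspaceT (fun t => is_derive1_continuous (df t))).
rewrite in_itv/= => /andP[ac cb] ->; rewrite normrM ler_wpM2r//; apply: f'M.
move: ar br; rewrite !ler_norml => /andP[ar1 _] /andP[_ br2].
by apply/andP; split; [exact: le_trans ar1 ac|exact: le_trans cb br2].
Qed.

Lemma cos_lipschitz (a b : K) : `|cos b - cos a| <= `|b - a|.
Proof.
rewrite -[leRHS]mul1r; apply: (@mvt_bound cos (fun t => - sin t) a b (Num.max `|a| `|b|)).
- by move=> t _; rewrite normrN ler_norml sin_geN1 sin_le1.
- by rewrite le_max lexx.
- by rewrite le_max lexx orbT.
Qed.

Lemma sin_lipschitz (a b : K) : `|sin b - sin a| <= `|b - a|.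
Proof.
rewrite -[leRHS]mul1r; apply: (@mvt_bound sin cos a b (Num.max `|a| `|b|)).
- by move=> t _; rewrite ler_norml cos_geN1 cos_le1.
- by rewrite le_max lexx.
- by rewrite le_max lexx orbT.
Qed.

(** Mean value estimate: between 0 and [t] the derivative is at most [|t|] in absolute value. *)
Lemma cos_quadratic (t : K) : `|cos t - 1| <= t ^+ 2.
Proof.
rewrite -[1]cos0 -[t ^+ 2]real_normK ?num_real// expr2.
have -> : `|t| * `|t| = `|t| * `|t - 0| by rewrite subr0.
apply: (@mvt_bound cos (fun t => - sin t) 0 t `|t|) => //.
- by move=> s st; rewrite normrN (le_trans _ st)// -[X in `|X|]subr0 -sin0 (le_trans (sin_lipschitz _ _))// subr0.
- by rewrite normr0.
Qed.

Lemma sin_quadratic (t : K) : `|sin t - t| <= t ^+ 2.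
Proof.
rewrite -[t ^+ 2]real_normK ?num_real// expr2.
have E : sin t - t = (sin t - t) - (sin 0 - 0) by rewrite sin0 !subr0.
rewrite E; have -> : `|t| * `|t| = `|t| * `|t - 0| by rewrite subr0.
apply: (@mvt_bound (fun t => sin t - t) (fun t => cos t - 1) 0 t `|t|) => //.
- by move=> s st; rewrite -cos0 (le_trans (cos_lipschitz _ _))// subr0.
- by rewrite normr0.
Qed.

End Trigonometry.

(** * Regularity and decay of the transform of a Schwartz function; the induction on powers of a
    coordinate *)

Section FourierSchwartz.
Variables (K : realType) (d : nat).
Implicit Types (f g : 'rV[K]_d -> K[i]) (x l m : 'rV[K]_d) (i j : 'I_d).

Lemma ccontinuousD f g : ccontinuous f -> ccontinuous g -> ccontinuous (fun x => f x + g x).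
Proof.
move=> [f1 f2] [g1 g2]; split.
  rewrite (_ : Ref _ = fun x => Ref f x + Ref g x); first by move=> x; exact: (cvgD (f1 x) (g1 x)).
  by apply/funext => x; rewrite /Ref cReD.
rewrite (_ : Imf _ = fun x => Imf f x + Imf g x); first by move=> x; exact: (cvgD (f2 x) (g2 x)).
by apply/funext => x; rewrite /Imf cImD.
Qed.

Lemma ccontinuousM f g : ccontinuous f -> ccontinuous g -> ccontinuous (fun x => f x * g x).
Proof.
move=> [f1 f2] [g1 g2]; split.
  rewrite (_ : Ref _ = fun x => Ref f x * Ref g x - Imf f x * Imf g x).
    by move=> x; exact: (cvgB (cvgM (f1 x) (g1 x)) (cvgM (f2 x) (g2 x))).
  by apply/funext => x; rewrite /Ref cReM.
rewrite (_ : Imf _ = fun x => Ref f x * Imf g x + Imf f x * Ref g x).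
  by move=> x; exact: (cvgD (cvgM (f1 x) (g2 x)) (cvgM (f2 x) (g1 x))).
by apply/funext => x; rewrite /Imf cImM.
Qed.

Lemma ccontinuous_cst (c : K[i]) : ccontinuous (fun _ : 'rV[K]_d => c).
Proof. by split; exact: cst_continuous. Qed.

Lemma ccontinuous_opsym (L : seq (K[i] * seq 'I_d)) : ccontinuous (opsym L).
Proof.
have cp (s : seq 'I_d) : ccontinuous (fun l : 'rV[K]_d => \prod_(j <- s) (0 +i* l 0 j)%C).
  elim: s => [|j s IH].
    rewrite (_ : (fun l => _) = (fun=> 1)); first exact: ccontinuous_cst.
    by apply/funext => l; rewrite big_nil.
  rewrite (_ : (fun l => _) = (fun l : 'rV[K]_d => (0 +i* l 0 j)%C * \prod_(j <- s) (0 +i* l 0 j)%C)).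
    apply: ccontinuousM => //; split; first exact: cst_continuous.
    exact: coord_continuous_rV.
  by apply/funext => l; rewrite big_cons.
rewrite /opsym; elim: L => [|p L IH].
  rewrite (_ : (fun l => _) = (fun=> 0)); first exact: ccontinuous_cst.
  by apply/funext => l; rewrite big_nil.
rewrite (_ : (fun l => _) = (fun l : 'rV[K]_d => p.1 * (\prod_(j <- p.2) (0 +i* l 0 j)%C) +
    \sum_(p <- L) p.1 * \prod_(j <- p.2) (0 +i* l 0 j)%C)).
  by apply: ccontinuousD => //; apply: ccontinuousM; [exact: ccontinuous_cst|exact: cp].
by apply/funext => l; rewrite big_cons.
Qed.

Lemma continuous_cabs f : ccontinuous f -> continuous (fun x => cabs (f x)).
Proof.
move=> [f1 f2]; rewrite (_ : (fun x => _) = fun x => Num.sqrt (Ref f x * Ref f x + Imf f x * Imf f x)).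
  move=> x; apply: (@continuous_comp _ _ _ (fun y => Ref f y * Ref f y + Imf f y * Imf f y) Num.sqrt).
    exact: (cvgD (cvgM (f1 x) (f1 x)) (cvgM (f2 x) (f2 x))).
  exact: sqrt_continuous.
by apply/funext => x; rewrite /cabs /Ref /Imf; case: (f x).
Qed.

Lemma dotvB l m x : dotv (l - m) x = dotv l x - dotv m x.
Proof.
rewrite /dotv -sumrB; apply: eq_bigr => j _; rewrite !mxE; ring.
Qed.

Lemma dotv_le l x : `|dotv l x| <= n1 l * n1 x.
Proof.
rewrite /dotv (le_trans (ler_norm_sum _ _ _))// /n1 mulr_suml; apply: ler_sum => j _.
by rewrite normrM ler_wpM2l// coord_le_n1.
Qed.

(** Two phases differ at [x] by at most [2 n1 (l - m) n1 x], and one additional power of decay of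
    [f] absorbs [n1 x]. *)
Lemma ftsf_lipschitz f : cschwartz f -> exists2 C : K, 0 <= C &
  forall l m, cabs (ftsf f l - ftsf f m) <= C * n1 (l - m).
Proof.
move=> sf; have df := cschwartz_cdecaying sf.
have [C C0 HC] := cschwartz_decay d.+2 sf.
have p0 : 0 <= pi ^+ d :> K by rewrite exprn_ge0// ltW// pi_gt0.
exists (4 * C * pi ^+ d); first by rewrite !mulr_ge0.
move=> l m.
have dl := cdecaying_phase l df; have dm := cdecaying_phase m df.
have E : ftsf f l - ftsf f m = integralRd (fun x => f x * phase l x + (- 1) * (f x * phase m x)).
  by rewrite integralRdD ?integralRdZ//; [rewrite mulN1r|exact: cdecayingZ].
have dd := cdecayingD dl (cdecayingZ (- 1) dm).
rewrite E (_ : 4 * C * pi ^+ d * n1 (l - m) = 2 * (2 * n1 (l - m) * C) * pi ^+ d); last by ring.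
apply: cabs_integralRd_le.
- by case: dd => -[? _] [? _].
- by rewrite !mulr_ge0// n1_ge0.
move=> x; rewrite mulN1r -mulrBr cabsM.
have HP : cabs (phase l x - phase m x) <= 2 * n1 (l - m) * n1 x.
  apply: (le_trans (cabs_le _)).
  have -> : complex.Re (phase l x - phase m x) = cos (dotv l x) - cos (dotv m x) by [].
  have -> : complex.Im (phase l x - phase m x) = - (sin (dotv l x) - sin (dotv m x)).
    by rewrite /= opprB opprK addrC.
  rewrite normrN -mulrA mulr_natl mulr2n; apply: lerD.
    by rewrite (le_trans (cos_lipschitz _ _))// -dotvB dotv_le.
  by rewrite (le_trans (sin_lipschitz _ _))// -dotvB dotv_le.
apply: (le_trans (ler_pM (cabs_ge0 _) (cabs_ge0 _) (HC x) HP)).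
have n0 := add_n1_gt0 x ltr01.
rewrite (_ : C * (1 + n1 x) ^- d.+2 * (2 * n1 (l - m) * n1 x) =
   2 * n1 (l - m) * C * ((1 + n1 x) ^- d.+2 * n1 x)); last by ring.
rewrite ler_wpM2l//; first by rewrite !mulr_ge0// n1_ge0.
rewrite exprSr invfM -mulrA ler_piMr ?invr_ge0 ?exprn_ge0 ?(ltW n0)//.
by rewrite mulrC ler_pdivrMr// mul1r lerDr.
Qed.

Lemma lipschitz_continuous (u : 'rV[K]_d -> K) C : 0 <= C ->
  (forall l m, `|u l - u m| <= C * n1 (l - m)) -> continuous u.
Proof.
move=> C0 H l A /nbhs_ballP[e /= e0 He].
have D : 0 < C * d%:R + 1 by rewrite ltr_wpDl// mulr_ge0.
apply/nbhs_ballP; exists (e / (C * d%:R + 1)); first by rewrite /= divr_gt0.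
move=> m; rewrite -ball_normE/= ltr_pdivlMr// => lm; apply: He; rewrite -ball_normE/=.
apply: (le_lt_trans (H l m)); apply: le_lt_trans lm.
apply: (@le_trans _ _ (C * (d%:R * `|l - m|))); first by rewrite ler_wpM2l// n1_le_norm.
by rewrite mulrA mulrDr mulr1 mulrC lerDl.
Qed.

Lemma ccontinuous_ftsf f : cschwartz f -> ccontinuous (ftsf f).
Proof.
move=> sf; have [C C0 HC] := ftsf_lipschitz sf.
split; apply: (lipschitz_continuous C0) => l m; apply: le_trans (HC l m).
  have -> : Ref (ftsf f) l - Ref (ftsf f) m = complex.Re (ftsf f l - ftsf f m).
    by rewrite /Ref; case: (ftsf f l) (ftsf f m) => a b [].
  exact: Re_le_cabs.
have -> : Imf (ftsf f) l - Imf (ftsf f) m = complex.Im (ftsf f l - ftsf f m).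
  by rewrite /Imf; case: (ftsf f l) (ftsf f m) => a b [].
exact: Im_le_cabs.
Qed.

Lemma phaseD l m x : phase (l + m) x = phase l x * (cos (dotv m x) -i* sin (dotv m x))%C.
Proof.
have -> : phase (l + m) x = (cos (dotv l x + dotv m x) -i* sin (dotv l x + dotv m x))%C.
  have -> // : dotv l x + dotv m x = dotv (l + m) x.
  by rewrite /dotv -big_split; apply: eq_bigr => j _; rewrite /= !mxE mulrDl.
by rewrite cosD sinD; apply: complex_ext; rewrite ?cReM ?cImM/=; ring.
Qed.

Lemma dotv_basis (h : K) j x : dotv (h *: basisv K j) x = h * x 0 j.
Proof.
rewrite /dotv (bigD1 j)//= big1 => [|k kj]; first by rewrite !mxE !eqxx mulr1 addr0.
by rewrite !mxE/= (negbTE kj) mulr0 mul0r.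
Qed.

(** Says that [- i F(x_j f)] is the derivative of [F f] in direction [j], with explicit remainder.
    With [t = h x_j] the remainder integrand contains [exp (- i t) - 1 + i t], which is at most
    [2 t^2], and [x_j^2 f] is again integrable. *)
Lemma ftsf_taylor f j : cschwartz f -> exists2 C : K, 0 <= C &
  forall l (h : K), cabs (ftsf f (l + h *: basisv K j) - ftsf f l + (0 +i* h)%C * ftsf (mulx j f) l)
    <= C * h ^+ 2.
Proof.
move=> sf; have df := cschwartz_cdecaying sf.
have sx := cschwartz_mulx j sf; have dx := cschwartz_cdecaying sx.
have sxx := cschwartz_mulx j sx.
have [C C0 HC] := cschwartz_decay d.+1 sxx.
have p0 : 0 <= pi ^+ d :> K by rewrite exprn_ge0// ltW// pi_gt0.
exists (4 * C * pi ^+ d); first by rewrite !mulr_ge0.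
move=> l h; set l' := l + _.
have dl := cdecaying_phase l df; have dl' := cdecaying_phase l' df.
have dxl := cdecaying_phase l dx.
have E : ftsf f l' - ftsf f l + (0 +i* h)%C * ftsf (mulx j f) l = integralRd (fun x =>
   f x * phase l' x + (- 1) * (f x * phase l x) + (0 +i* h)%C * (mulx j f x * phase l x)).
  rewrite integralRdD; [|by apply: cdecayingD => //; exact: cdecayingZ|exact: cdecayingZ].
  by rewrite integralRdD ?integralRdZ//; [rewrite mulN1r|exact: cdecayingZ].
have dd := cdecayingD (cdecayingD dl' (cdecayingZ (- 1) dl)) (cdecayingZ (0 +i* h)%C dxl).
rewrite E (_ : 4 * C * pi ^+ d * h ^+ 2 = 2 * (2 * h ^+ 2 * C) * pi ^+ d); last by ring.
apply: cabs_integralRd_le.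
- by case: dd => -[? _] [? _].
- by rewrite mulr_ge0// mulr_ge0// sqr_ge0.
move=> x; rewrite /l' phaseD dotv_basis /mulx; set t := h * x 0 j.
have -> : f x * (phase l x * (cos t -i* sin t)%C) + -1 * (f x * phase l x) +
    (0 +i* h)%C * ((x 0 j)%:C%C * f x * phase l x) =
    f x * phase l x * ((cos t - 1) -i* (sin t - t))%C.
  have -> : ((cos t - 1) -i* (sin t - t))%C = (cos t -i* sin t)%C - 1 + (0 +i* h)%C * (x 0 j)%:C%C :> K[i].
    by apply: complex_ext; rewrite !(cReD, cReM, cImD, cImM)/= /t; ring.
  ring.
rewrite cabsM cabsM cabs_phase mulr1.
have H2 : cabs ((cos t - 1) -i* (sin t - t))%C <= 2 * t ^+ 2.
  apply: (le_trans (cabs_le _)); rewrite /= normrN mulr_natl mulr2n.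
  by apply: lerD; [exact: cos_quadratic|exact: sin_quadratic].
apply: (le_trans (ler_wpM2l (cabs_ge0 _) H2)).
have -> : cabs (f x) * (2 * t ^+ 2) = 2 * h ^+ 2 * cabs (mulx j (mulx j f) x).
  have xx : `|x 0 j| * `|x 0 j| = x 0 j ^+ 2 by rewrite -expr2 real_normK ?num_real.
  rewrite /mulx !cabsM !cabs_real; transitivity (2 * h ^+ 2 * (`|x 0 j| * `|x 0 j|) * cabs (f x)).
    by rewrite xx /t; ring.
  by ring.
by rewrite -[leRHS]mulrA ler_wpM2l// mulr_ge0// sqr_ge0.
Qed.

(** For small [h] both values of the transform in [ftsf_taylor] vanish, leaving
    [h |F(x_j f)(l)| <= C h^2]. *)
Lemma ftsf_mulx_eq0 f j l : cschwartz f -> (\forall m \near l, ftsf f m = 0) ->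
  ftsf (mulx j f) l = 0.
Proof.
move=> sf /nbhs_ballP[e /= e0 He]; have [C C0 HC] := ftsf_taylor j sf.
apply/eqP; rewrite -cabs_eq0 -normr_le0 (ger0_norm (cabs_ge0 _)).
apply/ler_addgt0Pr => r r0; rewrite add0r.
(* The first bound keeps the shifted point in the ball where the transform vanishes, the second
   gives [C h <= r]. *)
pose h := Num.min (e / 2) (r / (C + 1)).
have C1 : 0 < C + 1 by rewrite ltr_wpDl.
have h0 : 0 < h by rewrite lt_min !divr_gt0.
have he : h < e by rewrite (@le_lt_trans _ _ (e / 2))// ?ge_min ?lexx// ltr_pdivrMr// ltr_pMr// ltr1n.
have := HC l h; rewrite (He l) ?subr0; last exact: ballxx.
rewrite (He (l + h *: basisv K j)) ?add0r; last first.
  rewrite -ball_normE/= opprD addNKr normrN; apply/rV_normE => // k.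
  rewrite !mxE/= normrM (gtr0_norm h0); case: (k == j); rewrite ?normr1 ?mulr1//.
  by rewrite normr0 mulr0.
rewrite cabsM (_ : cabs (0 +i* h)%C = h); last first.
  by rewrite /cabs/= expr0n add0r sqrtr_sqr gtr0_norm.
rewrite expr2 mulrA [leLHS]mulrC ler_pM2r// => /le_trans; apply.
apply: (@le_trans _ _ (C * (r / (C + 1)))); first by rewrite ler_wpM2l// ge_min lexx orbT.
by rewrite mulrA ler_pdivrMr// mulrC ler_wpM2l ?(ltW r0)// lerDl.
Qed.

(** Applying [1 - d_j^2] in every coordinate multiplies the transform by the product of the
    [1 + l_j^2], and the result is still a bounded transform of a Schwartz function. *)
Lemma ftsf_decay f : cschwartz f -> exists2 B : K, 0 <= B &
  forall l, cabs (ftsf f l) <= B * \prod_(j < d) (1 + l 0 j ^+ 2)^-1.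
Proof.
move=> sf; pose A j g : 'rV[K]_d -> K[i] := fun x => g x + (- 1) * partials [:: j; j] g x.
have [g sg gE] : exists2 g, cschwartz g & forall l,
    ftsf g l = (\prod_(j <- enum 'I_d) (1 + l 0 j ^+ 2))%:C%C * ftsf f l.
  elim: (enum _) => [|j s [g sg IH]]; first by exists f => // l; rewrite big_nil mul1r.
  have sp := cschwartz_partials [:: j; j] sg.
  exists (A j g); first by apply: cschwartzD => //; exact: cschwartzZ.
  move=> l; rewrite /A ftsfD ?ftsfZ; first last.
  - exact/cschwartz_cdecaying/cschwartzZ.
  - exact: cschwartz_cdecaying.
  - exact: cschwartz_cdecaying.
  rewrite ftsf_partials// IH big_cons !big_cons big_nil mulr1.
  set a := ftsf f l; set p := \prod_(k <- s) _; rewrite rmorphM/= !mulrA -mulrDl; congr (_ * _).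
  rewrite -[X in X + _]mul1r -mulrDl; congr (_ * _).
  by apply: complex_ext; rewrite /=; ring.
have [C C0 HC] := cdecaying_bound (cschwartz_cdecaying sg).
exists (2 * C * pi ^+ d); first by rewrite !mulr_ge0// exprn_ge0// ltW// pi_gt0.
move=> l; have := cabs_ftsf_le l (cschwartz_cdecaying sg) C0 HC.
have p0 : 0 < \prod_(j < d) (1 + l 0 j ^+ 2).
  by rewrite prodr_gt0// => j _; rewrite ltr_pwDl// sqr_ge0.
rewrite gE big_enum cabsM cabs_real gtr0_norm// => H.
by rewrite prodfV ler_pdivlMr// mulrC.
Qed.

(** The function is quantified after [N] because the induction hypothesis is used for [x_j f] and
    for the commutator applied to [f]. The power of [n.+1], and not of [n], makes the bound
    meaningful at [n = 0], which the step reaches through [n.-1]. *)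
Lemma mulx_iter_bound (L : seq (K[i] * seq 'I_d)) (R : K) j N : 0 < R ->
  forall f, cschwartz f -> (forall l, ftsf f l != 0 -> cabs (opsym L l) <= R) ->
  exists2 C : K, 0 <= C & forall n x,
    `|x 0 j| ^+ N * cabs (iter n (opd L) f x) <= C * n.+1%:R ^+ N * R ^+ n.
Proof.
move=> R0; elim: N => [|N IH] f sf fR.
  have [B B0 HB] := ftsf_decay sf.
  exists (4 ^+ d * B); first by rewrite mulr_ge0// exprn_ge0.
  move=> n x; rewrite !expr0 mulr1 mul1r -mulrA [B * _]mulrC.
  apply: Rd_inversion.
  - exact/cschwartz_cdecaying/cschwartz_iter_opd.
  - by rewrite mulr_ge0// exprn_ge0// ltW.
  - move=> l; rewrite ftsf_iter_opd// cabsM cabsX -mulrA.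
    have [->|/fR lR] := eqVneq (ftsf f l) 0.
      rewrite cabs0 mulr0 !mulr_ge0 ?exprn_ge0 ?(ltW R0)// prodr_ge0// => k _.
      by rewrite invr_ge0 addr_ge0// sqr_ge0.
    apply: ler_pM; rewrite ?exprn_ge0 ?cabs_ge0//.
    by rewrite lerXn2r// nnegrE ?cabs_ge0// ltW.
have sx := cschwartz_mulx j sf; have sq := cschwartz_opd (dop j L) sf.
have [C1 C10 H1] : exists2 C : K, 0 <= C & forall n x,
    `|x 0 j| ^+ N * cabs (iter n (opd L) (mulx j f) x) <= C * n.+1%:R ^+ N * R ^+ n.
  (* By contraposition: where the symbol exceeds [R] it does so on a neighbourhood, on which the
     transform of [f] is then zero. *)
  apply: IH => // l; apply: contraNT; rewrite -ltNge => lR; apply/eqP; apply: ftsf_mulx_eq0 => //.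
  have cc : continuous (fun m => cabs (opsym L m)) := continuous_cabs (ccontinuous_opsym L).
  have /(_ (nbhs_filter l)) := cvgr_gt (cabs (opsym L l)) (cc l) R lR.
  by apply: filterS => m; apply: contraTeq; rewrite -leNgt; exact: fR.
have [C2 C20 H2] : exists2 C : K, 0 <= C & forall n x,
    `|x 0 j| ^+ N * cabs (iter n (opd L) (opd (dop j L) f) x) <= C * n.+1%:R ^+ N * R ^+ n.
  apply: IH => // l; rewrite ftsf_opd// mulf_eq0 negb_or => /andP[_]; exact: fR.
(* The commutator term has only [n.-1] iterations, hence one factor [R] too few. *)
exists (C1 + C2 / R); first by rewrite addr_ge0// divr_ge0// ltW.
move=> n x.
have E : (x 0 j)%:C%C * iter n (opd L) f x = iter n (opd L) (mulx j f) x +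
    - (n%:R * iter n.-1 (opd L) (opd (dop j L) f) x).
  by rewrite iter_opd_mulx// addrK.
have -> : `|x 0 j| ^+ N.+1 * cabs (iter n (opd L) f x) =
    `|x 0 j| ^+ N * cabs ((x 0 j)%:C%C * iter n (opd L) f x).
  by rewrite cabsM cabs_real exprSr mulrA.
rewrite E (le_trans (ler_wpM2l _ (cabsD _ _)))// ?exprn_ge0// mulrDr !mulrDl; apply: lerD.
  apply: (le_trans (H1 n x)); rewrite ler_wpM2r ?exprn_ge0 ?(ltW R0)// ler_wpM2l//.
  by rewrite ler_weXn2l// ler1n.
rewrite cabsN cabsM; case: n {E} => [|n].
  by rewrite cabs0 mul0r mulr0 expr1n expr0 !mulr1 divr_ge0// ltW.
have -> : cabs (n.+1%:R : K[i]) = n.+1%:R.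
  have -> : (n.+1%:R : K[i]) = (n.+1%:R)%:C%C by rewrite rmorph_nat.
  by rewrite cabs_real ger0_norm.
rewrite mulrCA (le_trans (ler_wpM2l _ (H2 n x)))//.
have -> : C2 / R * n.+2%:R ^+ N.+1 * R ^+ n.+1 = n.+2%:R ^+ N.+1 * (C2 * R ^+ n).
  rewrite [R ^+ n.+1]exprS; move: (n.+2%:R ^+ N.+1) (R ^+ n) => a b; field.
  by rewrite gt_eqF.
have -> : n.+1%:R * (C2 * n.+1%:R ^+ N * R ^+ n) = n.+1%:R ^+ N.+1 * (C2 * R ^+ n).
  by rewrite [n.+1%:R ^+ N.+1]exprS; move: (R ^+ n) => b; move: (n.+1%:R ^+ N) => a; ring.
rewrite ler_wpM2r ?mulr_ge0 ?exprn_ge0 ?(ltW R0)// lerXn2r ?nnegrE//.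
by rewrite ler_nat.
Qed.

End FourierSchwartz.

(** * Test functions *)

Section BumpFunctions.
Variables (K : realType).

(* All derivatives of [t |-> expR (- t^-1)] on [t > 0] are combinations of these. *)
Definition flat k (t : K) : K := if 0 < t then t^-1 ^+ k * expR (- t^-1) else 0.

Lemma flat_gt0 k t : 0 < t -> 0 < flat k t.
Proof. by move=> t0; rewrite /flat t0 mulr_gt0 ?expR_gt0// exprn_gt0// invr_gt0. Qed.

Lemma flat_le0 k t : t <= 0 -> flat k t = 0.
Proof. by move=> t0; rewrite /flat ltNge t0. Qed.

Lemma flat0_le1 t : `|flat 0 t| <= 1.
Proof.
rewrite /flat; case: ifP => t0; last by rewrite normr0.
by rewrite expr0 mul1r ger0_norm ?expR_ge0// -expR0 ler_expR oppr_le0 invr_ge0 ltW.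
Qed.

(** From [s^(k+2) <= (k+2)! expR s] at [s = t^-1]. Quadratic vanishing makes the difference quotient
    at 0 tend to 0. *)
Lemma flat_bound k t : 0 < t -> flat k t <= k.+2`!%:R * t ^+ 2.
Proof.
move=> t0; rewrite /flat t0 expRN.
have s0 : 0 <= t^-1 by rewrite invr_ge0 ltW.
have f0 : 0 < k.+2`!%:R :> K by rewrite ltr0n fact_gt0.
have H : t^-1 ^+ k.+2 <= k.+2`!%:R * expR t^-1.
  rewrite mulrC -ler_pdivrMr//; apply: le_trans (expR_ge1Dxn k.+1 s0).
  by rewrite lerDr.
rewrite ler_pdivrMr ?expR_gt0// mulrAC -ler_pdivrMr ?exprn_gt0//.
by apply: le_trans H; rewrite -exprVn -exprD addn2.
Qed.

Lemma is_derive_flat0 k : is_derive (0 : K) (1 : K) (flat k) 0.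
Proof.
have H : (fun h : K => h^-1 *: ((flat k \o shift 0) (h *: 1) - flat k 0)) h @[h --> 0^'] --> (0 : K).
  have f0 : 0 < k.+2`!%:R :> K by rewrite ltr0n fact_gt0.
  apply/cvgrPdist_le => e e0; near=> h.
  rewrite sub0r normrN /= addr0 /GRing.scale /= mulr1 (flat_le0 _ (lexx 0)) subr0.
  have [h0|h0] := leP h 0; first by rewrite flat_le0// mulr0 normr0 ltW.
  have he : `|h| <= e / k.+2`!%:R.
    by near: h; apply: dnbhs0_le; rewrite divr_gt0.
  rewrite normrM normfV (gtr0_norm h0) (gtr0_norm (flat_gt0 k h0)) mulrC ler_pdivrMr//.
  apply: (le_trans (flat_bound k h0)); rewrite expr2 mulrA ler_pM2r//.
  by rewrite mulrC -ler_pdivlMr// -(gtr0_norm h0).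
by apply: DeriveDef; [exact: (cvgP _ H)|exact: cvg_lim].
Unshelve. all: by end_near. Qed.

Lemma is_derive_flat k t : is_derive t (1 : K) (flat k) (flat k.+2 t - k%:R * flat k.+1 t).
Proof.
have [t0|t0|->] := ltgtP t 0; last first.
- rewrite !flat_le0// mulr0 subr0; exact: is_derive_flat0.
- have D1 : is_derive t (1 : K) (fun s => s^-1) (- t^-1 ^+ 2).
    apply: is_derive_eq; first by apply: is_deriveV; rewrite gt_eqF.
    by rewrite /GRing.scale/= mulr1 exprVn.
  have D2 := isd_comp (isdN D1) (is_derive_expR (- t^-1)).
  have DX : is_derive t (1 : K) (fun s => s^-1 ^+ k) (k%:R * t^-1 ^+ k.-1 * - t^-1 ^+ 2).
    rewrite (_ : (fun s => _) = (fun s => s^-1) ^+ k); first exact: is_deriveX.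
    by rewrite exprfctE.
  have D3 := isdM DX D2.
  have E : \near t, (fun s => s^-1 ^+ k * expR (- s^-1)) t = flat k t.
    near=> s; rewrite /flat ifT//; near: s; exact: lt_nbhsr.
  apply: (near_eq_is_derive E); apply: is_derive_eq.
  rewrite /flat t0; case: k {D3 DX E} => [|k].
    by rewrite !mul0r !mulr0 addr0 subr0 expr0; ring.
  by rewrite !exprS/=; ring.
- rewrite !flat_le0 ?(ltW t0)// mulr0 subr0.
  have E : \near t, (fun _ => 0) t = flat k t.
    near=> s; rewrite flat_le0// ltW//; near: s; exact: lt_nbhsl.
  exact: (near_eq_is_derive E).
Unshelve. all: by end_near. Qed.
End BumpFunctions.

(** * Modulated bumps as test functions, and points of the support *)

Section TestFunctions.
Variables (K : realType) (d : nat).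
Implicit Types (u v : 'rV[K]_d -> K) (x l m : 'rV[K]_d) (j : 'I_d).

(* Stable under partial derivatives, hence made of smooth functions. *)
Inductive bump_alg : ('rV[K]_d -> K) -> Prop :=
| bump_cst c : bump_alg (fun=> c)
| bump_flat k (a s : K) i : bump_alg (fun x => flat k (a + s * x 0 i))
| bump_cos m : bump_alg (fun x => cos (dotv m x))
| bump_sin m : bump_alg (fun x => sin (dotv m x))
| bump_add u v : bump_alg u -> bump_alg v -> bump_alg (fun x => u x + v x)
| bump_mul u v : bump_alg u -> bump_alg v -> bump_alg (fun x => u x * v x).

Lemma isd_dotv m j x : is_derive x (basisv K j) (dotv m) (m 0 j).
Proof.
have H := isd_sum (enum 'I_d) (fun i => isdZ (m 0 i) (isd_coord i j x)).
apply: isd_ext H => [y|]; first by rewrite big_enum.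
rewrite big_enum (bigD1 j)//= big1 ?addr0 ?eqxx ?mulr1// => i ij.
by rewrite (negbTE ij) mulr0.
Qed.

Lemma bump_alg_derive u : bump_alg u -> continuous u /\
  forall j, exists2 v, bump_alg v & forall x, is_derive x (basisv K j) u (v x).
Proof.
elim=> [c|k a s i|m|m|{}u v _ [cu du] _ [cv dv]|{}u v bu [cu du] bv [cv dv]].
- split; first exact: cst_continuous.
  by move=> j; exists (fun=> 0) => [|x]; [exact: bump_cst|exact: isdC].
- split.
    move=> x; apply: (@continuous_comp _ _ _ (fun x : 'rV[K]_d => a + s * x 0 i) (flat k)).
      exact: (cvgD (cvg_cst a) (cvgM (cvg_cst s) (@coord_continuous_rV K d i x))).
    exact: is_derive1_continuous (is_derive_flat k _).
  move=> j; exists (fun x => s * (i == j)%:R *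
     (flat k.+2 (a + s * x 0 i) + - k%:R * flat k.+1 (a + s * x 0 i))) => [|x].
    apply: bump_mul; first exact: bump_cst.
    by apply: bump_add; [|apply: bump_mul; [exact: bump_cst|]]; exact: bump_flat.
  have D := isdD (isdC a x (basisv K j)) (isdZ s (isd_coord i j x)).
  apply: (isd_ext _ _ (isd_comp D (is_derive_flat k _))) => //=.
  by rewrite add0r mulrC mulNr.
- split; first by move=> x; exact: (continuous_comp (@continuous_dotv K d m x) (@continuous_cos K _)).
  move=> j; exists (fun x => - m 0 j * sin (dotv m x)) => [|x].
    by apply: bump_mul; [exact: bump_cst|exact: bump_sin].
  apply: (isd_ext _ _ (isd_comp (isd_dotv m j x) (is_derive_cos _))) => //.
  by rewrite mulrC mulrN mulNr.
- split; first by move=> x; exact: (continuous_comp (@continuous_dotv K d m x) (@continuous_sin K _)).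
  move=> j; exists (fun x => m 0 j * cos (dotv m x)) => [|x].
    by apply: bump_mul; [exact: bump_cst|exact: bump_cos].
  by apply: (isd_ext _ _ (isd_comp (isd_dotv m j x) (is_derive_sin _))) => //; rewrite mulrC.
- split; first by move=> x; exact: (cvgD (cu x) (cv x)).
  move=> j; have [u' bu' du'] := du j; have [v' bv' dv'] := dv j.
  by exists (fun x => u' x + v' x) => [|x]; [exact: bump_add|exact: isdD].
- split; first by move=> x; exact: (cvgM (cu x) (cv x)).
  move=> j; have [u' bu' du'] := du j; have [v' bv' dv'] := dv j.
  exists (fun x => u x * v' x + v x * u' x) => [|x]; last exact: isdM.
  by apply: bump_add; exact: bump_mul.
Qed.

Lemma bump_alg_rpartials s u : bump_alg u -> bump_alg (rpartials s u).
Proof.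
move=> bu; elim: s => //= j s /bump_alg_derive[_ /(_ j)[v bv dv]].
by rewrite (_ : rpartial j _ = v)//; apply/funext => x; exact: derive_val.
Qed.

Lemma bump_alg_smooth (f : 'rV[K]_d -> K[i]) : bump_alg (Ref f) -> bump_alg (Imf f) -> smooth f.
Proof.
have H u s : bump_alg u -> continuous (rpartials s u) /\ forall j x, derivable (rpartials s u) x (basisv K j).
  move=> /(bump_alg_rpartials s)/bump_alg_derive[c D]; split => // j x.
  by have [v _ /(_ x)[]] := D j.
by move=> /H br /H bi s; rewrite /ccontinuous !Ref_partials !Imf_partials;
  have [? ?] := br s; have [? ?] := bi s.
Qed.

(** Positive exactly on the open cube of half-side [e] around [l], for [e > 0]. The coefficients [1]
    and [-1] are written out to fit the shape of [bump_flat]. *)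
Definition bump (l : 'rV[K]_d) (e : K) x : K :=
  \prod_(j < d) (flat 0 (e - l 0 j + 1 * x 0 j) * flat 0 (e + l 0 j + -1 * x 0 j)).

Lemma bump_alg_prod I (r : seq I) (u : I -> 'rV[K]_d -> K) : (forall i, bump_alg (u i)) ->
  bump_alg (fun x => \prod_(i <- r) u i x).
Proof.
move=> bu; elim: r => [|i r IH].
  rewrite (_ : (fun x => _) = fun=> 1); first exact: bump_cst.
  by apply/funext => x; rewrite big_nil.
rewrite (_ : (fun x => _) = fun x => u i x * \prod_(i <- r) u i x); first exact: bump_mul.
by apply/funext => x; rewrite big_cons.
Qed.

Lemma bump_alg_bump l e : bump_alg (bump l e).
Proof.
by apply: bump_alg_prod => j; apply: bump_mul; exact: bump_flat.
Qed.

Lemma bump_center l e : 0 < e -> bump l e l != 0.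
Proof.
move=> e0; apply/prodf_neq0 => j _.
by rewrite mul1r mulN1r subrK addrK mulf_neq0// gt_eqF// flat_gt0.
Qed.

Lemma bump_neq0 l e x : bump l e x != 0 -> forall j, `|l 0 j - x 0 j| < e.
Proof.
move=> /prodf_neq0 H j; have := H j isT; rewrite mulf_eq0 negb_or mul1r mulN1r => /andP[H1 H2].
have flatP (t : K) : flat 0 t != 0 -> 0 < t by apply: contraNT; rewrite -leNgt => /flat_le0 ->.
by move: (flatP _ H1) (flatP _ H2) => h1 h2; rewrite ltr_norml; apply/andP; split; lra.
Qed.

Lemma bump_le1 l e x : `|bump l e x| <= 1.
Proof.
rewrite normr_prod; apply: prodr_ile1 => j _.
by rewrite normr_ge0 normrM mulr_ile1 ?flat0_le1.
Qed.

Lemma fsupp_bump l e (c : 'rV[K]_d -> K[i]) : 0 < e ->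
  fsupp (fun x => (bump l e x)%:C%C * c x) `<=` closed_ball l e.
Proof.
move=> e0; apply: (@subset_trans _ (closure (closed_ball l e))); last first.
  by rewrite -(closure_id _).1//; exact: closed_ball_closed.
apply: closureS => x /=; rewrite mulf_eq0 negb_or => /andP[bx _].
rewrite closed_ballE// /closed_ball_/=.
have {}bx : bump l e x != 0 by apply: contraNneq bx => ->.
by apply/ltW/rV_normE => // j; rewrite !mxE; exact: bump_neq0.
Qed.

Lemma compact_fsupp_bump l e (c : 'rV[K]_d -> K[i]) : 0 < e ->
  compact (fsupp (fun x => (bump l e x)%:C%C * c x)).
Proof.
move=> e0; apply: bounded_closed_compact; last exact: closed_closure.
exists (`|l| + e); split; first exact: num_real.
move=> M lM x /(fsupp_bump e0); rewrite closed_ballE// /closed_ball_/= => lx.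
apply: le_trans (ltW lM); rewrite -lerBlDl distrC in lx *.
exact: le_trans (lerB_dist _ _) lx.
Qed.

Lemma test_function_bump l e m : 0 < e ->
  test_function (fun x => (bump l e x)%:C%C * phase m x).
Proof.
move=> e0; split; last exact: compact_fsupp_bump.
have bb := bump_alg_bump l e; apply: bump_alg_smooth.
  rewrite (_ : Ref _ = fun x => bump l e x * cos (dotv m x)); first exact: (bump_mul bb (bump_cos m)).
  by apply/funext => x; rewrite /Ref cReM/= mul0r subr0.
rewrite (_ : Imf _ = fun x => bump l e x * (-1 * sin (dotv m x))).
  exact: (bump_mul bb (bump_mul (bump_cst (-1)) (bump_sin m))).
by apply/funext => x; rewrite /Imf cImM/= mul0r addr0 mulN1r.
Qed.

Lemma cdecaying_mul_bump (g : 'rV[K]_d -> K[i]) l e M : 0 < e -> ccontinuous g -> 0 <= M ->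
  (forall x, cabs (g x) <= M) -> cdecaying (fun x => g x * (bump l e x)%:C%C).
Proof.
(* An upper bound of [1 + n1 x] on the set where the bump is nonzero. *)
move=> e0 cg M0 gM; set A := 1 + n1 l + d%:R * e.
have A0 : 0 < A by rewrite /A ltr_wpDr ?mulr_ge0 ?(ltW e0)// add_n1_gt0.
apply: (@cdecaying_of_bound _ _ _ (M * A ^+ d.+1)).
- apply: ccontinuousM => //; split; last exact: cst_continuous.
  exact: (bump_alg_derive (bump_alg_bump l e)).1.
- by rewrite mulr_ge0// exprn_ge0// ltW.
move=> x; rewrite cabsM cabs_real.
have x0 := add_n1_gt0 x ltr01.
have [->|b0] := eqVneq (bump l e x) 0.
  by rewrite normr0 mulr0 divr_ge0 ?exprn_ge0 ?(ltW x0)// mulr_ge0// exprn_ge0// ltW.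
rewrite -mulrA; apply: (le_trans (ler_pM (cabs_ge0 _) (normr_ge0 _) (gM x) (bump_le1 l e x))).
rewrite ler_wpM2l// ler_pdivlMr ?exprn_gt0// mul1r lerXn2r ?nnegrE ?(ltW x0) ?(ltW A0)//.
rewrite /A -addrA lerD2l /n1.
have -> : d%:R * e = \sum_(j < d) e by rewrite sumr_const card_ord mulr_natl.
rewrite -big_split; apply: ler_sum => j _ /=.
rewrite -lerBlDl (le_trans (lerB_dist _ _))// distrC; exact/ltW/bump_neq0.
Qed.

(* If [fourier f] annihilated every [bump l e * phase m], the Fourier transform of
   [fourier f * bump l e] would vanish, hence so would this product. *)
Lemma dsupp_fourier (f : 'rV[K]_d -> K[i]) l : cschwartz f -> ftsf f l != 0 ->
  dsupp (regular_dist (fourier f)) l.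
Proof.
move=> sf fl U oU Ul; have /nbhs_ballP[r /= r0 rU] : nbhs l U by exact: open_nbhs_nbhs.
(* Halving the radius puts the closed ball, which contains the support of the bump, inside the open
   ball of radius [r]. *)
set e := r / 2; have e0 : 0 < e by rewrite divr_gt0.
apply: contrapT => nT; move: fl; apply/negP; rewrite negbK.
have df := cschwartz_cdecaying sf.
have [C C0 HC] := cdecaying_bound df.
have dg : cdecaying (fun x => ftsf f x * (bump l e x)%:C%C).
  apply: (cdecaying_mul_bump l e0 (ccontinuous_ftsf sf)); last by move=> x; exact: (cabs_ftsf_le x df C0 HC).
  by rewrite !mulr_ge0// exprn_ge0// ltW// pi_gt0.
pose g x := fourier f x * (bump l e x)%:C%C.
have {}dg : cdecaying g.
  have := cdecayingZ ((2 * pi) `^ (- (d%:R / 2)))%:C%C dg.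
  by congr cdecaying; apply/funext => x; rewrite /g fourierE mulrA.
have g0 m : ftsf g m = 0.
  apply/eqP; apply: contra_notT nT => gm.
  exists (fun x => (bump l e x)%:C%C * phase m x); split.
  - exact: test_function_bump.
  - move=> x /(fsupp_bump e0); rewrite closed_ballE// /closed_ball_/= => lx; apply: rU; rewrite -ball_normE/= (le_lt_trans lx)//.
    by rewrite ltr_pdivrMr// ltr_pMr// ltr1n.
  - move: gm; rewrite /ftsf /regular_dist /g.
    by under [X in integralRd X]eq_fun do rewrite -mulrA.
have := @Rd_inversion K d g 0 dg (lexx 0) _ l; rewrite mulr0 => /(_ _)/wrap[].
  by move=> m; rewrite g0 cabs0 mul0r.
move=> gl; have : g l == 0 by rewrite -cabs_eq0 -normr_le0 ger0_norm ?cabs_ge0.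
rewrite /g mulf_eq0 => /orP[|].
  by move/eqP => E; have := fourier_neq0 f l; rewrite E eqxx/= => /esym/negbFE.
by move=> /eqP[b0]; have := bump_center l e0; rewrite b0 eqxx.
Qed.

End TestFunctions.

(** * The equivalence *)

Section EuclideanNorm.
Variables (K : realType) (d : nat).
Implicit Types x : 'rV[K]_d.

Lemma enorm_ge0 x : 0 <= enorm x.
Proof. exact: sqrtr_ge0. Qed.

Lemma coord_le_enorm x j : `|x 0 j| <= enorm x.
Proof.
rewrite -sqrtr_sqr /enorm ler_wsqrtr// /dotv (bigD1 j)//= expr2 lerDl.
by apply: sumr_ge0 => i _; rewrite -expr2 sqr_ge0.
Qed.

Lemma n1_le_enorm x : n1 x <= d%:R * enorm x.
Proof.
have -> : d%:R * enorm x = \sum_(j < d) enorm x by rewrite sumr_const card_ord mulr_natl.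
by apply: ler_sum => j _; exact: coord_le_enorm.
Qed.

Lemma enorm_le_n1 x : enorm x <= n1 x.
Proof.
rewrite -[leRHS]ger0_norm ?n1_ge0// -sqrtr_sqr /enorm ler_wsqrtr// /dotv expr2 {1}/n1 mulr_suml.
apply: ler_sum => j _; apply: (le_trans (ler_norm _)); rewrite normrM.
by rewrite ler_wpM2l// coord_le_n1.
Qed.

Lemma add_enorm_gt0 x : 0 < 1 + enorm x.
Proof. by rewrite ltr_wpDr// enorm_ge0. Qed.

Lemma add_n1_le_enorm x : 1 + n1 x <= d.+1%:R * (1 + enorm x).
Proof.
rewrite mulrDr mulr1 -natr1 mulrDl mul1r [d%:R + 1]addrC.
apply: lerD; first by rewrite lerDl.
by rewrite (le_trans (n1_le_enorm x))// lerDl enorm_ge0.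
Qed.

End EuclideanNorm.

(** * The lower limit and the growth of geometric sequences *)

Section LimInf.
Variable K : realType.
Implicit Types (u : nat -> \bar K).

Lemma limn_einf_gt u (r : \bar K) : (r < limn_einf u)%E ->
  exists N, forall n, (N <= n)%N -> (r < u n)%E.
Proof.
have -> : limn_einf u = ereal_sup (range (einfs u)).
  by rewrite limn_einf_lim; apply: cvg_lim => //; exact: cvg_einfs_sup.
move=> /ereal_sup_gt[_ [N _ <-] rN]; exists N => n Nn.
by apply: (lt_le_trans rN); apply: ereal_inf_lbound; exists n.
Qed.

Lemma limn_einf_ge u (a : K) :
  (forall r, 0 < r -> r < a -> exists N, forall n, (N <= n)%N -> (r%:E <= u n)%E) ->
  0 < a -> (a%:E <= limn_einf u)%E.
Proof.
move=> H a0.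
have -> : limn_einf u = ereal_sup (range (einfs u)).
  by rewrite limn_einf_lim; apply: cvg_lim => //; exact: cvg_einfs_sup.
apply/lee_addgt0Pr => e e0; rewrite -leeBlDr//.
have [ea|ae] := ltP e a.
  have [N HN] := H (a - e) ltac:(by rewrite subr_gt0) ltac:(by rewrite gtrBl).
  apply: (@le_trans _ _ (einfs u N)); last by apply: ereal_sup_ubound; exists N.
  by apply: le_ereal_inf_tmp => _ [n /= Nn <-]; exact: HN.
(* Here [a - e] is not positive and cannot be used as [r]; any admissible value exceeds it, for
   instance [a / 2]. *)
have a20 : 0 < a / 2 by rewrite divr_gt0.
have [N HN] := H (a / 2) a20 ltac:(by rewrite ltr_pdivrMr// ltr_pMr// ltr1n).
apply: (@le_trans _ _ (einfs u N)); last by apply: ereal_sup_ubound; exists N.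
apply: le_ereal_inf_tmp => _ [n /= Nn <-]; apply: le_trans (HN n Nn).
by rewrite lee_fin (le_trans _ (ltW a20))// subr_le0.
Qed.

Lemma geometric_unbounded (q A a : K) N : 1 < q -> 0 < a ->
  (forall n, (N <= n)%N -> q ^+ n * a <= A) -> False.
Proof.
move=> q1 a0 H; pose h := q - 1; have h0 : 0 < h by rewrite subr_gt0.
(* Bernoulli's inequality. *)
have B n : 1 + n%:R * h <= q ^+ n.
  elim: n => [|n IH]; first by rewrite mul0r addr0 expr0.
  have q0 : 0 <= q by rewrite ltW// (lt_trans ltr01).
  rewrite exprS; apply: le_trans (ler_wpM2l q0 IH).
  have -> : q = 1 + h by rewrite /h addrC subrK.
  have -> : (1 + h) * (1 + n%:R * h) = 1 + n.+1%:R * h + n%:R * h ^+ 2.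
    by rewrite -natr1; ring.
  by rewrite lerDl mulr_ge0// sqr_ge0.
pose n := maxn N (Num.truncn (`|A| / (h * a))).+1.
have := H n (leq_maxl _ _); apply/negP; rewrite -ltNge.
apply: (@lt_le_trans _ _ ((1 + n%:R * h) * a)); last by rewrite ler_wpM2r// ltW.
apply: (le_lt_trans (ler_norm _)).
apply: (@lt_le_trans _ _ (n%:R * h * a)); last by rewrite ler_wpM2r ?(ltW a0)// lerDr.
rewrite -mulrA -ltr_pdivrMr ?mulr_gt0//.
apply: (lt_le_trans (truncnS_gt _)); rewrite ler_nat; exact: leq_maxr.
Qed.

(** With [a = - ln q], the inverse of [q^n] is at least [(a n)^(k+1) / (k+1)!], and this exceeds
    [n^k] once [n >= (k+1)! / a^(k+1)]. *)
Lemma geometric_poly_le1 (q : K) k : 0 < q -> q < 1 ->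
  exists N, forall n, (N <= n)%N -> q ^+ n * n%:R ^+ k <= 1.
Proof.
move=> q0 q1; pose a := - ln q; have a0 : 0 < a by rewrite oppr_gt0 ln_lt0// q0.
have f0 : 0 < k.+1`!%:R :> K by rewrite ltr0n fact_gt0.
exists (Num.truncn (k.+1`!%:R / a ^+ k.+1)).+1 => n Nn.
have n0 : 0 < n%:R :> K by rewrite ltr0n (leq_trans _ Nn).
have -> : q ^+ n = (expR (a * n%:R))^-1.
  by rewrite -expRN -mulNr /a opprK mulrC expRM_natl lnK.
rewrite mulrC ler_pdivrMr ?expR_gt0// mul1r.
have an0 : 0 <= a * n%:R by rewrite mulr_ge0// ltW.
apply: le_trans (expR_ge1Dxn k an0).
apply: (@le_trans _ _ ((a * n%:R) ^+ k.+1 / k.+1`!%:R)); last by rewrite lerDr.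
rewrite ler_pdivlMr// exprMn [n%:R ^+ k.+1]exprS mulrA mulrC.
rewrite ler_wpM2r ?exprn_ge0// -ler_pdivrMl ?exprn_gt0// mulrC.
by apply: ltW; apply: (lt_le_trans (truncnS_gt _)); rewrite ler_nat.
Qed.

End LimInf.

(** * From the spectral condition to weighted bounds and back *)

Section PaleyWiener.
Variables (K : realType) (d : nat).
Implicit Types (f : 'rV[K]_d -> K[i]) (L : seq (K[i] * seq 'I_d)).

Lemma powR_root (a : K) n : (0 < n)%N -> 0 <= a -> (a `^ n%:R^-1) ^+ n = a.
Proof.
move=> n0 a0; rewrite -powR_mulrn ?powR_ge0// -powRrM mulVf ?powRr1//.
by rewrite pnatr_eq0 -lt0n.
Qed.

Lemma iter_opd_bound L (R : K) N f : (0 < d)%N -> 0 < R -> cschwartz f ->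
  (forall l, ftsf f l != 0 -> cabs (opsym L l) <= R) ->
  exists C : K, forall (n : nat) x, (0 < n)%N ->
    cabs (iter n (opd L) f x) <= C * n%:R ^+ N * R ^+ n * (1 + enorm x) ^- N.
Proof.
move=> d0 R0 sf fR.
(* With power 0 the choice of coordinate is immaterial; this is the plain supremum bound. *)
have [C0 C00 H0] := mulx_iter_bound (Ordinal d0) 0 R0 sf fR.
pose C j := s2val (cid2 (mulx_iter_bound j N R0 sf fR)).
have C0j j : 0 <= C j := s2valP (cid2 (mulx_iter_bound j N R0 sf fR)).
have HC j := s2valP' (cid2 (mulx_iter_bound j N R0 sf fR)).
(* The first factor comes from [exp_add_n1_le], the last from [n + 1 <= 2 n]. *)
exists (d.+1%:R ^+ N * (C0 + \sum_(j < d) C j) * 2 ^+ N) => n x n0.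
have e0 := add_enorm_gt0 x; have a0 := cabs_ge0 (iter n (opd L) f x).
rewrite ler_pdivlMr ?exprn_gt0// mulrC.
have Rn : 0 <= R ^+ n by rewrite exprn_ge0// ltW.
have nn : n.+1%:R ^+ N <= 2 ^+ N * n%:R ^+ N :> K.
  rewrite -exprMn lerXn2r ?nnegrE ?mulr_ge0//.
  by rewrite -natrM ler_nat mul2n -addnn -addn1 leq_add2l.
have n1N : 1 <= n.+1%:R ^+ N :> K by rewrite exprn_ege1// ler1n.
apply: (@le_trans _ _ (d.+1%:R ^+ N * (1 + \sum_(j < d) `|x 0 j| ^+ N) * cabs (iter n (opd L) f x))).
  rewrite ler_wpM2r//; apply: le_trans (exp_add_n1_le N x).
  by rewrite lerXn2r ?nnegrE ?(ltW e0) ?(ltW (add_n1_gt0 x ltr01))// lerD2l enorm_le_n1.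
apply: (@le_trans _ _ (d.+1%:R ^+ N * ((C0 + \sum_(j < d) C j) * (n.+1%:R ^+ N * R ^+ n)))).
  rewrite -mulrA ler_wpM2l ?exprn_ge0// mulrDl mul1r mulr_suml mulrDl mulr_suml; apply: lerD.
    have := H0 n x; rewrite !expr0 mul1r mulr1 => /le_trans; apply.
    by rewrite ler_wpM2l// ler_peMl.
  by apply: ler_sum => j _; rewrite mulrA; exact: HC.
rewrite -!mulrA; apply: ler_wpM2l; first by rewrite exprn_ge0.
apply: ler_wpM2l; first by rewrite addr_ge0// sumr_ge0.
by rewrite mulrA ler_wpM2r.
Qed.

Lemma opsym_le_of_bound L (R A : K) f (phi : nat -> K) l : 0 < R -> cschwartz f ->
  (forall n, (0 < n)%N -> 0 <= phi n) ->
  ((R^-1)%:E <= limn_einf (fun n => (phi n `^ n%:R^-1)%:E))%E ->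
  (forall n x, (0 < n)%N -> phi n * ((1 + enorm x) ^+ d.+1 * cabs (iter n (opd L) f x)) <= A) ->
  0 <= A -> ftsf f l != 0 -> cabs (opsym L l) <= R.
Proof.
move=> R0 sf phi0 liminf HA A0 fl; rewrite leNgt; apply/negP => Rp.
set p := cabs (opsym L l) in Rp; have p0 : 0 < p := lt_trans R0 Rp.
have B n : (0 < n)%N -> phi n * (p ^+ n * cabs (ftsf f l)) <= 2 * (A * d.+1%:R ^+ d.+1) * pi ^+ d.
  (* The value [phi n = 0] is allowed, and the bound is then trivial; otherwise one divides by
     [phi n]. *)
  move=> n0; have := phi0 n n0; rewrite le_eqVlt => /orP[/eqP<-|ph].
    by rewrite mul0r !mulr_ge0 ?exprn_ge0// pi_ge0.
  rewrite /p -cabsX -cabsM -ftsf_iter_opd// mulrC -ler_pdivlMr//.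
  rewrite (_ : _ / phi n = 2 * (A / phi n * d.+1%:R ^+ d.+1) * pi ^+ d); last by ring.
  apply: cabs_ftsf_le; first exact/cschwartz_cdecaying/cschwartz_iter_opd.
    by rewrite mulr_ge0 ?exprn_ge0// divr_ge0// ltW.
  move=> x; have x0 := add_n1_gt0 x ltr01; have e0 := add_enorm_gt0 x.
  rewrite ler_pdivlMr ?exprn_gt0//.
  apply: (@le_trans _ _ (cabs (iter n (opd L) f x) * (d.+1%:R ^+ d.+1 * (1 + enorm x) ^+ d.+1))).
    rewrite ler_wpM2l ?cabs_ge0// -exprMn lerXn2r ?nnegrE ?mulr_ge0 ?(ltW x0) ?(ltW e0)//.
    exact: add_n1_le_enorm.
  rewrite mulrCA mulrC ler_wpM2r ?exprn_ge0// ler_pdivlMr// mulrC.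
  by rewrite [X in _ * X]mulrC HA.
(* Strictly between [p^-1] and [R^-1]: eventually [phi n >= r^n], while [r p > 1] gives geometric
   growth. *)
pose r := (p^-1 + R^-1) / 2.
have pR : p^-1 < R^-1 by rewrite ltf_pV2.
have rR : r < R^-1 by rewrite /r; lra.
have pr : p^-1 < r by rewrite /r; lra.
have r0 : 0 < r by apply: lt_trans pr; rewrite invr_gt0.
have [N HN] := limn_einf_gt (lt_le_trans (rR : (r%:E < R^-1%:E)%E) liminf).
have fl0 : 0 < cabs (ftsf f l) by rewrite lt_neqAle cabs_ge0 andbT eq_sym cabs_eq0.
have q1 : 1 < r * p by rewrite -ltr_pdivrMr// mul1r.
apply: (@geometric_unbounded K (r * p) _ _ N.+1 q1 fl0) => n Nn.
have n0 : (0 < n)%N by rewrite (leq_trans _ Nn).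
apply: le_trans (B n n0); rewrite exprMn -mulrA ler_wpM2r ?mulr_ge0 ?exprn_ge0 ?cabs_ge0 ?(ltW p0)//.
rewrite -[leRHS](powR_root n0 (phi0 n n0)) lerXn2r ?nnegrE ?powR_ge0 ?(ltW r0)//.
by have := HN n (ltnW Nn); rewrite lte_fin => /ltW.
Qed.

End PaleyWiener.

(** * The three conditions in terms of the pointwise spectral condition *)

Section Equivalence.
Variables (K : realType) (d : nat) (P : cpoly K d) (f : 'rV[K]_d -> K[i]) (R : K).
Hypotheses (sf : cschwartz f) (R0 : 0 < R).

(** Forward, points with nonzero transform lie in the support. Backward, if a support point had
    symbol above [R], a test function supported in the open set where the symbol exceeds [R] would
    pair nontrivially with a transform that vanishes there. *)
Lemma Rsup_leP : ((Rsup P (regular_dist (fourier f)) <= R%:E)%E) <->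
  (forall l, ftsf f l != 0 -> cabs (symbol P l) <= R).
Proof.
split=> [H l fl|H].
  rewrite -lee_fin; apply: le_trans H; apply: ereal_sup_ubound; right.
  by exists l => //; exact: dsupp_fourier.
apply: ge_ereal_sup => _ [->|[l Tl <-]]; first by rewrite lee_fin ltW.
rewrite lee_fin leNgt; apply/negP => Rl.
have cc : continuous (fun m => cabs (symbol P m)).
  rewrite (_ : (fun m => _) = fun m => cabs (opsym (word_of_mpoly P) m)).
    exact/continuous_cabs/ccontinuous_opsym.
  by apply/funext => m; rewrite symbolE.
have oU : open [set m | R < cabs (symbol P m)].
  exact: (open_comp (fun m _ => cc m) (@open_gt K R)).
have [psi [_ sU]] := Tl _ oU Rl; apply/negP; rewrite negbK /regular_dist.
rewrite (_ : (fun x => _) = fun=> 0); last first.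
  apply/funext => x; have [->|fx] := eqVneq (psi x) 0; first by rewrite mulr0.
  have := sU x (@subset_closure _ [set y | psi y != 0] x fx); rewrite /= ltNge.
  have [/H ->//|] := boolP (ftsf f x != 0).
  by rewrite -fourier_neq0 negbK => /eqP ->; rewrite mul0r.
by rewrite /integralRd /Ref /Imf /= !Rintegral_cst// !mul0r.
Qed.

(** The extended supremum is finite because it is nonnegative, as its term at [n = 1], [x = 0]
    shows; its real value is the constant. *)
Lemma pdiff_bound_of_sup (phi : nat -> K) :
  (forall n, (0 < n)%N -> 0 <= phi n) ->
  (ereal_sup [set (phi n)%:E * supnorm (fun x => ((1 + enorm x) ^+ d.+1)%:C%C *
                               iter n (pdiff P) f x)%R
             | n in [set n | (0 < n)%N]] < +oo)%E ->
  exists2 A : K, 0 <= A & forall n x, (0 < n)%N ->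
    phi n * ((1 + enorm x) ^+ d.+1 * cabs (iter n (pdiff P) f x)) <= A.
Proof.
move=> phi0; set S := ereal_sup _ => Soo.
have HS n x : (0 < n)%N ->
    ((phi n * ((1 + enorm x) ^+ d.+1 * cabs (iter n (pdiff P) f x)))%:E <= S)%E.
  move=> n0; apply: le_trans (ereal_sup_ubound _); last by exists n.
  rewrite EFinM; apply: lee_wpmul2l; first by rewrite lee_fin phi0.
  apply: ereal_sup_ubound; exists x => //.
  by rewrite cabsM cabs_real ger0_norm// exprn_ge0// ltW// add_enorm_gt0.
have S0 : (0 <= S)%E.
  apply: le_trans (HS 1%N 0 isT); rewrite lee_fin !mulr_ge0 ?phi0 ?cabs_ge0//.
  by rewrite exprn_ge0// ltW// add_enorm_gt0.
have Sf : S \is a fin_num by rewrite ge0_fin_numE.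
exists (fine S); first by rewrite fine_ge0.
by move=> n x n0; rewrite -lee_fin fineK// HS.
Qed.

Lemma sup_bound_of_pdiff C : 
  (forall (n : nat) (x : 'rV[K]_d), (0 < n)%N ->
      cabs (iter n (pdiff P) f x)
        <= C * n%:R ^+ d.+1 * R ^+ n * (1 + enorm x) ^- d.+1) ->
  exists phi : nat -> K,
      [/\ forall n, (0 < n)%N -> 0 <= phi n,
          ((R^-1)%:E <= limn_einf (fun n => (phi n `^ n%:R^-1)%:E))%E &
          (ereal_sup [set (phi n)%:E *
             supnorm (fun x => ((1 + enorm x) ^+ d.+1)%:C%C *
                               iter n (pdiff P) f x)%R
             | n in [set n | (0 < n)%N]] < +oo)%E ].
Proof.
move=> HC; pose phi n : K := (R ^+ n * n%:R ^+ d.+1)^-1.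
have phi0 n : (0 < n)%N -> 0 < phi n.
  by move=> n0; rewrite invr_gt0 mulr_gt0 ?exprn_gt0 ?ltr0n.
exists phi; split; first by move=> n /phi0/ltW.
- apply: limn_einf_ge; last by rewrite invr_gt0.
  move=> r r0 rR; have q0 : 0 < r * R by rewrite mulr_gt0.
  have q1 : r * R < 1 by rewrite -ltr_pdivlMr// div1r.
  have [N HN] := geometric_poly_le1 d.+1 q0 q1.
  exists N.+1 => n Nn; have n0 : (0 < n)%N by rewrite (leq_trans _ Nn).
  (* Taking [n]-th powers turns the claim into [(r R)^n n^(d+1) <= 1], where [r R < 1]. *)
  rewrite lee_fin -(@ler_pXn2r _ n) ?nnegrE ?powR_ge0 ?(ltW r0)//.
  rewrite powR_root ?(ltW (phi0 n n0))// /phi -[leRHS]div1r.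
  rewrite ler_pdivlMr ?mulr_gt0 ?exprn_gt0 ?ltr0n// mulrA -exprMn.
  exact: HN (ltnW Nn).
apply: (@le_lt_trans _ _ C%:E); last exact: ltry.
apply: ge_ereal_sup => _ [n /= n0 <-].
have ph := phi0 n n0.
have M : (supnorm (fun x => ((1 + enorm x) ^+ d.+1)%:C%C * iter n (pdiff P) f x)%R
    <= (C / phi n)%:E)%E.
  apply: ge_ereal_sup => _ [x _ <-]; rewrite lee_fin cabsM cabs_real.
  have e0 := add_enorm_gt0 x.
  rewrite ger0_norm ?exprn_ge0 ?(ltW e0)// mulrC -ler_pdivlMr ?exprn_gt0//.
  apply: (le_trans (HC n x n0)); rewrite /phi invrK.
  by rewrite (_ : C * (R ^+ n * n%:R ^+ d.+1) = C * n%:R ^+ d.+1 * R ^+ n)//; ring.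
apply: (@le_trans _ _ ((phi n)%:E * (C / phi n)%:E)%E).
  by apply: lee_wpmul2l => //; rewrite lee_fin ltW.
by rewrite -EFinM mulrC mulfVK// gt_eqF.
Qed.

End Equivalence.

Theorem theorem2p2 (K : realType) (d : nat) (hd : (0 < d)%N)
  (P : cpoly K d) (f : 'rV[K]_d -> K[i]) (hf : schwartz f)
  (R : K) (hR : 0 < R) :
  [<->
    (* (a) *)
    exists phi : nat -> K,
      [/\ forall n, (0 < n)%N -> 0 <= phi n,
          ((R^-1)%:E <= limn_einf (fun n => (phi n `^ n%:R^-1)%:E))%E &
          (ereal_sup [set (phi n)%:E *
             supnorm (fun x => ((1 + enorm x) ^+ d.+1)%:C%C *
                               iter n (pdiff P) f x)%R
             | n in [set n | (0 < n)%N]] < +oo)%E ];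
    (* (b) *)
    forall N : nat, exists C : K, forall (n : nat) (x : 'rV[K]_d), (0 < n)%N ->
      cabs (iter n (pdiff P) f x)
        <= C * n%:R ^+ N * R ^+ n * (1 + enorm x) ^- N;
    (* (c) *)
    (Rsup P (regular_dist (fourier f)) <= R%:E)%E ].
Proof.
have sf := cschwartz_of_schwartz hf.
have E n : iter n (pdiff P) f = iter n (opd (word_of_mpoly P)) f.
  by apply: eq_iter => g; exact: pdiffE.
(* Both [ca] and [bc] are stated with the pointwise condition, so that (a) gives (b) by composition,
   without passing through the distributional support. *)
have ca (phi : nat -> K) : (forall n, (0 < n)%N -> 0 <= phi n) ->
    ((R^-1)%:E <= limn_einf (fun n => (phi n `^ n%:R^-1)%:E))%E ->
    (ereal_sup [set (phi n)%:E * supnorm (fun x => ((1 + enorm x) ^+ d.+1)%:C%C *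
       iter n (pdiff P) f x)%R | n in [set n | (0 < n)%N]] < +oo)%E ->
    forall l, ftsf f l != 0 -> cabs (symbol P l) <= R.
  move=> phi0 liminf /(pdiff_bound_of_sup phi0)[A A0 HA] l fl; rewrite symbolE.
  apply: (opsym_le_of_bound hR sf phi0 liminf _ A0 fl) => n x n0.
  by rewrite -E; exact: HA.
have bc : (forall l, ftsf f l != 0 -> cabs (symbol P l) <= R) -> forall N : nat,
    exists C : K, forall (n : nat) (x : 'rV[K]_d), (0 < n)%N ->
      cabs (iter n (pdiff P) f x) <= C * n%:R ^+ N * R ^+ n * (1 + enorm x) ^- N.
  move=> H N; have [l fl|C HC] := @iter_opd_bound K d (word_of_mpoly P) R N f hd hR sf.
    by rewrite -symbolE; exact: H.
  by exists C => n x n0; rewrite E; exact: HC.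
(* The cycle reuses the three natural implications: (b) reaches (c) through (a), and (c) reaches (a)
   through (b) with [N = d + 1]. *)
tfae.
- by move=> [phi [phi0 liminf supb]]; apply: bc; exact: (ca phi).
- move=> /(_ d.+1)[C /(sup_bound_of_pdiff hR)[phi [phi0 liminf supb]]].
  by apply/(Rsup_leP _ sf hR); exact: (ca phi).
- move=> /(Rsup_leP _ sf hR)/bc/(_ d.+1)[C HC].
  exact: (sup_bound_of_pdiff hR HC).
Qed.
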